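(* The Dirac operator $D=D_+\sigma_++D_0\sigma_0+D_-\sigma_-$ on $\mathcal{S}=\mathcal{S}_+\oplus\mathcal{S}_-$ has spectrum $$\mathrm{Spec}(D)=\left\{\pm\left(q^{-2}\nu^4[j]^2[j+1]^2+[j+\tfrac12]^2\right)^{1/2}~\Big|~j\in\mathbb{N}+\tfrac12\right\}$$ with multiplicities $2j+1$ (each of the two eigenvalues $\pm$ associated with $j$ has multiplicity $2j+1$).
   Context: Fix $0<q<1$, $[x]=\frac{q^x-q^{-x}}{q-q^{-1}}$, $\nu=q-q^{-1}$, $\mathbb{N}=\{0,1,2,\dots\}$. $\mathcal{A}[\mathrm{SU}_q(2)]$ is the unital $*$-algebra generated by $a,b,c,d$ with $ab=qba$, $ac=qca$, $bd=qdb$, $cd=qdc$, $bc=cb$, $ad=1+qbc$, $da=1+q^{-1}bc$, $a^*=d$, $b^*=-qc$, $c^*=-q^{-1}b$, $d^*=a$, and matrix coproduct $\Delta(a)=a\otimes a+b\otimes c$, $\Delta(b)=a\otimes b+b\otimes d$, $\Delta(c)=c\otimes a+d\otimes c$, $\Delta(d)=c\otimes b+d\otimes d$; it is $\mathbb{Z}$-graded with $\deg a=\deg c=1$, $\deg b=\deg d=-1$. $\mathcal{U}_q(\mathfrak{su}(2))$ is generated by $K^{\pm1},E,F$ with $K^{\pm1}E=q^{\pm1}EK^{\pm1}$, $K^{\pm1}F=q^{\mp1}FK^{\pm1}$, $[E,F]=(q-q^{-1})^{-1}(K^2-K^{-2})$, coproduct $\Delta(K^{\pm1})=K^{\pm1}\otimes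 K^{\pm1}$, $\Delta(E)=E\otimes K+K^{-1}\otimes E$, $\Delta(F)=F\otimes K+K^{-1}\otimes F$. The Hopf pairing with $\mathcal{A}[\mathrm{SU}_q(2)]$ is given by $(K^{\pm1},a)=q^{\mp1/2}$, $(K^{\pm1},d)=q^{\pm1/2}$, $(E,c)=(F,b)=1$, all others on generators zero; the left action is $X\triangleright p=p_{(1)}(X,p_{(2)})$. Casimir: $C_q=FE+\nu^{-2}(qK^2-2+q^{-1}K^{-2})-\tfrac14$. $L_-=q^{1/2}FK^{-1}$, $L_+=q^{-1/2}EK^{-1}$, $L_0=K^2+\nu^2q^{-1}FE-1$, $L_z=K^{-2}-1$; $D_\pm=L_\pm$, $D_0=L_0+q^{-2}L_z=q^{-1}\nu^2(C_q+\tfrac14-[\tfrac12]^2)$. $\mathcal{S}_\pm$ is the subspace of $\mathcal{A}[\mathrm{SU}_q(2)]$ of degree $\mp1$; elements of $\mathcal{S}$ are columns $(\psi_+,\psi_-)^{\rm tr}$. $\sigma_+=\begin{pmatrix}0&1\\0&0\end{pmatrix}$, $\sigma_0=\begin{pmatrix}1&0\\0&-1\end{pmatrix}$, $\sigma_-=\begin{pmatrix}0&0\\1&0\end{pmatrix}$ act on columns and $D_\pm,D_0$ act entrywise via $\triangleright$. Under the right action $p\triangleleft X=(X,p_{(1)})p_{(2)}$, each $\mathcal{S}_\pm$ is isomorphic to $\bigoplus_{j\in\mathbb{N}+1/2}V^j$ with $V^j$ the $(2j+1)$-dimensional spin-$j$ irreducible module; there are bases $|j,m\rangle_\pm$ ($j\in\mathbb{N}+\tfrac12$,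 $m=-j,\dots,j$) of $\mathcal{S}_\pm$ adapted to this decomposition, in which $$D|j,m\rangle_\pm=\pm q^{-1}\nu^2[j][j+1]\,|j,m\rangle_\pm+[j+\tfrac12]\,|j,m\rangle_\mp .$$ $\mathcal{S}$ carries the inner product making the $|j,m\rangle_\pm$ orthonormal and $\mathcal{H}$ is its completion. *)

(* Defs.v *)
From HB Require Import structures.
From mathcomp Require Import all_boot all_order all_algebra.
From mathcomp Require Import sesquilinear ring_quotient generic_quotient finmap.
From mathcomp Require Import all_classical all_reals all_analysis.
From mathcomp Require Import complex.
From mathcomp Require monalg.
(* the notations of monalg are incompatible with those of analysis *)
Import -(notations) monalg.
Import Order.TTheory GRing.Theory Num.Theory numFieldNormedType.Exports.

Set Implicit Arguments.
Unset Strict Implicit.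
Unset Printing Implicit Defensive.

Local Open Scope classical_set_scope.
Local Open Scope ring_scope.
Local Open Scope quotient_scope.

Section Presented.
Context (C : fieldType) (G : choiceType).

Definition free_alg := malg (fmonom G) C.
HB.instance Definition _ := GRing.Lalgebra.on free_alg.

Definition word (w : seq G) : free_alg := mkmalgU (FMonom w) 1.
Definition gen (g : G) : free_alg := word [:: g].

Definition linear_ext (V : lmodType C) (f : seq G -> V) (x : free_alg) : V :=
  \sum_(w <- msupp x) mcoeff w x *: f w.

Variable rels : seq free_alg.

Inductive two_sided_ideal : free_alg -> Prop :=
| Ideal0 : two_sided_ideal 0
| IdealD x y : two_sided_ideal x -> two_sided_ideal y -> two_sided_ideal (x + y)
| IdealM l r x : r \in rels -> two_sided_ideal (l * r * x).

Definition ideal_pred (x : free_alg) : bool := `[< two_sided_ideal x >].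

Lemma idealP x : reflect (two_sided_ideal x) (x \in ideal_pred).
Proof. exact: asboolP. Qed.

Lemma ideal_mull x y : two_sided_ideal y -> two_sided_ideal (x * y).
Proof.
elim=> [|y1 y2 _ ? _ ?|l r z rP]; first by rewrite mulr0; exact: Ideal0.
  by rewrite mulrDr; exact: IdealD.
by rewrite !mulrA; exact: IdealM.
Qed.

Lemma ideal_mulr x y : two_sided_ideal y -> two_sided_ideal (y * x).
Proof.
elim=> [|y1 y2 _ ? _ ?|l r z rP]; first by rewrite mul0r; exact: Ideal0.
  by rewrite mulrDl; exact: IdealD.
by rewrite -[l * r * z * x]mulrA; exact: IdealM.
Qed.

Lemma ideal_zmod_closed : zmod_closed ideal_pred.
Proof.
split=> [|x y /idealP xI /idealP yI]; first exact/idealP/Ideal0.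
by apply/idealP/IdealD => //; rewrite -mulN1r; exact: ideal_mull.
Qed.

HB.instance Definition _ :=
  GRing.isZmodClosed.Build free_alg ideal_pred ideal_zmod_closed.

Definition presented := 
  Quotient.quot (GRing.ZmodClosed.clone free_alg ideal_pred _).
HB.instance Definition _ := GRing.Zmodule.on presented.

Definition cls (x : free_alg) : presented := \pi_(presented) x.

Lemma clsP x y : cls x = cls y <-> two_sided_ideal (x - y).
Proof.
rewrite /cls; split.
  by move/eqP; rewrite -Quotient.idealrBE => /idealP.
by move=> /idealP; rewrite Quotient.idealrBE => /eqP.
Qed.

Lemma reprP (x : presented) : cls (repr x) = x.
Proof. exact: reprK. Qed.

Lemma clsD x y : cls (x + y) = cls x + cls y.
Proof. by rewrite /cls !piE. Qed.

Definition one_presented : presented := cls 1.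
Definition mul_presented (x y : presented) : presented := cls (repr x * repr y).
Definition scale_presented (k : C) (x : presented) : presented :=
  cls (k *: repr x).

Lemma repr_cls x : two_sided_ideal (repr (cls x) - x).
Proof. by apply/clsP; rewrite reprP. Qed.

Lemma clsM x y : mul_presented (cls x) (cls y) = cls (x * y).
Proof.
apply/clsP; set x' := repr _; set y' := repr _.
have -> : x' * y' - x * y = (x' - x) * y' + x * (y' - y).
  by rewrite mulrBl mulrBr addrA subrK.
by apply: IdealD; [apply: ideal_mulr|apply: ideal_mull]; exact: repr_cls.
Qed.

Lemma clsZ k x : scale_presented k (cls x) = cls (k *: x).
Proof.
apply/clsP; rewrite -scalerBr -[_ - x]mul1r scalerAl.
exact/ideal_mull/repr_cls.
Qed.

Lemma presentedP (P : presented -> Prop) : (forall x, P (cls x)) -> forall x, P x.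
Proof. by move=> PC x; rewrite -[x]reprP. Qed.

Lemma mulpA : associative mul_presented.
Proof.
elim/presentedP=> x; elim/presentedP=> y; elim/presentedP=> z.
by rewrite !clsM mulrA.
Qed.

Lemma mul1p : left_id one_presented mul_presented.
Proof. by elim/presentedP=> x; rewrite clsM mul1r. Qed.

Lemma mulp1 : right_id one_presented mul_presented.
Proof. by elim/presentedP=> x; rewrite clsM mulr1. Qed.

Lemma mulpDl : left_distributive mul_presented +%R.
Proof.
elim/presentedP=> x; elim/presentedP=> y; elim/presentedP=> z.
by rewrite -clsD !clsM -clsD mulrDl.
Qed.

Lemma mulpDr : right_distributive mul_presented +%R.
Proof.
elim/presentedP=> x; elim/presentedP=> y; elim/presentedP=> z.
by rewrite -clsD !clsM -clsD mulrDr.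
Qed.

HB.instance Definition _ := GRing.Zmodule_isPzRing.Build presented
  mulpA mul1p mulp1 mulpDl mulpDr.

Lemma scalepA a b v :
  scale_presented a (scale_presented b v) = scale_presented (a * b) v.
Proof. by elim/presentedP: v => x; rewrite !clsZ scalerA. Qed.

Lemma scale1p : left_id 1 scale_presented.
Proof. by elim/presentedP=> x; rewrite clsZ scale1r. Qed.

Lemma scalepDr : right_distributive scale_presented +%R.
Proof.
by move=> a; elim/presentedP=> x; elim/presentedP=> y;
  rewrite -clsD !clsZ -clsD scalerDr.
Qed.

Lemma scalepDl v : {morph scale_presented^~ v : a b / a + b}.
Proof.
by elim/presentedP: v => x a b; rewrite !clsZ -clsD scalerDl.
Qed.

HB.instance Definition _ := GRing.Zmodule_isLmodule.Build C presented
  scalepA scale1p scalepDr scalepDl.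

End Presented.

Inductive sgen := Ga | Gb | Gc | Gd.

Definition sgen_code x : 'I_4 :=
  inord (match x with Ga => 0 | Gb => 1 | Gc => 2 | Gd => 3 end).
Definition sgen_decode (i : 'I_4) :=
  match val i with 0 => Ga | 1 => Gb | 2 => Gc | _ => Gd end%N.
Lemma sgen_codeK : cancel sgen_code sgen_decode.
Proof. by case; rewrite /sgen_decode /= inordK. Qed.
HB.instance Definition _ := Finite.copy sgen (can_type sgen_codeK).

Inductive ugen := GK | GKi | GE | GF.

Definition ugen_code x : 'I_4 :=
  inord (match x with GK => 0 | GKi => 1 | GE => 2 | GF => 3 end).
Definition ugen_decode (i : 'I_4) :=
  match val i with 0 => GK | 1 => GKi | 2 => GE | _ => GF end%N.
Lemma ugen_codeK : cancel ugen_code ugen_decode.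
Proof. by case; rewrite /ugen_decode /= inordK. Qed.
HB.instance Definition _ := Finite.copy ugen (can_type ugen_codeK).

(* Sweedler notation: an element of a tensor square is given as a finite list *)
(* of pairs, standing for the sum of the corresponding elementary tensors.    *)

Definition cop_sgen (x : sgen) : seq (sgen * sgen) :=
  match x with
  | Ga => [:: (Ga, Ga); (Gb, Gc)]
  | Gb => [:: (Ga, Gb); (Gb, Gd)]
  | Gc => [:: (Gc, Ga); (Gd, Gc)]
  | Gd => [:: (Gc, Gb); (Gd, Gd)]
  end.

Fixpoint cop_sword (w : seq sgen) : seq (seq sgen * seq sgen) :=
  if w is x :: w' then
    [seq (y.1 :: s.1, y.2 :: s.2) | y <- cop_sgen x, s <- cop_sword w']
  else [:: ([::], [::])].

Definition cop_ugen (X : ugen) : seq (ugen * ugen) :=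
  match X with
  | GK => [:: (GK, GK)]
  | GKi => [:: (GKi, GKi)]
  | GE => [:: (GE, GK); (GKi, GE)]
  | GF => [:: (GF, GK); (GKi, GF)]
  end.

Definition deg_sgen (x : sgen) : int :=
  match x with Ga | Gc => 1 | Gb | Gd => -1 end.
Definition deg_sword (w : seq sgen) : int := \sum_(x <- w) deg_sgen x.

Section Hopf.
Context (R : realType) (q : R).
Local Notation C := (R[i]).

Definition nu : R := q - q^-1.
Definition qnum (x : R) : R := (q `^ x - q `^ (- x)) / (q - q^-1).

Definition SUq2_rels : seq (free_alg C sgen) :=
  let a := gen C Ga in let b := gen C Gb in
  let c := gen C Gc in let d := gen C Gd in
  [:: a * b - q%:C%C *: (b * a);
      a * c - q%:C%C *: (c * a);
      b * d - q%:C%C *: (d * b);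
      c * d - q%:C%C *: (d * c);
      b * c - c * b;
      a * d - (1 + q%:C%C *: (b * c));
      d * a - (1 + (q^-1)%:C%C *: (b * c))].

Definition SUq2 := presented SUq2_rels.
HB.instance Definition _ := GRing.Lmodule.on SUq2.
HB.instance Definition _ := GRing.PzRing.on SUq2.

Definition Uq_rels : seq (free_alg C ugen) :=
  let K := gen C GK in let Ki := gen C GKi in
  let E := gen C GE in let F := gen C GF in
  [:: K * Ki - 1;
      Ki * K - 1;
      K * E - q%:C%C *: (E * K);
      Ki * E - (q^-1)%:C%C *: (E * Ki);
      K * F - (q^-1)%:C%C *: (F * K);
      Ki * F - q%:C%C *: (F * Ki);
      E * F - F * E - ((q - q^-1)^-1)%:C%C *: (K ^+ 2 - Ki ^+ 2)].

Definition Uq := presented Uq_rels.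
HB.instance Definition _ := GRing.Lmodule.on Uq.
HB.instance Definition _ := GRing.PzRing.on Uq.

Definition counit_sgen (x : sgen) : C :=
  match x with Ga | Gd => 1 | Gb | Gc => 0 end.
Definition counit_ugen (X : ugen) : C :=
  match X with GK | GKi => 1 | GE | GF => 0 end.

(* The Hopf pairing, from its values on generators up to arbitrary words, by  *)
(*   (X, 1) = eps(X),    (X, p r) = (X_(1), p) (X_(2), r),                    *)
(*   (1, p) = eps(p),    (X Y, p) = (X, p_(1)) (Y, p_(2)).                    *)

Definition pair_gen (X : ugen) (x : sgen) : C :=
  match X, x with
  | GK, Ga => (q `^ (- 2^-1))%:C%C
  | GK, Gd => (q `^ (2^-1))%:C%C
  | GKi, Ga => (q `^ (2^-1))%:C%C
  | GKi, Gd => (q `^ (- 2^-1))%:C%C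
  | GE, Gc => 1
  | GF, Gb => 1
  | _, _ => 0
  end.

Fixpoint pair_ugen (X : ugen) (w : seq sgen) : C :=
  if w is x :: w' then
    \sum_(Y <- cop_ugen X) pair_gen Y.1 x * pair_ugen Y.2 w'
  else counit_ugen X.

Fixpoint pair_uword (X : seq ugen) (w : seq sgen) : C :=
  if X is Y :: X' then
    \sum_(s <- cop_sword w) pair_ugen Y s.1 * pair_uword X' s.2
  else \prod_(x <- w) counit_sgen x.

Definition pairing_free (X : free_alg C ugen) (p : free_alg C sgen) : C :=
  linear_ext (fun v => linear_ext (fun w => pair_uword v w : C^o) p) X.

(* The pairing and the two actions below respect the relations of both        *)
(* algebras, so that evaluating them on representatives is harmless.          *)

Definition pairing (X : Uq) (p : SUq2) : C := pairing_free (repr X) (repr p).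

Definition lact (X : Uq) (p : SUq2) : SUq2 :=
  linear_ext (fun w => \sum_(s <- cop_sword w)
    pairing X (cls SUq2_rels (word C s.2)) *: cls SUq2_rels (word C s.1))
  (repr p).

Definition ract (p : SUq2) (X : Uq) : SUq2 :=
  linear_ext (fun w => \sum_(s <- cop_sword w)
    pairing X (cls SUq2_rels (word C s.1)) *: cls SUq2_rels (word C s.2))
  (repr p).

Definition uK : Uq := cls Uq_rels (gen C GK).
Definition uKi : Uq := cls Uq_rels (gen C GKi).
Definition uE : Uq := cls Uq_rels (gen C GE).
Definition uF : Uq := cls Uq_rels (gen C GF).

Definition Lminus : Uq := (q `^ (2^-1))%:C%C *: (uF * uKi).
Definition Lplus : Uq := (q `^ (- 2^-1))%:C%C *: (uE * uKi).
Definition Lzero : Uq := uK ^+ 2 + (nu ^+ 2 * q^-1)%:C%C *: (uF * uE) - 1.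
Definition Lz : Uq := uKi ^+ 2 - 1.

Definition Dminus : Uq := Lminus.
Definition Dplus : Uq := Lplus.
Definition Dzero : Uq := Lzero + (q ^- 2)%:C%C *: Lz.

Definition degree_part (n : int) : set SUq2 :=
  [set cls SUq2_rels p | p in
    [set p | forall w : fmonom sgen, mcoeff w p != 0 -> deg_sword w = n]].

(* [true] stands for the sign +, [false] for the sign -. *)
Definition Spm (s : bool) : set SUq2 := degree_part (if s then -1 else 1).

(* Columns (psi_+, psi_-)^tr. *)
Definition column := {ffun 'I_2 -> SUq2}.
HB.instance Definition _ := GRing.Lmodule.on column.

Definition pos (s : bool) : 'I_2 := if s then ord0 else ord_max.

Definition inS (s : bool) (p : SUq2) : column :=
  [ffun i => if i == pos s then p else 0].

Definition Spinor : set column := [set psi | forall s, Spm s (psi (pos s))].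

Definition sigma_plus : 'M[C]_2 := delta_mx ord0 ord_max.
Definition sigma_zero : 'M[C]_2 :=
  delta_mx ord0 ord0 - delta_mx ord_max ord_max.
Definition sigma_minus : 'M[C]_2 := delta_mx ord_max ord0.

Definition op_sigma (X : Uq) (M : 'M[C]_2) (psi : column) : column :=
  [ffun i => \sum_j M i j *: lact X (psi j)].

Definition Dirac (psi : column) : column :=
  op_sigma Dplus sigma_plus psi + op_sigma Dzero sigma_zero psi
  + op_sigma Dminus sigma_minus psi.

(* Half-integers j = k + 1/2 are indexed by k : nat, and the values           *)
(* m = - j + i, for i = 0, ..., 2 j, by i < 2 j + 1 = 2 k + 2.                *)

Definition jval (k : nat) : R := k%:R + 2^-1.
Definition mval (k i : nat) : R := i%:R - jval k.
Definition mult (k : nat) : nat := k.+1.*2.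

Definition ket_basis (S : set SUq2) (e : nat -> nat -> SUq2) :=
  [/\ forall k i, (i < mult k)%N -> S (e k i),
      forall p, S p -> exists (N : nat) (c : nat -> nat -> C),
        p = \sum_(k < N) \sum_(i < mult k) c k i *: e k i
    & forall (N : nat) (c : nat -> nat -> C),
        \sum_(k < N) \sum_(i < mult k) c k i *: e k i = 0 ->
        forall k i, (k < N)%N -> (i < mult k)%N -> c k i = 0].

(* For each j, the vectors e k i (i < 2 j + 1) form the standard basis of a   *)
(* right module V^j. The coefficients of the terms whose second index leaves  *)
(* the range vanish.                                                          *)
Definition standard_right (e : nat -> nat -> SUq2) :=
  forall k i, (i < mult k)%N -> let j := jval k in let m := mval k i in
  [/\ ract (e k i) uK = (q `^ m)%:C%C *: e k i,
      ract (e k i) uE =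
        (Num.sqrt (qnum (j + m) * qnum (j - m + 1)))%:C%C *: e k i.-1
    & ract (e k i) uF =
        (Num.sqrt (qnum (j - m) * qnum (j + m + 1)))%:C%C *: e k i.+1].

Definition adapted_kets (ket : bool -> nat -> nat -> SUq2) :=
  [/\ forall s, ket_basis (Spm s) (ket s),
      forall s, standard_right (ket s)
    & forall s k i, (i < mult k)%N -> let j := jval k in
        Dirac (inS s (ket s k i)) =
          ((if s then 1 else -1)
             * (q^-1 * nu ^+ 2 * qnum j * qnum (j + 1)))%:C%C
              *: inS s (ket s k i)
          + (qnum (j + 2^-1))%:C%C *: inS (~~ s) (ket (~~ s) k i)].

(* H, with scalar product dot, is the completion, via iota, of Spinor for the *)
(* inner product making the kets orthonormal.                                 *)
Definition spinor_completion (ket : bool -> nat -> nat -> SUq2)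
    (H : completeNormedModType C) (dot : {dot H for @Num.conj C})
    (iota : column -> H) :=
  [/\ forall x : H, `|x| ^+ 2 = dot x x,
      forall (c : C) psi phi, Spinor psi -> Spinor phi ->
        iota (c *: psi + phi) = c *: iota psi + iota phi,
      forall s k i s' k' i', (i < mult k)%N -> (i' < mult k')%N ->
        dot (iota (inS s (ket s k i))) (iota (inS s' (ket s' k' i'))) =
          ((s, k, i) == (s', k', i'))%:R
    & dense (iota @` Spinor)].

Definition Dirac_graph (H : completeNormedModType C) (iota : column -> H) :
    set (H * H) :=
  [set (iota psi, iota (Dirac psi)) | psi in Spinor].

Definition Dirac_ev (k : nat) : R :=
  let j := jval k in
  Num.sqrt (q ^- 2 * nu ^+ 4 * qnum j ^+ 2 * qnum (j + 1) ^+ 2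
            + qnum (j + 2^-1) ^+ 2).

End Hopf.

(* An unbounded operator on H is given by its graph, a subset of H * H. *)
Section Spectrum.
Context (K : numFieldType) (H : completeNormedModType K).

(* z is in the resolvent set of T when T - z has an everywhere defined        *)
(* bounded inverse Rz.                                                        *)
Definition resolvent_set (T : set (H * H)) : set K :=
  [set z | exists Rz : {linear H -> H},
    [/\ continuous Rz,
        forall y, T (Rz y, y + z *: Rz y)
      & forall x y, T (x, y) -> Rz (y - z *: x) = x]].

Definition spectrum (T : set (H * H)) : set K := ~` resolvent_set T.

Definition graph_eigenspace (T : set (H * H)) (z : K) : set H :=
  [set x | T (x, z *: x)].

Definition has_dimension (E : set H) (n : nat) :=
  exists v : 'I_n -> H,
    (forall x, E x <-> exists c : 'I_n -> K, x = \sum_i c i *: v i) /\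
    (forall c : 'I_n -> K, \sum_i c i *: v i = 0 -> forall i, c i = 0).

End Spectrum.

(* Main.v *)
(* Put s = q^(1/2). The left and right actions of U_q commute, and the vectors    *)
(* E^l |> a^n <| F^r span A[SU_q(2)]: their span is stable under multiplication   *)
(* by d, hence by the other generators, which are q-commutators of d with         *)
(* operators of the actions. In degree -1 or 1 only n = 2 j with j half-integral  *)
(* and one value of l occur; the Casimir operator has distinct eigenvalues        *)
(* [j + 1/2]^2 on different j, and K on the right separates the rest, so these    *)
(* vectors are free. Normalised, they are the kets, and D acts on the plane       *)
(* spanned by |j,m>_+ and |j,m>_- as the matrix [[alpha, beta], [beta, -alpha]]   *)
(* with alpha = q^-1 nu^2 [j][j+1] and beta = [j + 1/2], whose eigenvalues are    *)
(* lambda and -lambda for lambda = sqrt (alpha^2 + beta^2). Since lambda strictly *)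
(* increases to infinity with j, the closure of D is the diagonal operator of an  *)
(* orthonormal basis of eigenvectors, with discrete spectrum.                     *)

Require Import Defs.
From HB Require Import structures.
From mathcomp Require Import all_boot all_order all_algebra sesquilinear finmap.
From mathcomp Require Import all_classical all_reals all_analysis complex ring zify.
From mathcomp Require monalg.
Import -(notations) monalg.
Import Order.TTheory GRing.Theory Num.Theory numFieldNormedType.Exports.

Set Implicit Arguments.
Unset Strict Implicit.
Unset Printing Implicit Defensive.

Local Open Scope classical_set_scope.
Local Open Scope ring_scope.

(** * Algebras presented by generators and relations *)

(** The Peter-Weyl decomposition of A[SU_q(2)] cuts $D$ into 2x2 blocks, and the spectrum is then
    that of a diagonal operator with discrete eigenvalues.

    Algebra. Each generator of U_q acts from the left and from the right by an operator obeying a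
    twisted Leibniz rule. The rule preserves the seven relations ([act_rel_ab] to [act_rel_da]), so
    the operators descend to the quotient ([ideal_twisted]); by coassociativity the two sides
    commute ([act_comm]). The power a^n is a lowest weight vector on both sides, so the vectors
    [vec n l r] form ladders in l and in r, with lowering coefficients [l+1] [n-l] ([L_upv],
    [low_coefE]). They span, because their span is stable under left multiplication by the
    generators ([vec_span_word]); those of degree 1 or -1 are free, because the Casimir and the
    right K separate them ([vec_free]). On the two normalised copies of V^j, the operators D_+ and
    D_- exchange the copies with coefficient [j+1/2], while D_0, a function of the Casimir, acts on
    both by one scalar ([D0_ket]). This gives [adapted_kets_exist].

    Analysis. For arbitrary adapted kets, $D$ acts on the plane of |j,m>_+ and |j,m>_- by a
    symmetric traceless matrix with entries alpha and beta, whose square is alpha^2 + beta^2; a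
    rotation by half the angle diagonalises it. The rotated vectors are an orthonormal family with
    dense span, and coordinates of the closure of $D$ are multiplied by the eigenvalues
    ([level_graph], [graph_coef]). Since the eigenvalues tend to infinity, any z that is not one of
    them keeps a positive distance from all of them, and the diagonal operator with entries 1 /
    (lambda - z) is a bounded inverse ([resolvent_bounded], [diag_spectrum]). Since they increase
    strictly with j ([Dirac_ev_mono]), different j never share an eigenvalue, and the multiplicity
    is the number of values of m ([eigval_eq], [diag_eigenspace]). *)

Section FreeAlgebra.
Context (C : fieldType) (G : choiceType).
Local Notation F := (free_alg C G).

Lemma mul_word (u v : seq G) : word C u * word C v = word C (u ++ v) :> F.
Proof. by rewrite /word malgM_def fgmulUU mulr1 /mul /= fmmulE. Qed.

Lemma word_nil : word C [::] = 1 :> F.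
Proof. rewrite /word /GRing.one /= /fgone; congr (mkmalgU _ _); exact: esym (fmoneE _). Qed.

Lemma free_algE (x : F) : x = \sum_(w <- msupp x) mcoeff w x *: word C w.
Proof.
rewrite {1}(monalgE x); apply: eq_bigr => w _; apply/malgP => k.
by rewrite mcoeffZ !mcoeffU /= fmK; case: eqP => _; rewrite ?mulr1 ?mulr0.
Qed.

Lemma free_alg_ind (P : F -> Prop) :
  P 0 -> (forall x y, P x -> P y -> P (x + y)) ->
  (forall c w, P (c *: word C w)) -> forall x, P x.
Proof.
move=> P0 PD Pw x; rewrite (free_algE x).
by elim/big_rec: _ => // w y _; exact: PD.
Qed.

Section LinearExt.
Context (V : lmodType C) (f : seq G -> V).

Lemma linear_extE (d : {fset fmonom G}) (x : F) : (msupp x `<=` d)%fset ->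
  linear_ext f x = \sum_(w <- d) mcoeff w x *: f w.
Proof.
move=> xd; rewrite /linear_ext; apply: (big_fset_incl (idx := 0 : V)) => // w wd.
by move=> /mcoeff_outdom ->; rewrite scale0r.
Qed.

Lemma linear_ext_is_linear : linear (linear_ext f : F -> V).
Proof.
move=> c x y.
pose d := (msupp (c *: x + y)%R `|` (msupp x `|` msupp y))%fset.
rewrite (linear_extE (d := d)) ?fsubsetUl //.
rewrite [linear_ext f x](linear_extE (d := d)); last first.
  by rewrite /d fsetUA fsetUC fsetUA fsubsetUr.
rewrite [linear_ext f y](linear_extE (d := d)); last by rewrite /d fsetUA fsubsetUr.
rewrite scaler_sumr -big_split; apply: eq_bigr => w _ /=.
by rewrite mcoeffD mcoeffZ scalerDl scalerA.
Qed.
HB.instance Definition _ :=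
  GRing.isLinear.Build C F V *:%R (linear_ext f) linear_ext_is_linear.

Lemma linear_ext_word w : linear_ext f (word C w) = f w.
Proof.
by rewrite /linear_ext /word msuppU oner_eq0 big_seq_fset1 mcoeffUU scale1r.
Qed.
End LinearExt.

Lemma linear_ext_malgU (V : lmodType C) (f : seq G -> V) (m : fmonom G) (c : C) :
  linear_ext f (mkmalgU m c) = c *: f m.
Proof.
rewrite (@linear_extE _ f [fset m]%fset) ?big_seq_fset1 ?mcoeffUU //.
exact: msuppU_le.
Qed.

Lemma free_alg_mulE (x y : F) : x * y =
  \sum_(u <- msupp x) \sum_(v <- msupp y)
    mkmalgU (FMonom (u ++ v)) (mcoeff u x * mcoeff v y) :> F.
Proof.
have /= -> := malgME (x : malg _ _) y.
by apply: eq_bigr => u _; apply: eq_bigr => v _; rewrite /mul /= fmmulE.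
Qed.

(** A rule for products known on concatenated words extends bilinearly to the free algebra. With r
    the list of terms of a coproduct this is a twisted Leibniz rule; with one term it is
    multiplicativity. *)
Lemma linear_extM (A : algType C) (I : Type) (r : seq I) (f : seq G -> A)
    (g h : I -> seq G -> A) :
    (forall u v, f (u ++ v) = \sum_(i <- r) g i u * h i v) ->
  forall x y, linear_ext f (x * y) =
    \sum_(i <- r) linear_ext (g i) x * linear_ext (h i) y.
Proof.
move=> fM x y; rewrite free_alg_mulE linear_sum /=.
under eq_bigr => u _ do (rewrite linear_sum /=;
  under eq_bigr => v _ do (rewrite linear_ext_malgU /= fM scaler_sumr;
    under eq_bigr => i _ do rewrite -scalerA scalerAr scalerAl)).
under eq_bigr => u _ do rewrite exchange_big /=.
rewrite exchange_big /=; apply: eq_bigr => i _.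
by rewrite mulr_suml; apply: eq_bigr => u _; rewrite mulr_sumr.
Qed.

Lemma scale_wordE (c : C) (w : seq G) : c *: word C w = mkmalgU (FMonom w) c :> F.
Proof.
apply/malgP => k; rewrite mcoeffZ mcoeffU mcoeffU.
by case: (_ == _); rewrite /= ?mulr1 ?mulr0.
Qed.

Lemma free_scaleAl (c : C) (x y : F) : c *: (x * y) = (c *: x) * y.
Proof. exact: scalerAl. Qed.

Lemma free_scaleAr (c : C) (x y : F) : c *: (x * y) = x * (c *: y).
Proof.
rewrite (free_alg_mulE x (c *: y)) (free_alg_mulE x y) scaler_sumr.
apply: eq_bigr => u _; rewrite scaler_sumr.
(* Scaling by 0 shrinks the support, so both sums are taken over the support of y. *)
rewrite [RHS](big_fset_incl _ (B := msupp y)) ?msuppZ_le //=; last first.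
  by move=> v _ /mcoeff_outdom ->; rewrite mulr0 monalgU0.
apply: eq_bigr => v _; rewrite mcoeffZ -scale_wordE -scale_wordE scalerA.
by rewrite mulrCA.
Qed.
End FreeAlgebra.

Section PresentedTheory.
Context (C : fieldType) (G : choiceType) (rels : seq (free_alg C G)).
Local Notation F := (free_alg C G).
Local Notation P := (presented rels).

Lemma cls_is_linear : linear (cls rels : F -> P).
Proof. by move=> c x y; rewrite clsD -clsZ. Qed.
HB.instance Definition _ := GRing.isLinear.Build C F P *:%R (cls rels) cls_is_linear.

Lemma clsMr (x y : F) : cls rels (x * y) = (cls rels x : P) * cls rels y.
Proof. by rewrite -clsM. Qed.

Lemma presented_scaleAl (c : C) (x y : P) : c *: (x * y) = (c *: x) * y.
Proof.
elim/presentedP: x => x; elim/presentedP: y => y.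
by rewrite -clsMr -!linearZ -clsMr free_scaleAl.
Qed.

Lemma presented_scaleAr (c : C) (x y : P) : c *: (x * y) = x * (c *: y).
Proof.
elim/presentedP: x => x; elim/presentedP: y => y.
by rewrite -clsMr -!linearZ -clsMr free_scaleAr.
Qed.

Lemma presented_ind (Q : P -> Prop) :
  Q 0 -> (forall x y, Q x -> Q y -> Q (x + y)) ->
  (forall c w, Q (c *: (cls rels (word C w) : P))) -> forall x, Q x.
Proof.
move=> Q0 QD Qw; elim/presentedP=> x; elim/free_alg_ind: x => [|x y Qx Qy|c w].
- by rewrite linear0.
- by rewrite linearD; exact: QD.
- by rewrite linearZ; exact: Qw.
Qed.

Lemma ideal_linear (V : lmodType C) (f : {linear F -> V}) :
  (forall l r x, r \in rels -> f (l * r * x) = 0) ->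
  forall x, two_sided_ideal rels x -> f x = 0.
Proof.
move=> f0 x; elim=> [|y z _ fy _ fz|]; first by rewrite linear0.
  by rewrite linearD fy fz addr0.
exact: f0.
Qed.

(** The maps need not be multiplicative one by one: expanding f i (l * r * x) twice, each term
    contains some f k evaluated at the relator r. *)
Lemma ideal_twisted (A : algType C) (I : Type) (cop : I -> seq (I * I))
    (f : I -> {linear F -> A}) :
    (forall i x y, f i (x * y) = \sum_(j <- cop i) f j.1 x * f j.2 y) ->
    (forall i r, r \in rels -> f i r = 0) ->
  forall i x, two_sided_ideal rels x -> f i x = 0.
Proof.
move=> fM f0 i; apply: ideal_linear => l r x rP.
rewrite fM big1 // => j _; rewrite fM big1 ?mul0r // => k _.
by rewrite (f0 _ r) ?mulr0.
Qed.

(** Maps on the quotient are defined through [repr]; this is how they are computed on a given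
    class. *)
Lemma repr_linear (V : lmodType C) (f : {linear F -> V}) :
  (forall x, two_sided_ideal rels x -> f x = 0) ->
  forall x, f (repr (cls rels x : P)) = f x.
Proof. by move=> f0 x; apply/eqP; rewrite -subr_eq0 -linearB f0 //; exact: repr_cls. Qed.

Lemma lift_is_linear (V : lmodType C) (f : {linear F -> V}) :
  (forall x, two_sided_ideal rels x -> f x = 0) ->
  linear (fun x : P => f (repr x)).
Proof.
move=> f0 k; elim/presentedP=> x; elim/presentedP=> y.
by rewrite -linearP !repr_linear // linearP.
Qed.

End PresentedTheory.

Lemma mem_seq7 (T : eqType) (P : T -> Prop) (x1 x2 x3 x4 x5 x6 x7 r : T) :
  r \in [:: x1; x2; x3; x4; x5; x6; x7] ->
  P x1 -> P x2 -> P x3 -> P x4 -> P x5 -> P x6 -> P x7 -> P r.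
Proof. by rewrite !inE; do 6?case/orP; move=> /eqP->. Qed.

(** * The two actions on A[SU_q(2)] *)

Section QuantumGroup.
Context (R : realType) (q : R).
Local Notation C := (R[i]).
Local Notation F := (free_alg C sgen).
Local Notation A := (SUq2 q).

Definition cl (x : F) : A := cls (SUq2_rels q) x.

Lemma cl_is_linear : linear cl. Proof. exact: cls_is_linear. Qed.
HB.instance Definition _ := GRing.isLinear.Build C F A *:%R cl cl_is_linear.

Lemma clM (x y : F) : cl (x * y) = cl x * cl y. Proof. exact: clsMr. Qed.
Lemma cl1 : cl 1 = 1. Proof. by []. Qed.

(** The relators are quadratic in the generators up to constants, so a linear map is known on them
    from its values on 1 and on products of two generators. Each use then consists of seven
    identities in the target. *)
Lemma SUq2_rels_linear (V : lmodType C) (f : {linear F -> V}) (v1 : V)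
    (p : sgen -> sgen -> V) :
  f 1 = v1 -> (forall x y, f (gen C x * gen C y) = p x y) ->
  p Ga Gb = q%:C%C *: p Gb Ga ->
  p Ga Gc = q%:C%C *: p Gc Ga ->
  p Gb Gd = q%:C%C *: p Gd Gb ->
  p Gc Gd = q%:C%C *: p Gd Gc ->
  p Gb Gc = p Gc Gb ->
  p Ga Gd = v1 + q%:C%C *: p Gb Gc ->
  p Gd Ga = v1 + (q^-1)%:C%C *: p Gb Gc ->
  forall r, r \in SUq2_rels q -> f r = 0.
Proof.
move=> <- fp.
rewrite -(fp Ga Gb) -(fp Gb Ga) -(fp Ga Gc) -(fp Gc Ga) -(fp Gb Gd) -(fp Gd Gb).
rewrite -(fp Gc Gd) -(fp Gd Gc) -(fp Gb Gc) -(fp Gc Gb) -(fp Ga Gd) -(fp Gd Ga).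
rewrite /SUq2_rels; cbv zeta.
have f2 x y k : f x = k *: f y -> f (x - k *: y) = 0.
  by move=> fx; rewrite linearB linearZ fx subrr.
have f3 x y z k : f x = f y + k *: f z -> f (x - (y + k *: z)) = 0.
  by move=> fx; rewrite linearB linearD linearZ fx subrr.
move: (gen C Ga) (gen C Gb) (gen C Gc) (gen C Gd) => a b c d.
move=> h1 h2 h3 h4 h5 h6 h7 r.
have f1 x y : f x = f y -> f (x - y) = 0 by move=> fx; rewrite linearB fx subrr.
by move=> /(mem_seq7 (P := fun r => f r = 0)); apply; [exact: (f2 _ _ _ h1)|exact: (f2 _ _ _ h2)|
  exact: (f2 _ _ _ h3)|exact: (f2 _ _ _ h4)|exact: (f1 _ _ h5)|exact: (f3 _ _ _ _ h6)|exact: (f3 _ _ _ _ h7)].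
Qed.

Definition counit_word (w : seq sgen) : C^o := \prod_(x <- w) counit_sgen R x.

Definition counit_free (x : F) : C^o := linear_ext counit_word x.
Lemma counit_free_is_linear : linear counit_free.
Proof. exact: linear_ext_is_linear. Qed.
HB.instance Definition _ :=
  GRing.isLinear.Build C F C^o *:%R counit_free counit_free_is_linear.

Lemma counit_freeM x y : counit_free (x * y) = counit_free x * counit_free y.
Proof.
rewrite /counit_free (@linear_extM _ _ C^o _ [:: tt] _ (fun=> counit_word) (fun=> counit_word)).
  by rewrite big_seq1.
by move=> u v; rewrite big_seq1 /counit_word big_cat.
Qed.

Lemma counit_free_word w : counit_free (word C w) = counit_word w.
Proof. exact: linear_ext_word. Qed.

Lemma counit_free_gen x : counit_free (gen C x) = counit_sgen R x.
Proof. by rewrite counit_free_word /counit_word big_seq1. Qed.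

Lemma counit_free1 : counit_free 1 = 1.
Proof. by rewrite -word_nil counit_free_word /counit_word big_nil. Qed.

Lemma counit_free_rels r : r \in SUq2_rels q -> counit_free r = 0.
Proof.
pose p (x y : sgen) : C^o := counit_sgen R x * counit_sgen R y.
have fp x y : counit_free (gen C x * gen C y) = p x y.
  exact: etrans (counit_freeM _ _)
                (congr2 *%R (counit_free_gen x) (counit_free_gen y)).
apply: (SUq2_rels_linear counit_free1 fp); rewrite /p /=.
all: by rewrite ?(mulr0, mul0r, scaler0, mulr1, addr0).
Qed.

Lemma counit_free_ideal x : two_sided_ideal (SUq2_rels q) x -> counit_free x = 0.
Proof.
apply: (@ideal_twisted _ _ _ C^o unit (fun _ => [:: (tt, tt)]) (fun _ => counit_free) _ _ tt).
  by move=> _ y z; rewrite big_seq1; exact: counit_freeM.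
by move=> _ r; exact: counit_free_rels.
Qed.

(** The counit kills the ideal and sends 1 to 1, so the relations do not collapse the algebra. *)
Lemma SUq2_oner_neq0 : (1 : A) != 0.
Proof.
apply/negP => /eqP A10.
have /(clsP (SUq2_rels q) 1 0)/counit_free_ideal : cl 1 = cl 0.
  by rewrite linear0 -A10.
by rewrite subr0 counit_free1 => /eqP; rewrite oner_eq0.
Qed.
HB.instance Definition _ := GRing.PzSemiRing_isNonZero.Build A SUq2_oner_neq0.
HB.instance Definition _ :=
  GRing.Lmodule_isLalgebra.Build C A (@presented_scaleAl _ _ (SUq2_rels q)).
HB.instance Definition _ :=
  GRing.Lalgebra_isAlgebra.Build C A (@presented_scaleAr _ _ (SUq2_rels q)).

Definition counit (x : A) : C^o := counit_free (repr x).

Lemma counit_is_linear : linear counit.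
Proof. exact/lift_is_linear/counit_free_ideal. Qed.
HB.instance Definition _ := GRing.isLinear.Build C A C^o *:%R counit counit_is_linear.

Lemma counit_cl x : counit (cl x) = counit_free x.
Proof. exact/(repr_linear (f := counit_free))/counit_free_ideal. Qed.

End QuantumGroup.

(** * Invariance of the relations under the generators of U_q *)

Section OneSidedActions.
Context (C : fieldType) (s : C) (A : algType C) (g : sgen -> A).

(* On the span of the generators, K has eigenvalue s on the generators with      *)
(* [weight_up] and s^-1 on the others; E or F exchanges them through [flip].      *)
Definition weight_up (t : bool) (x : sgen) : bool :=
  match x with Ga => false | Gb => t | Gc => ~~ t | Gd => true end.

Definition flip (t : bool) (x : sgen) : sgen :=
  match x with
  | Ga => if t then Gb else Gc | Gb => if t then Ga else Gd
  | Gc => if t then Gd else Ga | Gd => if t then Gc else Gb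
  end.

(** The right action reverses products, so as operators its E and F have the roles that F and E have
    on the left; hence the comparisons with [t] and [~~ t]. *)
Definition act_gen (t : bool) (X : ugen) (x : sgen) : A :=
  match X with
  | GK => (if weight_up t x then s else s^-1) *: g x
  | GKi => (if weight_up t x then s^-1 else s) *: g x
  | GE => if weight_up t x == ~~ t then g (flip t x) else 0
  | GF => if weight_up t x == t then g (flip t x) else 0
  end.

Record SUq2_relations : Prop := SUq2Relations {
  rel_ab : g Ga * g Gb = s ^+ 2 *: (g Gb * g Ga);
  rel_ac : g Ga * g Gc = s ^+ 2 *: (g Gc * g Ga);
  rel_bd : g Gb * g Gd = s ^+ 2 *: (g Gd * g Gb);
  rel_cd : g Gc * g Gd = s ^+ 2 *: (g Gd * g Gc);
  rel_bc : g Gb * g Gc = g Gc * g Gb;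
  rel_ad : g Ga * g Gd = 1 + s ^+ 2 *: (g Gb * g Gc);
  rel_da : g Gd * g Ga = 1 + s ^- 2 *: (g Gb * g Gc) }.

Hypotheses (s0 : s != 0) (grel : SUq2_relations).

Lemma rel_ba : g Gb * g Ga = s ^- 2 *: (g Ga * g Gb).
Proof. by rewrite (rel_ab grel) scalerK // expf_neq0. Qed.
Lemma rel_ca : g Gc * g Ga = s ^- 2 *: (g Ga * g Gc).
Proof. by rewrite (rel_ac grel) scalerK // expf_neq0. Qed.
Lemma rel_db : g Gd * g Gb = s ^- 2 *: (g Gb * g Gd).
Proof. by rewrite (rel_bd grel) scalerK // expf_neq0. Qed.
Lemma rel_dc : g Gd * g Gc = s ^- 2 *: (g Gc * g Gd).
Proof. by rewrite (rel_cd grel) scalerK // expf_neq0. Qed.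

Definition act_pair (t : bool) (X : ugen) (x y : sgen) : A :=
  \sum_(Y <- cop_ugen X) act_gen t Y.1 x * act_gen t Y.2 y.

Definition act_one (X : ugen) : A :=
  (match X with GK | GKi => 1 | GE | GF => 0 end).

Lemma scale_eq (k l : C) (v : A) : k = l -> k *: v = l *: v.
Proof. by move->. Qed.

Lemma scale_eq2 (k l m n : C) (u v : A) : k = m -> l = n -> k *: u + l *: v = m *: u + n *: v.
Proof. by move=> -> ->. Qed.

Lemma scale_eq21 (k l n : C) (u v : A) : k = 1 -> l = n -> k *: u + l *: v = u + n *: v.
Proof. by move=> -> ->; rewrite scale1r. Qed.

Local Ltac expand := rewrite /act_pair /act_one /= ?big_cons !big_nil /=
   ?(mulr0, mul0r, add0r, addr0, scaler0) -?scalerAl -?scalerAr ?scalerA.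
Local Ltac normal := rewrite ?rel_ba ?rel_ca ?rel_db ?rel_dc -?(rel_bc grel)
   ?(rel_ad grel) ?(rel_da grel) ?scalerA.
Local Ltac coef := field; rewrite ?s0.
Local Ltac close := rewrite ?scaler0 ?scalerDr ?scalerA -?addrA;
  first [ done
        | by apply: scale_eq; coef
        | by apply: scale_eq21; coef
        | by rewrite [in LHS]addrCA -!scalerDl; apply: scale_eq2; coef
        | by rewrite [in RHS]addrCA -!scalerDl; apply: scale_eq2; coef ].

(** This and the next six lemmas: a generator X acting through its coproduct preserves each
    relation. Products are put in alphabetical order, with ad and da replaced by 1 and bc, and only
    coefficients in s remain to be compared. *)
Lemma act_rel_ab t X : act_pair t X Ga Gb = s ^+ 2 *: act_pair t X Gb Ga.
Proof. by case: t; case: X; expand; normal; close. Qed.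
Lemma act_rel_ac t X : act_pair t X Ga Gc = s ^+ 2 *: act_pair t X Gc Ga.
Proof. by case: t; case: X; expand; normal; close. Qed.
Lemma act_rel_bd t X : act_pair t X Gb Gd = s ^+ 2 *: act_pair t X Gd Gb.
Proof. by case: t; case: X; expand; normal; close. Qed.
Lemma act_rel_cd t X : act_pair t X Gc Gd = s ^+ 2 *: act_pair t X Gd Gc.
Proof. by case: t; case: X; expand; normal; close. Qed.
Lemma act_rel_bc t X : act_pair t X Gb Gc = act_pair t X Gc Gb.
Proof. by case: t; case: X; expand; normal; close. Qed.
Lemma act_rel_ad t X : act_pair t X Ga Gd = act_one X + s ^+ 2 *: act_pair t X Gb Gc.
Proof. by case: t; case: X; expand; normal; close. Qed.
Lemma act_rel_da t X : act_pair t X Gd Ga = act_one X + s ^- 2 *: act_pair t X Gb Gc.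
Proof. by case: t; case: X; expand; normal; close. Qed.

End OneSidedActions.

(** * Coassociativity on words, and the pairing of a generator with a word *)

Section Coproduct.
Context (V : nmodType).

Lemma big_cop_cons (f : seq sgen -> seq sgen -> V) x w :
  \sum_(s <- cop_sword (x :: w)) f s.1 s.2 =
  \sum_(y <- cop_sgen x) \sum_(s <- cop_sword w) f (y.1 :: s.1) (y.2 :: s.2).
Proof. by rewrite /= big_allpairs_dep. Qed.

Lemma big_cop_cat (f : seq sgen -> seq sgen -> V) u v :
  \sum_(s <- cop_sword (u ++ v)) f s.1 s.2 =
  \sum_(s <- cop_sword u) \sum_(t <- cop_sword v) f (s.1 ++ t.1) (s.2 ++ t.2).
Proof.
elim: u f => [|x u IHu] f; first by rewrite /= big_seq1.
rewrite cat_cons !(big_cop_cons _ x).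
rewrite (big_cop_cons (fun s1 s2 => \sum_(t <- cop_sword v) f (s1 ++ t.1) (s2 ++ t.2))).
apply: eq_bigr => y _; exact: (IHu (fun u1 u2 => f (y.1 :: u1) (y.2 :: u2))).
Qed.

Lemma cop_sgen_coassoc (f : sgen -> sgen -> sgen -> V) x :
  \sum_(y <- cop_sgen x) \sum_(z <- cop_sgen y.1) f z.1 z.2 y.2 =
  \sum_(y <- cop_sgen x) \sum_(z <- cop_sgen y.2) f y.1 z.1 z.2.
Proof. by case: x; rewrite /= !(big_cons, big_nil) /= !addr0 addrACA. Qed.

(** Once the sums are exchanged, the first letter and the tail separate: the tail is the induction
    hypothesis and the letter is [cop_sgen_coassoc]. *)
Lemma cop_sword_coassoc (f : seq sgen -> seq sgen -> seq sgen -> V) w :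
  \sum_(s <- cop_sword w) \sum_(t <- cop_sword s.1) f t.1 t.2 s.2 =
  \sum_(s <- cop_sword w) \sum_(t <- cop_sword s.2) f s.1 t.1 t.2.
Proof.
elim: w f => [|x w IHw] f; first by rewrite !big_seq1.
rewrite (big_cop_cons (fun u v => \sum_(t <- cop_sword u) f t.1 t.2 v)).
rewrite (big_cop_cons (fun u v => \sum_(t <- cop_sword v) f u t.1 t.2)).
under eq_bigr => y _.
  under eq_bigr => s _ do rewrite (big_cop_cons (fun u v => f u v (y.2 :: s.2))).
  rewrite exchange_big /=.
  under eq_bigr => z _ do
    rewrite (IHw (fun a b c => f (z.1 :: a) (z.2 :: b) (y.2 :: c))).
  over.
under [RHS]eq_bigr => y _.
  under eq_bigr => s _ do rewrite (big_cop_cons (fun u v => f (y.1 :: s.1) u v)).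
  rewrite exchange_big /=.
  over.
exact: (cop_sgen_coassoc (fun a b c => \sum_(s <- cop_sword w)
  \sum_(t <- cop_sword s.2) f (a :: s.1) (b :: t.1) (c :: t.2))).
Qed.
End Coproduct.

Section PairUgen.
Context (R : realType) (q : R).
Local Notation C := (R[i]).

Lemma pair_ugen_cat X u v : pair_ugen q X (u ++ v) =
  \sum_(Y <- cop_ugen X) pair_ugen q Y.1 u * pair_ugen q Y.2 v.
Proof.
elim: u X => [|x u IHu] X.
  by case: X; rewrite /= !(big_cons, big_nil) /= ?(mul1r, mul0r, addr0, add0r).
rewrite cat_cons /=; under eq_bigr => Y _ do rewrite IHu.
by case: X; rewrite /= !(big_cons, big_nil) /= ?addr0 !(mulrDl, mulrDr, mulrA, addrA).
Qed.

Lemma pair_ugen1 X x : pair_ugen q X [:: x] = pair_gen q X x.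
Proof.
by case: X; rewrite /= !(big_cons, big_nil) /= !(mulr1, mulr0, addr0, add0r).
Qed.

Definition hq : C := (q `^ 2^-1)%:C%C.

Hypothesis q0 : 0 < q.

Lemma hq_neq0 : hq != 0.
Proof. by rewrite /hq fmorph_eq0 gt_eqF // powR_gt0. Qed.

Lemma hq_inv : hq^-1 = (q `^ (- 2^-1))%:C%C.
Proof. by rewrite /hq powRN fmorphV. Qed.

Lemma hq_sqr : hq ^+ 2 = q%:C%C.
Proof. by rewrite /hq -rmorphXn /= -powR_mulrn ?powR_ge0 // -powRrM mulVf ?powRr1 // ltW. Qed.

Lemma hq_sqrV : hq ^- 2 = (q^-1)%:C%C.
Proof. by rewrite hq_sqr fmorphV. Qed.

End PairUgen.

Lemma mem_seq7_all (T : eqType) (x1 x2 x3 x4 x5 x6 x7 : T) (P : T -> Prop) :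
  (forall r, r \in [:: x1; x2; x3; x4; x5; x6; x7] -> P r) ->
  [/\ P x1, P x2, P x3 & P x4] /\ [/\ P x5, P x6 & P x7].
Proof. by move=> h; split; split; apply: h; rewrite !inE eqxx ?orbT. Qed.

Section MorphRel.
Context (C : fieldType) (F A : lalgType C) (f : {linear F -> A}).
Hypothesis fM : forall x y, f (x * y) = f x * f y.

Lemma morph_rel1 x y z w : f (x * y - z * w) = 0 -> f x * f y = f z * f w.
Proof. by rewrite linearB !fM => /subr0_eq. Qed.

Lemma morph_rel2 k x y z w :
  f (x * y - k *: (z * w)) = 0 -> f x * f y = k *: (f z * f w).
Proof. by rewrite linearB linearZ /= !fM => /subr0_eq. Qed.

Lemma morph_rel3 k x y z w : f 1 = 1 ->
  f (x * y - (1 + k *: (z * w))) = 0 -> f x * f y = 1 + k *: (f z * f w).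
Proof. by move=> f1; rewrite linearB linearD linearZ /= f1 !fM => /subr0_eq. Qed.
End MorphRel.

(** Ties the table [act_gen], for which the relations have been checked, to the pairing that defines
    the actions. *)
Lemma act_genE (R : realType) (q : R) (A : algType R[i]) (g : sgen -> A) t X x :
  0 < q -> act_gen (hq q) g t X x =
  \sum_(y <- cop_sgen x)
    pair_gen q X (if t then y.2 else y.1) *: g (if t then y.1 else y.2).
Proof.
move=> q0; have hV := hq_inv q; move: hV; rewrite /hq => hV.
by case: t; case: X; case: x; rewrite /= !(big_cons, big_nil) /=
  ?(scale0r, scale1r, addr0, add0r) ?hV.
Qed.

Lemma linear_sumZ (C : fieldType) (U V : lmodType C) (f : {linear U -> V})
    (I : Type) (r : seq I) (k : I -> C) (u : I -> U) :
  f (\sum_(i <- r) k i *: u i) = \sum_(i <- r) k i *: f (u i).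
Proof. by rewrite linear_sum; apply: eq_bigr => i _; rewrite linearZ. Qed.

(** * The left and right actions as commuting operators on the quotient *)

Section Operators.
Context (R : realType) (q : R) (q0 : 0 < q).
Local Notation C := (R[i]).
Local Notation F := (free_alg C sgen).
Local Notation A := (SUq2 q).
Local Notation cl := (@cl R q).
Local Notation s := (hq q).

Definition sg (x : sgen) : A := cl (gen C x).
Definition sword (w : seq sgen) : A := cl (word C w).

Lemma sword_nil : sword [::] = 1. Proof. by rewrite /sword word_nil. Qed.
Lemma sword_cons x w : sword (x :: w) = sg x * sword w.
Proof. by rewrite /sword /sg -clM /gen mul_word. Qed.
Lemma sword_cat u v : sword (u ++ v) = sword u * sword v.
Proof. by rewrite /sword -clM mul_word. Qed.

Lemma sg_relations : SUq2_relations s sg.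
Proof.
have rel0 r : r \in SUq2_rels q -> cl r = 0.
  move=> rP; have rI := IdealM 1 1 rP; rewrite mul1r mulr1 -[r in two_sided_ideal _ r]subr0 in rI.
  exact: etrans ((clsP _ _ _).2 rI) (linear0 cl).
have clM' x y : cl (x * y) = cl x * cl y by exact: clM.
have cl1' : cl 1 = 1 by exact: cl1.
have := mem_seq7_all (P := fun r => cl r = 0) rel0.
case=> -[h1 h2 h3 h4] [h5 h6 h7].
split; rewrite ?(hq_sqrV q0) ?(hq_sqr q0).
- exact: (morph_rel2 clM' h1).
- exact: (morph_rel2 clM' h2).
- exact: (morph_rel2 clM' h3).
- exact: (morph_rel2 clM' h4).
- exact: (morph_rel1 clM' h5).
- exact: (morph_rel3 clM' cl1' h6).
- exact: (morph_rel3 clM' cl1' h7).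
Qed.

(* [t = true] is the left action, which pairs with the second leg of the      *)
(* coproduct; [t = false] is the right action.                                *)
Definition act_word (t : bool) (X : ugen) (w : seq sgen) : A :=
  \sum_(p <- cop_sword w)
    pair_ugen q X (if t then p.2 else p.1) *: sword (if t then p.1 else p.2).

(** The coproduct of words is multiplicative, and (X, p r) = (X_(1), p) (X_(2), r) by
    [pair_ugen_cat]. *)
Lemma act_word_cat t X u v : act_word t X (u ++ v) =
  \sum_(Y <- cop_ugen X) act_word t Y.1 u * act_word t Y.2 v.
Proof.
rewrite /act_word (big_cop_cat (fun u1 u2 =>
  pair_ugen q X (if t then u2 else u1) *: sword (if t then u1 else u2))).
under [RHS]eq_bigr => Y _ do (rewrite mulr_suml;
  under eq_bigr => p _ do rewrite mulr_sumr).
rewrite [RHS]exchange_big /=; apply: eq_bigr => p _.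
rewrite [RHS]exchange_big /=; apply: eq_bigr => p' _.
have ifcat (b : bool) : (if b then p.1 ++ p'.1 else p.2 ++ p'.2) =
  (if b then p.1 else p.2) ++ (if b then p'.1 else p'.2) by case: b.
have ifcat' (b : bool) : (if b then p.2 ++ p'.2 else p.1 ++ p'.1) =
  (if b then p.2 else p.1) ++ (if b then p'.2 else p'.1) by case: b.
rewrite ifcat ifcat' pair_ugen_cat sword_cat scaler_suml.
by apply: eq_bigr => Y _; rewrite -scalerAl -scalerAr scalerA.
Qed.

Lemma act_word1 t X x : act_word t X [:: x] = act_gen s sg t X x.
Proof.
rewrite /act_word.
have -> : cop_sword [:: x] = [seq ([:: y.1], [:: y.2]) | y <- cop_sgen x].
  by case: x.
rewrite big_map.
rewrite (act_genE _ _ _ _ q0).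
apply: eq_bigr => y _.
by rewrite -(pair_ugen1 q X); case: t.
Qed.

Lemma act_word0 t X : act_word t X [::] = act_one A X.
Proof.
rewrite /act_word /= big_seq1 /=.
case: t; case: X; rewrite /= sword_nil ?scale1r ?scale0r //.
Qed.

Definition act_free t X (x : F) : A := linear_ext (act_word t X) x.
Lemma act_free_is_linear t X : linear (act_free t X).
Proof. exact: linear_ext_is_linear. Qed.
HB.instance Definition _ t X :=
  GRing.isLinear.Build C F A *:%R (act_free t X) (act_free_is_linear t X).

Lemma act_free_word t X w : act_free t X (word C w) = act_word t X w.
Proof. exact: linear_ext_word. Qed.

Lemma act_freeM t X x y : act_free t X (x * y) =
  \sum_(Y <- cop_ugen X) act_free t Y.1 x * act_free t Y.2 y.
Proof. exact: (linear_extM (act_word_cat t X)). Qed.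

Lemma act_free_gen t X x : act_free t X (gen C x) = act_gen s sg t X x.
Proof. exact: etrans (act_free_word t X [:: x]) (act_word1 t X x). Qed.

Lemma act_free1 t X : act_free t X 1 = act_one A X.
Proof. by rewrite -word_nil; exact: etrans (act_free_word t X [::]) (act_word0 t X). Qed.

Lemma act_free_rels t X r : r \in SUq2_rels q -> act_free t X r = 0.
Proof.
have fp x y : act_free t X (gen C x * gen C y) = act_pair s sg t X x y.
  apply: (etrans (act_freeM t X _ _)); rewrite /act_pair; apply: eq_bigr => Y _.
  by congr (_ * _); [exact: (act_free_gen t Y.1 x)|exact: (act_free_gen t Y.2 y)].
have s0 := hq_neq0 q0.
apply: (SUq2_rels_linear (act_free1 t X) fp); rewrite -?(hq_sqrV q0) -?(hq_sqr q0).
- exact: act_rel_ab s0 sg_relations t X.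
- exact: act_rel_ac s0 sg_relations t X.
- exact: act_rel_bd s0 sg_relations t X.
- exact: act_rel_cd s0 sg_relations t X.
- exact: act_rel_bc s0 sg_relations t X.
- exact: act_rel_ad s0 sg_relations t X.
- exact: act_rel_da s0 sg_relations t X.
Qed.

Lemma act_free_ideal t X x : two_sided_ideal (SUq2_rels q) x -> act_free t X x = 0.
Proof.
apply: (@ideal_twisted _ _ _ A ugen cop_ugen (act_free t) _ _ X).
  exact: act_freeM.
by move=> Y r; exact: act_free_rels.
Qed.

Definition act t X (x : A) : A := act_free t X (repr x).

Lemma act_cl t X x : act t X (cl x) = act_free t X x.
Proof. exact/(repr_linear (f := act_free t X))/act_free_ideal. Qed.

Lemma SUq2_ind (Q : A -> Prop) :
  Q 0 -> (forall x y, Q x -> Q y -> Q (x + y)) ->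
  (forall c w, Q (c *: sword w)) -> forall x, Q x.
Proof. exact: presented_ind. Qed.

Lemma clP (Q : A -> Prop) : (forall x, Q (cl x)) -> forall x, Q x.
Proof. exact: presentedP. Qed.

Lemma act_is_linear t X : linear (act t X).
Proof. exact/(lift_is_linear (f := act_free t X))/act_free_ideal. Qed.
Definition lop (t : bool) (X : ugen) : {linear A -> A} :=
  HB.pack (act t X) (GRing.isLinear.Build C A A *:%R (act t X) (act_is_linear t X)).

Lemma actM t X x y : act t X (x * y) =
  \sum_(Y <- cop_ugen X) act t Y.1 x * act t Y.2 y.
Proof.
elim/clP: x => x; elim/clP: y => y; rewrite -clM act_cl act_freeM.
by apply: eq_bigr => Y _; rewrite !act_cl.
Qed.

Lemma act_sword t X w : act t X (sword w) = act_word t X w.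
Proof. exact: etrans (act_cl t X (word C w)) (act_free_word t X w). Qed.

Lemma act_sg t X x : act t X (sg x) = act_gen s sg t X x.
Proof. exact: etrans (act_sword t X [:: x]) (act_word1 t X x). Qed.

Lemma act1 t X : act t X 1 = act_one A X.
Proof. by rewrite -sword_nil; exact: etrans (act_sword t X [::]) (act_word0 t X). Qed.

Lemma SUq2_linear_eq (V : lmodType C) (f g : {linear A -> V}) :
  (forall w, f (sword w) = g (sword w)) -> f =1 g.
Proof.
move=> fg x; elim/SUq2_ind: x => [|x y fx fy|k w].
- exact: etrans (linear0 f) (esym (linear0 g)).
- exact: etrans (linearD f x y) (etrans (congr2 _ fx fy) (esym (linearD g x y))).
- exact: etrans (linearZZ f k _) (etrans (congr1 _ (fg w)) (esym (linearZZ g k _))).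
Qed.

(** In the iterated coproduct of the word, both orders pair Y with the first leg, X with the third,
    and keep the middle one. *)
Lemma act_comm X Y x : act true X (act false Y x) = act false Y (act true X x).
Proof.
apply: (SUq2_linear_eq (f := lop true X \o lop false Y) (g := lop false Y \o lop true X)) => w.
pose f u v w := (pair_ugen q Y u * pair_ugen q X w) *: sword v.
have ER : act true X (act false Y (sword w)) =
    \sum_(p <- cop_sword w) \sum_(r <- cop_sword p.2) f p.1 r.1 r.2.
  apply: (etrans (congr1 (act true X) (act_sword false Y w))).
  apply: (etrans (linear_sumZ (lop true X) _ _ _)); apply: eq_bigr => p _.
  apply: (etrans (congr1 _ (act_sword true X p.2))).
  by rewrite /act_word scaler_sumr; apply: eq_bigr => r _; rewrite scalerA.
have EL : act false Y (act true X (sword w)) =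
    \sum_(p <- cop_sword w) \sum_(r <- cop_sword p.1) f r.1 r.2 p.2.
  apply: (etrans (congr1 (act false Y) (act_sword true X w))).
  apply: (etrans (linear_sumZ (lop false Y) _ _ _)); apply: eq_bigr => p _.
  apply: (etrans (congr1 _ (act_sword false Y p.1))).
  by rewrite /act_word scaler_sumr; apply: eq_bigr => r _; rewrite scalerA mulrC.
by apply: (etrans ER); apply: esym; apply: (etrans EL); exact: cop_sword_coassoc.
Qed.

End Operators.

(** * Spectral decomposition of the commuting actions *)

(** The quantum integer [n] at q = s^2, written in s because half-integral powers of q occur
    throughout. *)
Definition qint (C : fieldType) (s : C) (n : nat) : C :=
  (s ^+ (2 * n) - s ^- (2 * n)) / (s ^+ 2 - s ^- 2).

(* The commuting left ([op true]) and right ([op false]) actions of U_q on    *)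
(* A[SU_q(2)], together with the genericity of q = s ^ 2.                     *)
Record SUq2_actions (C : fieldType) (s : C) (A : algType C) (g : sgen -> A)
    (op : bool -> ugen -> {linear A -> A}) : Prop := SUq2Actions {
  sa_s0 : s != 0;
  sa_nu0 : s ^+ 2 - s ^- 2 != 0;
  sa_s_inj : injective (fun i => s ^+ (2 * i));
  sa_qint_neq0 : forall n, qint s n.+1 != 0;
  sa_qint_inj : injective (fun k => qint s k.+1 ^+ 2);
  sa_rel : SUq2_relations s g;
  sa_M : forall t X x y,
    op t X (x * y) = \sum_(Y <- cop_ugen X) op t Y.1 x * op t Y.2 y;
  sa_1 : forall t X, op t X 1 = act_one A X;
  sa_g : forall t X x, op t X (g x) = act_gen s g t X x;
  sa_comm : forall X Y x, op true X (op false Y x) = op false Y (op true X x);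
  sa_ind : forall Q : A -> Prop, Q 0 ->
    (forall x y, Q x -> Q y -> Q (x + y)) ->
    (forall k w, Q (k *: \prod_(x <- w) g x)) -> forall x, Q x;
  sa_neq0 : forall n, g Ga ^+ n != 0 }.

Section Actions.
Context (C : fieldType) (s : C) (A : algType C) (g : sgen -> A).
Context (op : bool -> ugen -> {linear A -> A}).
Hypothesis H : SUq2_actions s g op.
Let s0 := sa_s0 H.
Let nu0 := sa_nu0 H.
Let grel := sa_rel H.
Let opM := sa_M H.
Let op1 := sa_1 H.
Let opg := sa_g H.
Let opC := sa_comm H.
Let gen_ind := sa_ind H.
Local Notation qint := (qint s).

Definition opK t := op t GK.
Definition opKi t := op t GKi.
(** [opU] multiplies the weight of K by s^2 and [opL] by s^-2: E raises in the left action, F in the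
    right one. *)
Definition opU (t : bool) := op t (if t then GE else GF).
Definition opL (t : bool) := op t (if t then GF else GE).

Lemma opKM t x y : opK t (x * y) = opK t x * opK t y.
Proof. by rewrite /opK opM big_seq1. Qed.
Lemma opKiM t x y : opKi t (x * y) = opKi t x * opKi t y.
Proof. by rewrite /opKi opM big_seq1. Qed.
Lemma opUM t x y : opU t (x * y) = opU t x * opK t y + opKi t x * opU t y.
Proof. by rewrite /opU opM; case: t; rewrite !big_cons big_nil addr0. Qed.
Lemma opLM t x y : opL t (x * y) = opL t x * opK t y + opKi t x * opL t y.
Proof. by rewrite /opL opM; case: t; rewrite !big_cons big_nil addr0. Qed.

Lemma opK1 t : opK t 1 = 1. Proof. by rewrite /opK op1. Qed.
Lemma opKi1 t : opKi t 1 = 1. Proof. by rewrite /opKi op1. Qed.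
Lemma opU1 t : opU t 1 = 0. Proof. by rewrite /opU op1; case: t. Qed.
Lemma opL1 t : opL t 1 = 0. Proof. by rewrite /opL op1; case: t. Qed.

Lemma opKg t x : opK t (g x) = (if weight_up t x then s else s^-1) *: g x.
Proof. by rewrite /opK opg. Qed.
Lemma opKig t x : opKi t (g x) = (if weight_up t x then s^-1 else s) *: g x.
Proof. by rewrite /opKi opg. Qed.
Lemma opUg t x : opU t (g x) = if weight_up t x then 0 else g (flip t x).
Proof. by rewrite /opU opg; case: t; case: x. Qed.
Lemma opLg t x : opL t (g x) = if weight_up t x then g (flip t x) else 0.
Proof. by rewrite /opL opg; case: t; case: x. Qed.

Lemma weight_flip t x : weight_up t (flip t x) = ~~ weight_up t x.
Proof. by case: t; case: x. Qed.
Lemma flipK t x : flip t (flip t x) = x.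
Proof. by case: t; case: x. Qed.

(** Words arise from 1 by left multiplication by generators. The commutation relations of K, U and L
    as operators all follow from this principle and the Leibniz rules. *)
Lemma linear_gen_eq (f h : {linear A -> A}) : f 1 = h 1 ->
  (forall x p, f p = h p -> f (g x * p) = h (g x * p)) -> f =1 h.
Proof.
move=> fh1 fhM x; elim/gen_ind: x => [|x y fx fy|k w].
- by rewrite !linear0.
- by rewrite !linearD fx fy.
- rewrite !linearZ /=; congr (_ *: _); elim: w => [|x w IHw]; first by rewrite big_nil.
  by rewrite big_cons; exact: fhM.
Qed.

Lemma opKKi t : opK t \o opKi t =1 id.
Proof.
apply: (linear_gen_eq (h := idfun)) => [|x p] /=; first by rewrite opKi1 opK1.
rewrite opKiM opKM opKig linearZ /= opKg scalerA => ->.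
by case: ifP => _; rewrite ?mulVf ?mulfV // scale1r.
Qed.

Lemma opKiK t : opKi t \o opK t =1 id.
Proof.
apply: (linear_gen_eq (h := idfun)) => [|x p] /=; first by rewrite opK1 opKi1.
rewrite opKM opKiM opKg linearZ /= opKig scalerA => ->.
by case: ifP => _; rewrite ?mulVf ?mulfV // scale1r.
Qed.

Let comp_scale (k : C) (f : {linear A -> A}) : {linear A -> A} := k \*: f.

Lemma opKU t : opK t \o opU t =1 comp_scale (s ^+ 2) (opU t \o opK t).
Proof.
apply: linear_gen_eq => [|x p] /=; first by rewrite opU1 opK1 opU1 linear0 scaler0.
move=> IHp; rewrite opUM opKM linearD /= !opKM opUM IHp.
have -> : opK t (opU t (g x)) = s ^+ 2 *: opU t (opK t (g x)).
  rewrite opUg opKg linearZ /= opUg; case: ifP => wx; first by rewrite linear0 !scaler0.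
  by rewrite opKg weight_flip wx /= scalerA; congr (_ *: _); field.
rewrite (opKKi t (g x) : opK t (opKi t (g x)) = _) (opKiK t (g x) : opKi t (opK t (g x)) = _).
by rewrite scalerDr -scalerAl -scalerAr.
Qed.

Lemma opKL t : opK t \o opL t =1 comp_scale (s ^- 2) (opL t \o opK t).
Proof.
apply: linear_gen_eq => [|x p] /=; first by rewrite opL1 opK1 opL1 linear0 scaler0.
move=> IHp; rewrite opLM opKM linearD /= !opKM opLM IHp.
have -> : opK t (opL t (g x)) = s ^- 2 *: opL t (opK t (g x)).
  rewrite opLg opKg linearZ /= opLg; case: ifP => wx; last by rewrite linear0 !scaler0.
  by rewrite opKg weight_flip wx /= scalerA; congr (_ *: _); field.
rewrite (opKKi t (g x) : opK t (opKi t (g x)) = _) (opKiK t (g x) : opKi t (opK t (g x)) = _).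
by rewrite scalerDr -scalerAl -scalerAr.
Qed.

Lemma KUE t x : opK t (opU t x) = s ^+ 2 *: opU t (opK t x).
Proof. exact: (opKU t x). Qed.
Lemma KLE t x : opK t (opL t x) = s ^- 2 *: opL t (opK t x).
Proof. exact: (opKL t x). Qed.
Lemma KKiE t x : opK t (opKi t x) = x. Proof. exact: (opKKi t x). Qed.
Lemma KiKE t x : opKi t (opK t x) = x. Proof. exact: (opKiK t x). Qed.

Lemma KiUE t x : opKi t (opU t x) = s ^- 2 *: opU t (opKi t x).
Proof.
have := KUE t (opKi t x); rewrite KKiE => /(congr1 (opKi t)).
by rewrite KiKE linearZ /= => ->; rewrite scalerK // expf_neq0.
Qed.

Lemma KiLE t x : opKi t (opL t x) = s ^+ 2 *: opL t (opKi t x).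
Proof.
have := KLE t (opKi t x); rewrite KKiE => /(congr1 (opKi t)).
by rewrite KiKE linearZ /= => ->; rewrite scalerKV // expf_neq0.
Qed.

Local Notation nui := ((s ^+ 2 - s ^- 2)^-1).

Lemma ULE_gen t x :
  opU t (opL t (g x)) = opL t (opU t (g x)) +
    nui *: (opK t (opK t (g x)) - opKi t (opKi t (g x))).
Proof.
have wf := weight_flip t x.
case wx: (weight_up t x) wf => wf.
  rewrite opLg opUg wx opUg wf flipK linear0 add0r !opKg !opKig wx.
  rewrite (linearZZ (opK t)) (linearZZ (opKi t)) opKg opKig wx !scalerA -scalerBl scalerA.
  by rewrite -!expr2 exprVn mulVf // scale1r.
rewrite opLg opUg wx opLg wf flipK linear0 !opKg !opKig wx.
rewrite (linearZZ (opK t)) (linearZZ (opKi t)) opKg opKig wx !scalerA -scalerBl scalerA.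
by rewrite -!expr2 exprVn -(opprB (s ^+ 2)) mulrN mulVf // scaleN1r subrr.
Qed.

Let KK_KiKi t : {linear A -> A} := (opK t \o opK t) \- (opKi t \o opKi t).

(** Expand both sides on g x * p. The mixed terms of U L and L U match in pairs, because K and its
    inverse pass U and L with factors that balance; the diagonal terms telescope through K^-2 (g x)
    * K^2 p. *)
Lemma opUL t : opU t \o opL t =1 (opL t \o opU t) \+ comp_scale nui (KK_KiKi t).
Proof.
apply: linear_gen_eq => [|x p] /=.
  by rewrite opU1 opL1 !linear0 !opK1 !opKi1 subrr scaler0 addr0.
move=> IHp.
rewrite opLM opUM !linearD /= !opUM !opLM IHp ULE_gen !opKM !opKiM.
rewrite KiLE (KLE t p) KiUE (KUE t p) -!scalerAl -!scalerAr.
rewrite !mulrDl !mulrDr -!scalerAl -!scalerAr !mulrBl !mulrBr.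
rewrite !scalerDr !scalerN.
rewrite !addrA; congr (_ - _).
by rewrite [LHS](ACl (3*7*1*5*4*6*2))%AC /= addNr add0r.
Qed.

Lemma ULE t x : opU t (opL t x) =
  opL t (opU t x) + nui *: (opK t (opK t x) - opKi t (opKi t x)).
Proof. exact: (opUL t x). Qed.

Lemma qint1 : qint 1 = 1. Proof. by rewrite /qint muln1 mulfV. Qed.

(** * Ladders above a lowest weight vector *)

Section LowestWeight.
Context (t : bool) (n : nat) (v : A).
Hypothesis Kv : opK t v = s ^- n *: v.
Hypothesis Lv : opL t v = 0.

Definition upv (l : nat) : A := iter l (opU t) v.

Lemma upvS l : upv l.+1 = opU t (upv l). Proof. by []. Qed.

Lemma K_upv l : opK t (upv l) = (s ^+ (2 * l) / s ^+ n) *: upv l.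
Proof.
elim: l => [|l IHl]; first by rewrite muln0 mul1r.
by rewrite upvS KUE IHl linearZ /= scalerA mulrA -exprD mulnS.
Qed.

Lemma Ki_upv l : opKi t (upv l) = (s ^+ n / s ^+ (2 * l)) *: upv l.
Proof.
rewrite -[in RHS](KiKE t (upv l)) K_upv linearZ /= scalerA.
rewrite (_ : _ * _ = 1) ?scale1r //.
by field; rewrite !expf_neq0.
Qed.

Definition low_coef (l : nat) : C :=
  qint l.+1 * ((s ^+ (2 * n) / s ^+ (2 * l) - s ^+ (2 * l) / s ^+ (2 * n)) / (s ^+ 2 - s ^- 2)).

(* [low_coef] is stated without the truncated subtraction so that its recursion  *)
(* holds for all l.                                                               *)
Lemma low_coefE l : (l <= n)%N -> low_coef l = qint l.+1 * qint (n - l).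
Proof.
move=> ln; rewrite /low_coef /qint; congr (_ * (_ / _)).
have -> : s ^+ (2 * n) = s ^+ (2 * (n - l)) * s ^+ (2 * l) by rewrite -exprD -mulnDr subnK.
by rewrite mulfK ?expf_neq0 // invfM mulrCA mulrV ?mulr1 // unitfE expf_neq0.
Qed.

Let s4 : s * s * (s * s) - 1 != 0.
Proof.
rewrite (_ : _ - _ = s ^+ 2 * (s ^+ 2 - s ^- 2)) ?mulf_neq0 ?expf_neq0 //.
by field.
Qed.

Lemma low_coef_rec l : low_coef l.+1 = low_coef l -
  (s ^+ 2 - s ^- 2)^-1 *
  ((s ^+ (2 * l.+1) / s ^+ n) ^+ 2 - (s ^+ n / s ^+ (2 * l.+1)) ^+ 2).
Proof.
rewrite /low_coef /qint !(mulnC 2) !exprM !exprS.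
have := expf_neq0 l s0; have := expf_neq0 n s0; move: (s ^+ l) (s ^+ n) => x y y0 x0.
by field; rewrite x0 y0 s0 s4.
Qed.

Lemma low_coef0 : low_coef 0 =
  - ((s ^+ 2 - s ^- 2)^-1 * ((s ^+ (2 * 0) / s ^+ n) ^+ 2 - (s ^+ n / s ^+ (2 * 0)) ^+ 2)).
Proof.
rewrite /low_coef qint1 mul1r muln0 expr0 (mulnC 2) exprM.
have := expf_neq0 n s0; move: (s ^+ n) => y y0.
by field; rewrite oner_neq0 y0 s0 expr2 s4.
Qed.

Lemma UL_upv l : opU t (opL t (upv l)) = opL t (upv l.+1) +
  ((s ^+ 2 - s ^- 2)^-1 *
  ((s ^+ (2 * l) / s ^+ n) ^+ 2 - (s ^+ n / s ^+ (2 * l)) ^+ 2)) *: upv l.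
Proof.
rewrite ULE -upvS K_upv Ki_upv (linearZZ (opK t)) (linearZZ (opKi t)) K_upv Ki_upv.
by rewrite !scalerA -scalerBl scalerA !expr2.
Qed.

(** The commutator turns L U^(l+1) v into U L U^l v minus a multiple of U^l v, and [low_coef_rec] is
    the recursion for the coefficients that results. *)
Lemma L_upv l : opL t (upv l.+1) = low_coef l *: upv l.
Proof.
elim: l => [|l IHl].
  have := UL_upv 0; rewrite [upv 0]/= Lv linear0 => /esym/eqP.
  by rewrite addr_eq0 -scaleNr -low_coef0 => /eqP.
have := UL_upv l.+1; rewrite IHl linearZ /= -upvS => /(canLR (addrK _)) <-.
by rewrite -scalerBl low_coef_rec.
Qed.

End LowestWeight.

(** * The double ladders above the powers of a *)

Definition raised (t : bool) : sgen := if t then Gb else Gc.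
Local Notation y t := (g (raised t)).
Local Notation a := (g Ga).

Lemma Ka t n : opK t (a ^+ n) = s ^- n *: a ^+ n.
Proof.
elim: n => [|n IHn]; first by rewrite !expr0 opK1 invr1 scale1r.
rewrite [a ^+ _]exprS opKM IHn opKg /= -scalerAl -scalerAr scalerA.
by rewrite [s ^+ n.+1]exprS invfM.
Qed.

Lemma La t n : opL t (a ^+ n) = 0.
Proof.
elim: n => [|n IHn]; first by rewrite expr0 opL1.
by rewrite exprS opLM IHn mulr0 addr0 opLg mul0r.
Qed.

Lemma Uy t m : opU t (y t ^+ m) = 0.
Proof.
elim: m => [|m IHm]; first by rewrite expr0 opU1.
by rewrite exprS opUM IHm mulr0 addr0 opUg; case: t {IHm} => /=; rewrite mul0r.
Qed.

Lemma Kiy t m : opKi t (y t ^+ m) = s ^- m *: y t ^+ m.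
Proof.
elim: m => [|m IHm]; first by rewrite !expr0 opKi1 invr1 scale1r.
rewrite [y t ^+ _]exprS opKiM IHm opKig -scalerAl -scalerAr scalerA.
by rewrite [s ^+ m.+1]exprS invfM; case: t {IHm}.
Qed.

Lemma ay t : a * y t = s ^+ 2 *: (y t * a).
Proof. by case: t; [exact: rel_ab grel|exact: rel_ac grel]. Qed.

Lemma qintS m : qint m.+1 = s ^- (2 * m) + s ^+ 2 * qint m.
Proof.
rewrite /qint mulnS exprD.
have := expf_neq0 (2 * m) s0; move: (s ^+ (2 * m)) => x x0.
have s4 : s * s * (s * s) - 1 != 0.
  rewrite (_ : _ - _ = s ^+ 2 * (s ^+ 2 - s ^- 2)) ?mulf_neq0 ?expf_neq0 //.
  by field.
by field; rewrite s0 x0 s4.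
Qed.

(** U replaces one factor a by U a, which is b or c. Moving it to the front with a y = q y a yields
    a geometric sum in q, summed by [qintS] to a quantum integer. *)
Lemma Ua t m : opU t (a ^+ m.+1) = (s ^+ m * qint m.+1) *: (y t * a ^+ m).
Proof.
elim: m => [|m IHm].
  by rewrite expr0 qint1 mul1r scale1r mulr1 expr1 opUg; case: t.
have fE : g (flip t Ga) = y t by case: t {IHm}.
rewrite [in LHS]exprS opUM IHm Ka opUg opKig /= fE.
rewrite -[(s *: a) * _]scalerAl -!scalerAr (mulrA a) ay -!scalerAl -mulrA -exprS !scalerA.
rewrite -scalerDl; congr (_ *: _).
rewrite [qint m.+2]qintS (mulnC 2) exprM [s ^+ m.+1]exprS.
by have := expf_neq0 m s0; move: (s ^+ m) (qint _) => x z x0; field; rewrite x0 s0.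
Qed.

Lemma iterU_a t n r : (r <= n)%N ->
  exists k, iter r (opU t) (a ^+ n) = k *: (y t ^+ r * a ^+ (n - r)).
Proof.
elim: r => [|r IHr] rn; first by exists 1; rewrite scale1r mul1r subn0.
have [k E] := IHr (ltnW rn).
exists (k * (s ^- r * (s ^+ (n - r.+1) * qint (n - r)))).
rewrite iterS E linearZ /= opUM Uy mul0r add0r Kiy.
by rewrite -subnSK // Ua -scalerAr -scalerAl (mulrA (y t ^+ r)) -exprSr !scalerA; congr (_ *: _); ring.
Qed.

(** U^n a^n is a multiple of y^n, which U kills; so the ladder above a^n has at most n + 1 steps. *)
Lemma iterU_a0 t n r : (n < r)%N -> iter r (opU t) (a ^+ n) = 0.
Proof.
move=> nr; rewrite -(subnK nr) iterD.
have -> : iter n.+1 (opU t) (a ^+ n) = 0.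
  have [k E] := iterU_a t (leqnn n).
  by rewrite iterS E subnn expr0 mulr1 linearZ /= Uy scaler0.
by elim: (r - _)%N => //= m ->; rewrite linear0.
Qed.

(** E^l |> a^n <| F^r. For l, r <= n these are, up to scalars, the matrix coefficients of the
    irreducible module of dimension n + 1. *)
Definition vec (n l r : nat) : A := iter l (opU true) (iter r (opU false) (a ^+ n)).

Lemma vecE n l r : vec n l r = iter r (opU false) (iter l (opU true) (a ^+ n)).
Proof.
rewrite /vec; elim: l => //= l ->.
by elim: r => //= r IHr; rewrite -IHr /opU opC.
Qed.

Lemma vec_K n r : opK true (iter r (opU false) (a ^+ n)) = s ^- n *: iter r (opU false) (a ^+ n).
Proof. by elim: r => [|r IHr] /=; rewrite ?Ka // /opK /opU opC IHr linearZ. Qed.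

Lemma vec_K' n l : opK false (iter l (opU true) (a ^+ n)) = s ^- n *: iter l (opU true) (a ^+ n).
Proof. by elim: l => [|l IHl] /=; rewrite ?Ka // /opK /opU -opC IHl linearZ. Qed.

Lemma vec_L n r : opL true (iter r (opU false) (a ^+ n)) = 0.
Proof. by elim: r => [|r IHr] /=; rewrite ?La // /opL /opU opC IHr linear0. Qed.

Lemma vec_L' n l : opL false (iter l (opU true) (a ^+ n)) = 0.
Proof. by elim: l => [|l IHl] /=; rewrite ?La // /opL /opU -opC IHl linear0. Qed.

Lemma U_vec n l r : opU true (vec n l r) = vec n l.+1 r. Proof. by []. Qed.
Lemma U'_vec n l r : opU false (vec n l r) = vec n l r.+1. Proof. by rewrite !vecE. Qed.
Lemma L_vec n l r : opL true (vec n l.+1 r) = low_coef n l *: vec n l r.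
Proof. exact: (L_upv (vec_K n r) (vec_L n r)). Qed.
Lemma L'_vec n l r : opL false (vec n l r.+1) = low_coef n r *: vec n l r.
Proof. by rewrite !vecE; exact: (L_upv (vec_K' n l) (vec_L' n l)). Qed.
Lemma L_vec0 n r : opL true (vec n 0 r) = 0. Proof. exact: vec_L. Qed.
Lemma L'_vec0 n l : opL false (vec n l 0) = 0. Proof. exact: vec_L'. Qed.
Lemma K_vec n l r : opK true (vec n l r) = (s ^+ (2 * l) / s ^+ n) *: vec n l r.
Proof. exact: (K_upv (vec_K n r)). Qed.
Lemma K'_vec n l r : opK false (vec n l r) = (s ^+ (2 * r) / s ^+ n) *: vec n l r.
Proof. by rewrite !vecE; exact: (K_upv (vec_K' n l)). Qed.
Lemma Ki_vec n l r : opKi true (vec n l r) = (s ^+ n / s ^+ (2 * l)) *: vec n l r.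
Proof. exact: (Ki_upv (vec_K n r)). Qed.
Lemma Ki'_vec n l r : opKi false (vec n l r) = (s ^+ n / s ^+ (2 * r)) *: vec n l r.
Proof. by rewrite !vecE; exact: (Ki_upv (vec_K' n l)). Qed.

Lemma vec_eq0 n l r : (n < l)%N || (n < r)%N -> vec n l r = 0.
Proof.
case/orP=> h; first by rewrite vecE iterU_a0 //; elim: r => //= r ->; rewrite linear0.
by rewrite /vec iterU_a0 //; elim: l => //= l ->; rewrite linear0.
Qed.

(** * The ladder vectors span, degree by degree *)

Inductive vec_span : int -> A -> Prop :=
| VecSpan0 d : vec_span d 0
| VecSpanD d x y : vec_span d x -> vec_span d y -> vec_span d (x + y)
| VecSpanZ d k n l r : d = n%:Z - 2 * l%:Z -> vec_span d (k *: vec n l r).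

Lemma vec_spanZ d k x : vec_span d x -> vec_span d (k *: x).
Proof.
elim=> [e|e y z _ IHy _ IHz|e k' n l r dE].
- by rewrite scaler0; exact: VecSpan0.
- by rewrite scalerDr; exact: VecSpanD.
- by rewrite scalerA; exact: VecSpanZ.
Qed.

Lemma vec_spanB d x y : vec_span d x -> vec_span d y -> vec_span d (x - y).
Proof. by move=> hx hy; rewrite -scaleN1r; apply: VecSpanD => //; exact: vec_spanZ. Qed.

Lemma vec_span_vec d n l r : d = n%:Z - 2 * l%:Z -> vec_span d (vec n l r).
Proof. by move=> dE; rewrite -[vec _ _ _]scale1r; exact: VecSpanZ. Qed.

Lemma vec_span_linear (f : A -> A) (e : int) : linear f ->
  (forall n l r, vec_span (n%:Z - 2 * l%:Z + e) (f (vec n l r))) ->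
  forall d d' x, d' = d + e -> vec_span d x -> vec_span d' (f x).
Proof.
move=> fl fv d d' x -> hx; have f0 : f 0 = 0.
  by have := fl (-1) 0 0; rewrite scaler0 addr0 scaleN1r addNr.
elim: {d x}hx => [d|d x y _ IHx _ IHy|d k n l r ->].
- by rewrite f0; exact: VecSpan0.
- by rewrite -[x]scale1r fl scale1r; exact: VecSpanD.
- by rewrite -[_ *: _]addr0 fl f0 addr0; exact: vec_spanZ.
Qed.

Lemma vec_span_U d d' x : d' = d - 2 -> vec_span d x -> vec_span d' (opU true x).
Proof.
move=> dd'; apply: vec_span_linear dd'; first exact: linearP.
by move=> n l r; rewrite U_vec; apply: vec_span_vec; lia.
Qed.

Lemma vec_span_L d d' x : d' = d + 2 -> vec_span d x -> vec_span d' (opL true x).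
Proof.
move=> dd'; apply: vec_span_linear dd'; first exact: linearP.
move=> n [|l] r; first by rewrite L_vec0; exact: VecSpan0.
by rewrite L_vec; apply: VecSpanZ; lia.
Qed.

Lemma vec_span_Ki d x : vec_span d x -> vec_span d (opKi true x).
Proof.
apply: (vec_span_linear (e := 0)); rewrite ?addr0 //; first exact: linearP.
by move=> n l r; rewrite addr0 Ki_vec; exact: VecSpanZ.
Qed.

Lemma vec_span_U' d x : vec_span d x -> vec_span d (opU false x).
Proof.
apply: (vec_span_linear (e := 0)); rewrite ?addr0 //; first exact: linearP.
by move=> n l r; rewrite addr0 U'_vec; exact: vec_span_vec.
Qed.

Lemma vec_span_L' d x : vec_span d x -> vec_span d (opL false x).
Proof.
apply: (vec_span_linear (e := 0)); rewrite ?addr0 //; first exact: linearP.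
move=> n l [|r]; rewrite addr0; first by rewrite L'_vec0; exact: VecSpan0.
by rewrite L'_vec; exact: VecSpanZ.
Qed.

Lemma vec_span_Ki' d x : vec_span d x -> vec_span d (opKi false x).
Proof.
apply: (vec_span_linear (e := 0)); rewrite ?addr0 //; first exact: linearP.
by move=> n l r; rewrite addr0 Ki'_vec; exact: VecSpanZ.
Qed.

(** Raising a^(m+2) once on each side gives a combination of a^m and b c a^m. The coefficient of b c
    a^m contains the nonzero factor [m+2], so b c a^m can be solved for. *)
Lemma vec_span_bca m : vec_span m%:Z (g Gb * g Gc * a ^+ m).
Proof.
have E : vec m.+2 1 1 = (s ^+ m.+1 * qint m.+2) *:
    (s ^- m.+1 *: a ^+ m + (s ^- m.+1 * s ^- 2 + s ^+ m.+1 * qint m.+1) *: (g Gb * g Gc * a ^+ m)).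
  rewrite /vec /= (Ua false m.+1) linearZ /= opUM opUg /= Ka Ua opKig /=.
  congr (_ *: _); rewrite [a ^+ m.+1]exprS.
  rewrite -!scalerAr -scalerAl !mulrA (rel_da grel) -(rel_bc grel) mulrDl mul1r.
  rewrite -!scalerAl !scalerDr !scalerA -addrA -scalerDl; congr (_ + _ *: _).
  by rewrite [s ^+ m.+1]exprS; ring.
have cf : s ^- m.+1 * s ^- 2 + s ^+ m.+1 * qint m.+1 != 0.
  suff -> : s ^- m.+1 * s ^- 2 + s ^+ m.+1 * qint m.+1 = s ^+ m / s * qint m.+2.
    exact: mulf_neq0 (mulf_neq0 (expf_neq0 m s0) (invr_neq0 s0)) ((sa_qint_neq0 H) _).
  rewrite (qintS m.+1) mulnC exprM [s ^+ m.+1]exprS.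
  have := expf_neq0 m s0; move: (s ^+ m) (qint _) => x z x0.
  by field; rewrite x0 s0.
have h1 : vec_span m%:Z (vec m.+2 1 1) by apply: vec_span_vec; lia.
have h2 : vec_span m%:Z (a ^+ m) by apply: (@vec_span_vec _ m 0 0); lia.
have := vec_spanB (vec_spanZ (s ^+ m.+1 * qint m.+2)^-1 h1) (vec_spanZ (s ^- m.+1) h2).
rewrite E scalerK; last exact: mulf_neq0 (expf_neq0 _ s0) ((sa_qint_neq0 H) _).
by rewrite addrAC subrr add0r => /(vec_spanZ (s ^- m.+1 * s ^- 2 + s ^+ m.+1 * qint m.+1)^-1);
  rewrite scalerK.
Qed.

Lemma vec_span_dan n : vec_span (n%:Z - 1) (g Gd * a ^+ n).
Proof.
case: n => [|n].
  rewrite expr0 mulr1 sub0r.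
  have -> : g Gd = vec 1 1 1 by rewrite /vec /= expr1 !opUg.
  exact: vec_span_vec.
rewrite exprS mulrA (rel_da grel) mulrDl mul1r -scalerAl.
have -> : n.+1%:Z - 1 = n%:Z by lia.
apply: VecSpanD; last exact/vec_spanZ/vec_span_bca.
by apply: (@vec_span_vec _ n 0 0); lia.
Qed.

(** Both raising operators kill d, hence commute with multiplication by d up to the factor s; this
    reduces the claim to d a^n. *)
Lemma vec_span_d d d' x : d' = d - 1 -> vec_span d x -> vec_span d' (g Gd * x).
Proof.
move=> dd'; apply: vec_span_linear dd'.
  by move=> k u v; rewrite mulrDr scalerAr.
have dU t p : g Gd * opU t p = s *: opU t (g Gd * p).
  by rewrite opUM opUg opKig /= mul0r add0r -scalerAl scalerA mulfV // scale1r.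
move=> n l r; elim: l => [|l IHl].
  rewrite mulr0 subr0 /vec /=; elim: r => [|r IHr] /=; first exact: vec_span_dan.
  rewrite dU; apply: vec_spanZ.
  exact: vec_span_U'.
rewrite -U_vec dU; apply: vec_spanZ; apply: vec_span_U IHl; lia.
Qed.

(** On the left L d = c, so the Leibniz rule for L on d * K^-1 x expresses c x through
    multiplication by d alone. Below, b is obtained from d in this way by the right action, and a
    from b by the left one. *)
Lemma vec_span_c d d' x : d' = d + 1 -> vec_span d x -> vec_span d' (g Gc * x).
Proof.
move=> dd' hx; have -> : g Gc * x = opL true (g Gd * opKi true x) - s^-1 *: (g Gd * opL true (opKi true x)).
  by rewrite opLM opLg /= KKiE opKig /= -scalerAl addrK.
apply: vec_spanB.
  by apply: (@vec_span_L (d - 1)); [lia|apply: (@vec_span_d d) => //; exact: vec_span_Ki].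
apply: vec_spanZ; apply: (@vec_span_d (d + 2)); first lia.
by apply: (@vec_span_L d) => //; exact: vec_span_Ki.
Qed.

Lemma vec_span_b d d' x : d' = d - 1 -> vec_span d x -> vec_span d' (g Gb * x).
Proof.
move=> dd' hx; have -> : g Gb * x = opL false (g Gd * opKi false x) - s^-1 *: (g Gd * opL false (opKi false x)).
  by rewrite opLM opLg /= KKiE opKig /= -scalerAl addrK.
apply: vec_spanB.
  by apply: vec_span_L'; apply: (@vec_span_d d) => //; exact: vec_span_Ki'.
apply: vec_spanZ; apply: (@vec_span_d d) => //.
by apply: vec_span_L'; exact: vec_span_Ki'.
Qed.

Lemma vec_span_a d d' x : d' = d + 1 -> vec_span d x -> vec_span d' (a * x).
Proof.
move=> dd' hx; have -> : a * x = opL true (g Gb * opKi true x) - s^-1 *: (g Gb * opL true (opKi true x)).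
  by rewrite opLM opLg /= KKiE opKig /= -scalerAl addrK.
apply: vec_spanB.
  by apply: (@vec_span_L (d - 1)); [lia|apply: (@vec_span_b d) => //; exact: vec_span_Ki].
apply: vec_spanZ; apply: (@vec_span_b (d + 2)); first lia.
by apply: (@vec_span_L d) => //; exact: vec_span_Ki.
Qed.

Lemma vec_span_word w : vec_span (deg_sword w) (\prod_(x <- w) g x).
Proof.
elim: w => [|x w IHw].
  by rewrite /deg_sword !big_nil; apply: (@vec_span_vec 0 0 0 0).
rewrite big_cons; have -> : deg_sword (x :: w) = deg_sword w + deg_sgen x.
  by rewrite /deg_sword big_cons addrC.
case: x => /=.
- exact: vec_span_a IHw.
- exact: vec_span_b IHw.
- exact: vec_span_c IHw.
- exact: vec_span_d IHw.
Qed.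

(* The degree 1 - 2 b forces n = 2 k + 1 and l = k + b. *)
Lemma vec_span_odd (b : bool) x : vec_span (1 - 2 * b%:Z) x ->
  exists (N : nat) (c : nat -> nat -> C),
    x = \sum_(k < N) \sum_(i < (k.+1).*2) c k i *: vec k.*2.+1 (k + b) i.
Proof.
move dE: (1 - 2 * b%:Z) => d hx; elim: hx dE => {d x}.
- by move=> d _; exists 0, (fun _ _ => 0); rewrite big_ord0.
- move=> d x y _ IHx _ IHy dE.
  have [N [c xE]] := IHx dE; have [M [e yE]] := IHy dE.
  have pad P (f : nat -> nat -> C) Q : (P <= Q)%N ->
      \sum_(k < P) \sum_(i < (k.+1).*2) f k i *: vec k.*2.+1 (k + b) i =
      \sum_(k < Q) \sum_(i < (k.+1).*2) (if (k < P)%N then f k i else 0) *: vec k.*2.+1 (k + b) i.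
    move=> PQ; rewrite (big_ord_widen Q (fun k => \sum_(i < (k.+1).*2) f k i *: vec k.*2.+1 (k + b) i) PQ).
    rewrite big_mkcond; apply: eq_bigr => k _; case: ifP => // _.
    by rewrite big1 // => i _; rewrite scale0r.
  exists (maxn N M), (fun k i => (if (k < N)%N then c k i else 0) + (if (k < M)%N then e k i else 0)).
  rewrite xE yE (pad N c (maxn N M)) ?leq_maxl // (pad M e (maxn N M)) ?leq_maxr //.
  rewrite -big_split; apply: eq_bigr => k _; rewrite -big_split; apply: eq_bigr => i _.
  by rewrite scalerDl.
move=> d k n l r dE d1; have [nl lE] : n = (n./2).*2.+1 /\ l = (n./2 + b)%N.
  by have := odd_double_half n; case: (b) d1; case: (odd n) => /=; lia.
have [rn|rn] := leqP r n; last first.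
  by exists 0, (fun _ _ => 0); rewrite big_ord0 vec_eq0 ?scaler0 // rn orbT.
exists n./2.+1, (fun k' i => if (k' == n./2) && (i == r) then k else 0).
have rk : (r < (n./2.+1).*2)%N by lia.
rewrite big_ord_recr big1 /= => [|k' _]; last first.
  by rewrite big1 // => i _; rewrite ltn_eqF // scale0r.
rewrite add0r (bigD1 (Ordinal rk)) //= !eqxx big1 ?addr0 => [|i /negPf ir]; last first.
  by rewrite (_ : (i == r :> nat) = false) ?scale0r.
by rewrite -nl -lE.
Qed.

(** * The ladder vectors of degree 1 and -1 are free *)

Lemma low_coef_neq0 n l : (l < n)%N -> low_coef n l != 0.
Proof.
move=> ln; rewrite low_coefE ?(ltnW ln) // mulf_neq0 ?(sa_qint_neq0 H) //.
by rewrite -(subnSK ln) (sa_qint_neq0 H).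
Qed.

(** The lowering operators lead back to a^n with nonzero coefficients. *)
Lemma vec_neq0 n l r : (l <= n)%N -> (r <= n)%N -> vec n l r != 0.
Proof.
move=> ln; elim: r => [_|r IHr rn].
  elim: l ln => [_|l IHl ln]; first exact: (sa_neq0 H).
  apply: contra (IHl (ltnW ln)) => /eqP v0.
  by have /eqP := L_vec n l 0; rewrite v0 linear0 eq_sym scaler_eq0 (negPf (low_coef_neq0 ln)).
apply: contra (IHr (ltnW rn)) => /eqP v0.
by have /eqP := L'_vec n l r; rewrite v0 linear0 eq_sym scaler_eq0 (negPf (low_coef_neq0 rn)).
Qed.

(** Applying T - mu N to the relation removes the last term and multiplies the others by nonzero
    scalars, so induction applies. *)
Lemma eigenvectors_free (T : {linear A -> A}) (mu : nat -> C) (x : nat -> A) N :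
  {in gtn N &, injective mu} ->
  (forall k, (k < N)%N -> T (x k) = mu k *: x k) ->
  \sum_(k < N) x k = 0 -> forall k, (k < N)%N -> x k = 0.
Proof.
elim: N x => [|N IHN] x muI Tx // x0.
have low k : (k < N)%N -> x k = 0.
  move=> kN; have muN : mu k - mu N != 0.
    rewrite subr_eq0; apply/eqP => /muI; rewrite !inE ltnS (ltnW kN) ltnSn => /(_ isT isT) kE.
    by rewrite kE ltnn in kN.
  have hT : \sum_(i < N) (mu i - mu N) *: x i = 0.
    have := congr1 T x0; rewrite linear0 linear_sum /= big_ord_recr /= Tx // => Tx0.
    have := congr1 ( *:%R (mu N)) x0.
    rewrite scaler0 big_ord_recr /= scalerDr scaler_sumr => mx0.
    have := congr2 (fun u v => u - v) Tx0 mx0.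
    rewrite /= subrr opprD addrACA subrr addr0 -sumrB; apply: etrans.
    by apply: eq_bigr => i _; rewrite Tx ?scalerBl // (leqW (ltn_ord i)).
  have muI' : {in gtn N &, injective mu}.
    by move=> i j iN jN; apply: muI; rewrite inE (leqW iN, leqW jN).
  have := IHN (fun i => (mu i - mu N) *: x i) muI' _ hT k kN.
  have Tx' i : (i < N)%N -> T ((mu i - mu N) *: x i) = mu i *: ((mu i - mu N) *: x i).
    by move=> iN; rewrite linearZ /= Tx ?(leqW iN) // !scalerA mulrC.
  by move=> /(_ Tx')/eqP; rewrite scaler_eq0 (negPf muN) => /eqP.
move=> k; rewrite ltnS leq_eqVlt => /predU1P[->|]; last exact: low.
by rewrite -x0 big_ord_recr /= big1 ?add0r // => i _; exact: low.
Qed.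

(* L U (for b = 0) and U L (for b = 1) are the quantum Casimir operator up to *)
(* a constant.                                                                *)
Lemma casimir_vec (b : bool) k i :
  (if b then opU true (opL true (vec k.*2.+1 (k + b) i))
   else opL true (opU true (vec k.*2.+1 (k + b) i))) =
  qint k.+1 ^+ 2 *: vec k.*2.+1 (k + b) i.
Proof.
case: b; rewrite ?addn1 ?addn0.
  rewrite L_vec linearZ /= U_vec low_coefE; last by lia.
  by rewrite expr2 (_ : k.*2.+1 - k = k.+1)%N //; lia.
rewrite U_vec L_vec low_coefE; last by lia.
by rewrite expr2 (_ : k.*2.+1 - k = k.+1)%N //; lia.
Qed.

(** The Casimir, with eigenvalue [k+1]^2, splits the relation over k; the right K, with eigenvalue
    s^(2 i - 2 k - 1), then splits each part over i, leaving single nonzero vectors. *)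
Lemma vec_free (b : bool) (N : nat) (c : nat -> nat -> C) :
  \sum_(k < N) \sum_(i < (k.+1).*2) c k i *: vec k.*2.+1 (k + b) i = 0 ->
  forall k i, (k < N)%N -> (i < (k.+1).*2)%N -> c k i = 0.
Proof.
pose ul : {linear A -> A} := opU true \o opL true.
pose lu : {linear A -> A} := opL true \o opU true.
pose cas := if b then ul else lu.
move=> x0 k i kN ik.
have casE x : cas x = if b then opU true (opL true x) else opL true (opU true x).
  by rewrite /cas; case: (b).
have := @eigenvectors_free cas (fun k => qint k.+1 ^+ 2)
  (fun k => \sum_(i < (k.+1).*2) c k i *: vec k.*2.+1 (k + b) i) N _ _ x0 k kN.
move=> h; have {h} xk : \sum_(i < (k.+1).*2) c k i *: vec k.*2.+1 (k + b) i = 0.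
  apply: h => [k1 k2 _ _|k' _]; first exact: (sa_qint_inj H).
  rewrite linear_sum scaler_sumr; apply: eq_bigr => j _ /=.
  by rewrite linearZ /= casE casimir_vec !scalerA mulrC.
have := @eigenvectors_free (opK false) (fun i => s ^+ (2 * i) / s ^+ k.*2.+1)
  (fun i => c k i *: vec k.*2.+1 (k + b) i) (k.+1).*2 _ _ xk i ik.
move=> h; have /eqP : c k i *: vec k.*2.+1 (k + b) i = 0.
  apply: h => [i1 i2 _ _|i' _]; last by rewrite linearZ /= K'_vec !scalerA mulrC.
  by move/(mulIf (invr_neq0 (expf_neq0 _ s0)))/(sa_s_inj H).
rewrite scaler_eq0 => /orP[/eqP//|/eqP v0]; exfalso; move/eqP: v0; apply/negP.
by apply: vec_neq0; case: (b); lia.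
Qed.

(** The graded pieces, generated by words inside the quotient. [degree_part] gives the same sets
    through lifts to the free algebra; the inductive form suits arguments about products and
    operators. *)
Inductive homog : int -> A -> Prop :=
| Homog0 d : homog d 0
| HomogD d x y : homog d x -> homog d y -> homog d (x + y)
| HomogZ d k w : d = deg_sword w -> homog d (k *: \prod_(x <- w) g x).

Lemma homogZ d k x : homog d x -> homog d (k *: x).
Proof.
elim=> [e|e y z _ IHy _ IHz|e k' w dE].
- by rewrite scaler0; exact: Homog0.
- by rewrite scalerDr; exact: HomogD.
- by rewrite scalerA; exact: HomogZ.
Qed.

Lemma homogM d e x y : homog d x -> homog e y -> homog (d + e) (x * y).
Proof.
elim=> {d x} [d|d x z _ IHx _ IHz|d k w dE] hy.
- by rewrite mul0r; exact: Homog0.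
- by rewrite mulrDl; apply: HomogD; [exact: IHx|exact: IHz].
rewrite -scalerAl; apply: homogZ; elim: {e y}hy => [e|e y z _ IHy _ IHz|e k' w' eE].
- by rewrite mulr0; exact: Homog0.
- by rewrite mulrDr; exact: HomogD.
rewrite -scalerAr -big_cat; apply: HomogZ.
by rewrite /deg_sword big_cat dE eE.
Qed.

Lemma homog_gen d x : d = deg_sgen x -> homog d (g x).
Proof.
move=> ->; have -> : g x = 1 *: \prod_(y <- [:: x]) g y by rewrite scale1r big_seq1.
by apply: HomogZ; rewrite /deg_sword big_seq1.
Qed.

(** The left E sends a to b and c to d, so it lowers the degree by 2, and the left F undoes this;
    the right action exchanges generators of equal degree. *)
Definition shift (t : bool) (X : ugen) : int :=
  if t then match X with GE => -2 | GF => 2 | _ => 0 end else 0.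

Lemma homog_op_gen t X x : homog (deg_sgen x + shift t X) (op t X (g x)).
Proof.
rewrite opg; case: t; case: X; case: x => /=; first
  [exact: Homog0 | by apply: homogZ; apply: homog_gen | exact: homog_gen].
Qed.

Lemma homog_op_word t X w : homog (deg_sword w + shift t X) (op t X (\prod_(x <- w) g x)).
Proof.
elim: w X => [|x w IHw] X.
  rewrite big_nil op1 /act_one /deg_sword big_nil.
  have h1 : homog 0 1.
    have := @HomogZ 0 1 [::]; rewrite big_nil scale1r; apply.
    by rewrite /deg_sword big_nil.
  by case: X; rewrite /shift; case: t => //=; exact: Homog0.
have -> : deg_sword (x :: w) = deg_sgen x + deg_sword w by rewrite /deg_sword big_cons.
rewrite big_cons opM.
have hs (Y1 Y2 : ugen) : shift t Y1 + shift t Y2 = shift t X ->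
    homog (deg_sgen x + deg_sword w + shift t X)
      (op t Y1 (g x) * op t Y2 (\prod_(j <- w) g j)).
  by move=> <-; rewrite addrACA; apply: homogM => //; exact: homog_op_gen.
case: X hs => hs; rewrite /= !(big_cons, big_nil) /= addr0; do ?apply: HomogD;
  by apply: hs; rewrite /shift; case: (t).
Qed.

Lemma homog_op t X d d' x : d' = d + shift t X -> homog d x -> homog d' (op t X x).
Proof.
move=> -> ; elim=> {d x} [d|d x y _ IHx _ IHy|d k w ->].
- by rewrite linear0; exact: Homog0.
- by rewrite linearD; exact: HomogD.
- by rewrite linearZ; apply: homogZ; exact: homog_op_word.
Qed.

Lemma homog_vec n l r : homog (n%:Z - 2 * l%:Z) (vec n l r).
Proof.
elim: l => [|l IHl].
  rewrite mulr0 subr0 /vec /=; elim: r => [|r IHr] /=; last first.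
    by apply: (homog_op _ IHr); rewrite /shift addr0.
  elim: n => [|n IHn]; last by rewrite exprS -add1n PoszD; apply: homogM => //; exact: homog_gen.
  rewrite expr0; have := @HomogZ 0 1 [::]; rewrite big_nil scale1r; apply.
  by rewrite /deg_sword big_nil.
by rewrite -U_vec; apply: (homog_op _ IHl); rewrite /shift; lia.
Qed.

Lemma homog_vec_span d x : homog d x -> vec_span d x.
Proof.
elim=> {d x} [d|d x y _ IHx _ IHy|d k w ->].
- exact: VecSpan0.
- exact: VecSpanD.
- by apply: vec_spanZ; exact: vec_span_word.
Qed.

End Actions.

(** * Quantum integers for 0 < q < 1 *)

Section QuantumNumbers.
Context (R : realType) (q : R) (q0 : 0 < q) (q1 : q < 1).
Local Notation C := (R[i]).
Local Notation s := (hq q).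
Local Notation "[ n ]_q" := (qnum q n%:R) (at level 0, format "[ n ]_q").

Let qn0 : q != 0. Proof. exact: lt0r_neq0. Qed.
Let qge0 : 0 <= q. Proof. exact: ltW. Qed.

Lemma nu_lt0 : q - q^-1 < 0.
Proof. by rewrite subr_lt0 (lt_trans q1) // invf_gt1. Qed.

Lemma nu_neq0 : q - q^-1 != 0.
Proof. by rewrite lt_eqF ?nu_lt0. Qed.

Lemma qnum_nat n : [n]_q = (q ^+ n - q ^- n) / (q - q^-1).
Proof. by rewrite /qnum powRN powR_mulrn ?ltW. Qed.

Lemma qnum0 : [0]_q = 0.
Proof. by rewrite qnum_nat expr0 invr1 subrr mul0r. Qed.

Lemma qnumS n : [n.+1]_q = q ^- n + q * [n]_q.
Proof.
rewrite !qnum_nat exprS.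
have := expf_neq0 n qn0; move: (q ^+ n) => x x0.
have qq : q * q - 1 != 0.
  by rewrite (_ : _ - _ = q * (q - q^-1)) ?mulf_neq0 ?nu_neq0 // mulrBr mulfV.
by field; rewrite qn0 x0 qq.
Qed.

Lemma qnum_ge0 n : 0 <= [n]_q.
Proof.
elim: n => [|n IHn]; first by rewrite qnum0.
by rewrite qnumS; apply: addr_ge0; [rewrite invr_ge0 exprn_ge0|rewrite mulr_ge0].
Qed.

Lemma qnum_ge n : q ^- n <= [n.+1]_q.
Proof. by rewrite qnumS lerDl mulr_ge0 ?qnum_ge0. Qed.

Lemma qnum_gt0 n : 0 < [n.+1]_q.
Proof. by rewrite (lt_le_trans _ (qnum_ge n)) // invr_gt0 exprn_gt0. Qed.

(** q^n - q^-n decreases strictly in n, and the denominator q - q^-1 is negative. *)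
Lemma qnum_lt n : [n]_q < [n.+1]_q.
Proof.
rewrite !qnum_nat ltr_nM2r ?invr_lt0 ?nu_lt0 //.
have xq : q ^+ n.+1 < q ^+ n by rewrite ltr_iXn2l.
by rewrite ltrB ?ltf_pV2 ?posrE ?exprn_gt0.
Qed.

Lemma qnum_inj : injective (fun n => [n]_q).
Proof.
have mono : {homo (fun n => [n]_q) : m n / (m < n)%N >-> m < n}.
  by apply: homo_ltn => [x y z|n]; [exact: lt_trans|exact: qnum_lt].
move=> m n mn; case: (ltngtP m n) => // /mono; by rewrite mn ltxx.
Qed.

Lemma hq_exp n : s ^+ (2 * n) = (q ^+ n)%:C%C.
Proof. by rewrite exprM hq_sqr // -rmorphXn. Qed.

Lemma qint_hq n : qint s n = ([n]_q)%:C%C.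
Proof.
by rewrite /qint hq_exp hq_sqrV // hq_sqr // qnum_nat !(rmorphM, rmorphB, fmorphV).
Qed.

Lemma hq_nu : s ^+ 2 - s ^- 2 = (q - q^-1)%:C%C.
Proof. by rewrite hq_sqrV // hq_sqr // rmorphB. Qed.

Lemma hq_nu_neq0 : s ^+ 2 - s ^- 2 != 0.
Proof. by rewrite hq_nu fmorph_eq0 nu_neq0. Qed.

Lemma hq_inj : injective (fun n => s ^+ (2 * n)).
Proof.
move=> m n; rewrite !hq_exp => /complexI mn.
case: (ltngtP m n) => // lt_mn; first have := lt_mn; last have := lt_mn;
by rewrite -(ltr_iXn2l q0 q1) mn ltxx.
Qed.

Lemma qint_neq0 n : qint s n.+1 != 0.
Proof. by rewrite qint_hq fmorph_eq0 lt0r_neq0 ?qnum_gt0. Qed.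

Lemma qint_sqr_inj : injective (fun k => qint s k.+1 ^+ 2).
Proof.
move=> m n; rewrite !qint_hq -!rmorphXn => /complexI/eqP.
by rewrite eqrXn2 ?qnum_ge0 // => /eqP/qnum_inj[].
Qed.

End QuantumNumbers.

(** * Pairing and actions *)

Section FreeAlgebraModules.
Context (C : fieldType) (G : choiceType).
Local Notation F := (free_alg C G).

Lemma eq_linear_ext (V : lmodType C) (f h : seq G -> V) :
  f =1 h -> linear_ext f =1 linear_ext h :> (F -> V).
Proof. by move=> fh x; apply: eq_bigr => w _; rewrite fh. Qed.

Lemma linear_ext_linear (V : lmodType C) (h : {linear F -> V}) x :
  linear_ext (fun w => h (word C w)) x = h x.
Proof. by rewrite [in RHS](free_algE x) linear_sumZ. Qed.

Lemma linear_linear_ext (U V : lmodType C) (h : {linear U -> V}) (f : seq G -> U) x :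
  h (linear_ext f x) = linear_ext (fun w => h (f w)) x.
Proof. exact: linear_sumZ. Qed.

Section Representation.
Context (V : lmodType C) (rho : G -> {linear V -> V}).

Definition rep_word (w : seq G) (v : V) : V := foldr (fun X => rho X) v w.
Definition rep (x : F) (v : V) : V := linear_ext (rep_word^~ v) x.

Lemma rep_word_is_linear w : linear (rep_word w).
Proof. by elim: w => [//|X w IHw] k u v /=; rewrite IHw linearP. Qed.
HB.instance Definition _ w :=
  GRing.isLinear.Build C V V *:%R (rep_word w) (rep_word_is_linear w).

Lemma rep_wordE w v : rep (word C w) v = rep_word w v.
Proof. exact: linear_ext_word. Qed.

Lemma rep_is_linear x : linear (rep x).
Proof.
move=> k u v; rewrite /rep /linear_ext scaler_sumr -big_split; apply: eq_bigr => w _ /=.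
by rewrite linearP scalerDr !scalerA mulrC.
Qed.
HB.instance Definition _ x := GRing.isLinear.Build C V V *:%R (rep x) (rep_is_linear x).

Lemma rep0l v : rep 0 v = 0.
Proof. exact: (linear0 (linear_ext (rep_word^~ v))). Qed.
Lemma repDl x y v : rep (x + y) v = rep x v + rep y v.
Proof. exact: (linearD (linear_ext (rep_word^~ v))). Qed.
Lemma repBl x y v : rep (x - y) v = rep x v - rep y v.
Proof. exact: (linearB (linear_ext (rep_word^~ v))). Qed.
Lemma repZl k x v : rep (k *: x) v = k *: rep x v.
Proof. exact: (linearZZ (linear_ext (rep_word^~ v))). Qed.

Lemma repM x y v : rep (x * y) v = rep x (rep y v).
Proof.
rewrite /rep free_alg_mulE linear_sum; apply: eq_bigr => a _.
rewrite linear_sum [rep_word a _]linear_linear_ext /linear_ext scaler_sumr.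
apply: eq_bigr => b _; apply: (etrans (linear_ext_malgU _ _ _)).
by rewrite scalerA /= /rep_word foldr_cat.
Qed.

Lemma rep1 v : rep 1 v = v.
Proof. by rewrite -word_nil rep_wordE. Qed.

Lemma rep_gen X v : rep (gen C X) v = rho X v.
Proof. exact: rep_wordE. Qed.
End Representation.
End FreeAlgebraModules.

Section UqRepresentation.
Context (R : realType) (q : R).
Local Notation C := (R[i]).
Local Notation F := (free_alg C ugen).
Context (V : lmodType C) (rho : ugen -> {linear V -> V}).
Hypothesis rKKi : forall v, rho GK (rho GKi v) = v.
Hypothesis rKiK : forall v, rho GKi (rho GK v) = v.
Hypothesis rKE : forall v, rho GK (rho GE v) = q%:C%C *: rho GE (rho GK v).
Hypothesis rKiE : forall v, rho GKi (rho GE v) = (q^-1)%:C%C *: rho GE (rho GKi v).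
Hypothesis rKF : forall v, rho GK (rho GF v) = (q^-1)%:C%C *: rho GF (rho GK v).
Hypothesis rKiF : forall v, rho GKi (rho GF v) = q%:C%C *: rho GF (rho GKi v).
Hypothesis rEF : forall v, rho GE (rho GF v) - rho GF (rho GE v) =
  ((q - q^-1)^-1)%:C%C *: (rho GK (rho GK v) - rho GKi (rho GKi v)).

Lemma rep_Uq_rels r v : r \in Uq_rels q -> rep rho r v = 0.
Proof.
have E x y : rep rho (gen C x * gen C y) v = rho x (rho y v).
  by rewrite repM !rep_gen.
have f1 x y : rho x (rho y v) = v -> rep rho (gen C x * gen C y - 1) v = 0.
  by move=> h; rewrite repBl E rep1 h subrr.
have f2 x y z w k : rho x (rho y v) = k *: rho z (rho w v) ->
    rep rho (gen C x * gen C y - k *: (gen C z * gen C w)) v = 0.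
  move=> h; apply: (etrans (repBl _ _ _ _)).
  apply: (etrans (congr2 (fun u1 u2 => u1 - u2) (E _ _) (repZl _ _ _ _))).
  apply: (etrans (congr1 (fun u => _ - _ *: u) (E _ _))).
  by rewrite h subrr.
have E2 x : rep rho (gen C x ^+ 2) v = rho x (rho x v).
  by rewrite expr2; exact: (E x x).
have f3 x y z w k :
    rho x (rho y v) - rho y (rho x v) = k *: (rho z (rho z v) - rho w (rho w v)) ->
    rep rho (gen C x * gen C y - gen C y * gen C x - k *: (gen C z ^+ 2 - gen C w ^+ 2)) v = 0.
  move=> h; apply: (etrans (repBl _ _ _ _)).
  apply: (etrans (congr2 (fun u1 u2 => u1 - u2) (repBl _ _ _ _) (repZl _ _ _ _))).
  apply: (etrans (congr2 (fun u1 u2 => u1 - _ *: u2) (congr2 (fun u1 u2 => u1 - u2) (E _ _) (E _ _)) (repBl _ _ _ _))).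
  apply: (etrans (congr1 (fun u => _ - _ *: u) (congr2 (fun u1 u2 => u1 - u2) (E2 _) (E2 _)))).
  by rewrite h subrr.
rewrite /Uq_rels; cbv zeta.
move/(mem_seq7 (P := fun r => rep rho r v = 0)); apply.
- exact: (f1 _ _ (rKKi v)).
- exact: (f1 _ _ (rKiK v)).
- exact: (f2 _ _ _ _ _ (rKE v)).
- exact: (f2 _ _ _ _ _ (rKiE v)).
- exact: (f2 _ _ _ _ _ (rKF v)).
- exact: (f2 _ _ _ _ _ (rKiF v)).
- exact: (f3 _ _ _ _ _ (rEF v)).
Qed.

Lemma rep_Uq_ideal x v : two_sided_ideal (Uq_rels q) x -> rep rho x v = 0.
Proof.
move=> xI; elim: xI v => [|y z _ fy _ fz|l r y rP] v.
- exact: rep0l.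
- by rewrite repDl fy fz addr0.
- by rewrite !repM (rep_Uq_rels _ rP) linear0.
Qed.

Definition Urep (X : Uq q) (v : V) : V := rep rho (repr X) v.

Lemma Urep_cls x v : Urep (cls (Uq_rels q) x) v = rep rho x v.
Proof.
apply/eqP; rewrite -subr_eq0; apply/eqP.
have := rep_Uq_ideal v (repr_cls (Uq_rels q) x); apply: etrans.
exact: esym (repBl _ _ _ _).
Qed.
End UqRepresentation.

Section CounitLaws.
Context (R : realType) (V : lmodType R[i]).

Lemma cop_sgen_counitl (f : sgen -> V) x :
  \sum_(y <- cop_sgen x) counit_sgen R y.1 *: f y.2 = f x.
Proof. by case: x; rewrite /= !(big_cons, big_nil) /= !(scale1r, scale0r, addr0, add0r). Qed.

Lemma cop_sgen_counitr (f : sgen -> V) x :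
  \sum_(y <- cop_sgen x) counit_sgen R y.2 *: f y.1 = f x.
Proof. by case: x; rewrite /= !(big_cons, big_nil) /= !(scale1r, scale0r, addr0, add0r). Qed.

Lemma cop_counitl (f : seq sgen -> V) w :
  \sum_(p <- cop_sword w) counit_word R p.1 *: f p.2 = f w.
Proof.
elim: w f => [|x w IHw] f; first by rewrite big_seq1 /counit_word big_nil scale1r.
rewrite (big_cop_cons (fun u v => counit_word R u *: f v)).
rewrite -(cop_sgen_counitl (fun y => f (y :: w))); apply: eq_bigr => y _.
rewrite -(IHw (fun u => f (y.2 :: u))) scaler_sumr; apply: eq_bigr => p _.
by rewrite /counit_word big_cons scalerA.
Qed.

Lemma cop_counitr (f : seq sgen -> V) w :
  \sum_(p <- cop_sword w) counit_word R p.2 *: f p.1 = f w.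
Proof.
elim: w f => [|x w IHw] f; first by rewrite big_seq1 /counit_word big_nil scale1r.
rewrite (big_cop_cons (fun u v => counit_word R v *: f u)).
rewrite -(cop_sgen_counitr (fun y => f (y :: w))); apply: eq_bigr => y _.
rewrite -(IHw (fun u => f (y.1 :: u))) scaler_sumr; apply: eq_bigr => p _.
by rewrite /counit_word big_cons scalerA.
Qed.
End CounitLaws.

Section PairingAction.
Context (R : realType) (q : R).
Local Notation C := (R[i]).
Context (A : lmodType C) (sw : seq sgen -> A) (rho : ugen -> {linear A -> A}).
Context (eps : {linear A -> C^o}).
Hypothesis rho_sw : forall Y w, rho Y (sw w) =
  \sum_(p <- cop_sword w) pair_ugen q Y p.2 *: sw p.1.
Hypothesis eps_sw : forall w, eps (sw w) = counit_word R w.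

(** This is (X Y, p) = (X, p_(1)) (Y, p_(2)) read through coassociativity: acting letter by letter
    amounts to pairing the whole word with the second leg. *)
Lemma rep_word_sw v w : rep_word rho v (sw w) =
  \sum_(p <- cop_sword w) pair_uword q v p.2 *: sw p.1.
Proof.
elim: v w => [|Y v IHv] w /=; first by rewrite (cop_counitr sw).
rewrite IHv linear_sumZ.
transitivity (\sum_(p <- cop_sword w) \sum_(r <- cop_sword p.1)
    (pair_ugen q Y r.2 * pair_uword q v p.2) *: sw r.1).
  apply: eq_bigr => p _; rewrite rho_sw scaler_sumr; apply: eq_bigr => r _.
  by rewrite scalerA mulrC.
rewrite (cop_sword_coassoc (fun a b c => (pair_ugen q Y b * pair_uword q v c) *: sw a)).
by apply: eq_bigr => p _; rewrite scaler_suml.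
Qed.

(** The counit axiom leaves only the pairing. The pairing is thus recovered from the action and
    inherits its compatibility with the relations. *)
Lemma eps_rep_word v w : eps (rep_word rho v (sw w)) = pair_uword q v w.
Proof.
rewrite rep_word_sw linear_sumZ -[RHS](cop_counitl (fun u => pair_uword q v u : C^o)).
by apply: eq_bigr => p _; rewrite eps_sw [LHS]mulrC.
Qed.

Lemma pairing_freeE X p :
  pairing_free q X p = eps (rep rho X (linear_ext sw p)).
Proof.
rewrite /pairing_free /rep linear_linear_ext; apply: eq_bigr => v _; congr (_ *: _).
rewrite [RHS](linear_linear_ext (eps \o rep_word rho v)); apply: eq_bigr => w _.
by rewrite /= eps_rep_word.
Qed.

Lemma cop_rep X w :
  \sum_(p <- cop_sword w) eps (rep rho X (sw p.2)) *: sw p.1 = rep rho X (sw w).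
Proof.
rewrite [RHS]/rep.
rewrite /linear_ext; under [RHS]eq_bigr => v _ do rewrite rep_word_sw scaler_sumr.
rewrite exchange_big; apply: eq_bigr => p _ /=.
rewrite /rep /linear_ext linear_sumZ scaler_suml; apply: eq_bigr => v _.
by rewrite eps_rep_word scalerA.
Qed.
End PairingAction.

Section HopfActions.
Context (R : realType) (q : R) (q0 : 0 < q).
Local Notation C := (R[i]).
Local Notation A := (SUq2 q).

Local Notation lop := (lop q0).

Lemma lop_sword Y w : lop true Y (sword q w) =
  \sum_(p <- cop_sword w) pair_ugen q Y p.2 *: sword q p.1.
Proof. exact: (act_sword q0 true Y w). Qed.

Definition counit_lin : {linear A -> C^o} := @counit R q.

Lemma counit_sword w : counit_lin (sword q w) = counit_word R w.
Proof. exact: etrans (counit_cl q _) (counit_free_word R w). Qed.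

Lemma cl_linear_ext p : cl q p = linear_ext (sword q) p.
Proof. exact: esym (linear_ext_linear (cl q) p). Qed.

Lemma pairing_freeE' X p : pairing_free q X p = counit_lin (rep (lop true) X (cl q p)).
Proof. by rewrite (pairing_freeE lop_sword counit_sword) cl_linear_ext. Qed.

Lemma repr_sword w : cl q (repr (sword q w)) = sword q w.
Proof. exact: reprP. Qed.

Lemma pairing_sword X w :
  pairing X (sword q w) = counit_lin (rep (lop true) (repr X) (sword q w)).
Proof. exact: etrans (pairing_freeE' _ _) (congr1 _ (congr1 _ (repr_sword w))). Qed.

(** [lact] is computed from representatives; since the pairing is the counit of the action,
    [cop_rep] reassembles the sum over the coproduct into the operators [lop]. *)
Lemma lact_rep X p : lact X p = rep (lop true) (repr X) p.
Proof.
have E w : \sum_(s <- cop_sword w) pairing X (sword q s.2) *: sword q s.1 =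
    rep (lop true) (repr X) (sword q w).
  rewrite -(cop_rep lop_sword counit_sword); apply: eq_bigr => s _.
  by rewrite pairing_sword.
apply: (etrans (eq_linear_ext E (repr p))).
apply: (etrans (esym (linear_linear_ext (rep (lop true) (repr X)) (sword q) (repr p)))).
congr (rep _ _ _); apply: (etrans (esym (cl_linear_ext _))); exact: reprP.
Qed.

End HopfActions.

(** * Normalised kets and the action of D_+, D_- and D_0 on them *)

Section Kets.
Context (R : realType) (q : R) (q0 : 0 < q) (q1 : q < 1).
Local Notation C := (R[i]).
Local Notation s := (hq q).
Local Notation "[ n ]_q" := (qnum q n%:R) (at level 0, format "[ n ]_q").
Context (A : algType C) (g : sgen -> A) (op : bool -> ugen -> {linear A -> A}).
Hypothesis H : SUq2_actions s g op.
Local Notation vec := (vec g op).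
Local Notation K := (opK op).
Local Notation Ki := (opKi op).
Local Notation U := (opU op).
Local Notation L := (opL op).

(** The product of the square roots prescribed for the steps from m = -j upwards, so that dividing
    by it puts the right module in standard form. *)
Definition ket_norm (k i : nat) : R :=
  \prod_(t < i) Num.sqrt ([t.+1]_q * [k.*2.+1 - t]_q).
(** The factor 1 / [k+1] on the plus side makes the left E and F exchange the signs with the same
    coefficient [j+1/2], so that the blocks of $D$ become symmetric. *)
Definition ket_coef (b : bool) (k i : nat) : R :=
  (if b then [k.+1]_q^-1 else 1) / ket_norm k i.
Definition norm_ket (b : bool) (k i : nat) : A :=
  (ket_coef b k i)%:C%C *: vec k.*2.+1 (k + b) i.

Lemma hq_half : s = (q `^ 2^-1)%:C%C. Proof. by []. Qed.

Lemma hq_pow (n : nat) : s ^+ n = (q `^ (n%:R / 2))%:C%C.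
Proof. by rewrite /hq -rmorphXn /= -powR_mulrn ?powR_ge0 // -powRrM mulrC. Qed.

Lemma qnum_gt0' n : (0 < n)%N -> 0 < [n]_q.
Proof. by case: n => // n _; exact: qnum_gt0. Qed.

Lemma ket_norm_gt0 k i : (i <= k.*2.+1)%N -> 0 < ket_norm k i.
Proof.
move=> ik; apply: prodr_gt0 => t _; rewrite sqrtr_gt0 mulr_gt0 ?qnum_gt0' //.
by rewrite subn_gt0 (leq_trans (ltn_ord t)).
Qed.

Lemma ket_coef_neq0 b k i : (i <= k.*2.+1)%N -> ket_coef b k i != 0.
Proof.
move=> ik; apply: mulf_neq0; last by rewrite invr_eq0 lt0r_neq0 // ket_norm_gt0.
by case: b; rewrite ?oner_eq0 // invr_eq0 lt0r_neq0 // qnum_gt0.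
Qed.

Lemma odd_natr k : k.*2.+1%:R = 2 * k%:R + 1 :> R.
Proof. by rewrite -natr1 -mul2n natrM. Qed.

Lemma jm_add k i : jval R k + mval R k i = i%:R.
Proof. by rewrite /mval addrC subrK. Qed.

Lemma jm_sub k i : (i <= k.*2.+1)%N -> jval R k - mval R k i = (k.*2.+1 - i)%:R.
Proof.
move=> ik; rewrite natrB // /mval /jval odd_natr.
by field.
Qed.

Lemma K_ket_right b k i : K false (norm_ket b k i) = (q `^ mval R k i)%:C%C *: norm_ket b k i.
Proof.
rewrite /norm_ket linearZ /= (K'_vec H) !scalerA mulrC; congr (_ * _ *: _).
rewrite !hq_pow -fmorphV -rmorphM -powRN -powRD; last by rewrite lt0r_neq0 ?implybT.
congr (_%:C%C); congr (q `^ _).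
by rewrite /mval /jval natrM odd_natr; field.
Qed.

Lemma ket_normS k i : ket_norm k i.+1 = ket_norm k i * Num.sqrt ([i.+1]_q * [k.*2.+1 - i]_q).
Proof. by rewrite /ket_norm big_ord_recr. Qed.

Lemma L_ket_right b k i : (i <= k.*2.+1)%N -> let j := jval R k in let m := mval R k i in
  L false (norm_ket b k i) =
  (Num.sqrt (qnum q (j + m) * qnum q (j - m + 1)))%:C%C *: norm_ket b k i.-1.
Proof.
move=> ik /=; rewrite jm_add jm_sub // /norm_ket linearZ /=.
case: i ik => [|i] ik.
  by rewrite (L'_vec0 H) scaler0 (qnum0 q0) mul0r sqrtr0 scale0r.
rewrite (L'_vec H) (low_coefE H) ?(ltnW ik) // !qint_hq //= !scalerA.
congr (_ *: _); rewrite -!rmorphM; congr (_%:C%C).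
have -> : (k.*2.+1 - i.+1)%:R + 1 = (k.*2.+1 - i)%:R :> R by rewrite natr1 subnSK.
rewrite /ket_coef ket_normS.
have P : 0 < [i.+1]_q * [k.*2.+1 - i]_q by rewrite mulr_gt0 ?qnum_gt0' // subn_gt0.
have r0 : Num.sqrt ([i.+1]_q * [k.*2.+1 - i]_q) != 0 by rewrite lt0r_neq0 // sqrtr_gt0.
have n0 : ket_norm k i != 0 by rewrite lt0r_neq0 // ket_norm_gt0 // ltnW.
(* [low_coef] is the square of the root r, and one factor r cancels against the last factor of the
   norm. *)
rewrite -{2}(sqr_sqrtr (ltW P)); move: (Num.sqrt _) (ket_norm k i) r0 n0 => r n r0 n0.
by case: b; field; rewrite ?r0 ?n0 ?lt0r_neq0 ?qnum_gt0.
Qed.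

Lemma U_ket_right b k i : (i <= k.*2.+1)%N -> let j := jval R k in let m := mval R k i in
  U false (norm_ket b k i) =
  (Num.sqrt (qnum q (j - m) * qnum q (j + m + 1)))%:C%C *: norm_ket b k i.+1.
Proof.
move=> ik /=; rewrite jm_add jm_sub // /norm_ket linearZ /= (U'_vec H).
(* At m = j the next index leaves the ladder, where [vec] vanishes. *)
have [ki|ki] := leqP k.*2.+1 i.
  by rewrite (vec_eq0 H) ?ltnS ?ki ?orbT // !scaler0.
rewrite scalerA; congr (_ *: _); rewrite -!rmorphM; congr (_%:C%C).
rewrite natr1 (mulrC [k.*2.+1 - i]_q) /ket_coef ket_normS.
have P : 0 < [i.+1]_q * [k.*2.+1 - i]_q by rewrite mulr_gt0 ?qnum_gt0' // subn_gt0.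
have r0 : Num.sqrt ([i.+1]_q * [k.*2.+1 - i]_q) != 0 by rewrite lt0r_neq0 // sqrtr_gt0.
have n0 : ket_norm k i != 0 by rewrite lt0r_neq0 // ket_norm_gt0 // ltnW.
move: (Num.sqrt _) (ket_norm k i) r0 n0 => r n r0 n0.
by case: b; field; rewrite ?r0 ?n0 ?lt0r_neq0 ?qnum_gt0.
Qed.

Lemma U_ket k i : U true (norm_ket false k i) = ([k.+1]_q)%:C%C *: norm_ket true k i.
Proof.
rewrite /norm_ket linearZ /= U_vec scalerA addn0 addn1; congr (_ *: _).
by rewrite -rmorphM /ket_coef mulrA mulfV ?mul1r // lt0r_neq0 ?qnum_gt0.
Qed.

Lemma UL_vec_sqr k i : L true (vec k.*2.+1 k.+1 i) = (([k.+1]_q) ^+ 2)%:C%C *: vec k.*2.+1 k i.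
Proof.
rewrite (L_vec H) (low_coefE H) ?leqW ?leq_double // ?qint_hq //; last by lia.
by rewrite (_ : k.*2.+1 - k = k.+1)%N ?expr2 ?rmorphM //; lia.
Qed.

Lemma L_ket k i : L true (norm_ket true k i) = ([k.+1]_q)%:C%C *: norm_ket false k i.
Proof.
rewrite /norm_ket linearZ /= addn1 addn0 UL_vec_sqr !scalerA; congr (_ *: _).
rewrite -!rmorphM /ket_coef; congr (_%:C%C); move: (ket_norm k i)^-1 => x.
by rewrite mul1r expr2; field; rewrite lt0r_neq0 ?qnum_gt0.
Qed.

Lemma K_ket b k i : K true (norm_ket b k i) = (if b then s else s^-1) *: norm_ket b k i.
Proof.
rewrite /norm_ket linearZ /= (K_vec H) !scalerA mulrC; congr (_ * _ *: _).
rewrite exprS -mul2n; have := expf_neq0 (2 * k) (sa_s0 H).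
case: b => x0; last first.
  rewrite addn0; move: (s ^+ (2 * k)) x0 (sa_s0 H) => x x0 s0.
  by field; rewrite s0 x0.
rewrite addn1 mulnS (exprD s 2); move: (s ^+ (2 * k)) x0 (sa_s0 H) => x x0 s0.
by field; rewrite s0 x0.
Qed.

Lemma Ki_ket b k i : Ki true (norm_ket b k i) = (if b then s^-1 else s) *: norm_ket b k i.
Proof.
have := congr1 (Ki true) (K_ket b k i); rewrite (KiKE H) linearZ /= => E.
rewrite [in RHS]E scalerA; have s0 := sa_s0 H.
by case: (b); rewrite ?mulVf ?mulfV ?scale1r.
Qed.

(** This is [j] [j+1] = [j+1/2]^2 - [1/2]^2 times q^-1 nu^2, with j + 1/2 = k + 1. *)
Lemma jval_qnum k : q^-1 * nu q ^+ 2 * qnum q (jval R k) * qnum q (jval R k + 1) =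
  q^-1 * nu q ^+ 2 * [k.+1]_q ^+ 2 + 2 * q^-1 - 1 - q ^- 2.
Proof.
have h0 : q `^ 2^-1 != 0 by rewrite lt0r_neq0 // powR_gt0.
have h2 : q = (q `^ 2^-1) ^+ 2.
  by rewrite -powR_mulrn ?powR_ge0 // -powRrM mulVf ?powRr1 // ltW.
have qne : q != 0 by rewrite lt0r_neq0.
have qD x y : q `^ (x + y) = q `^ x * q `^ y by rewrite powRD // qne implybT.
have jE : q `^ (jval R k) = q ^+ k * q `^ 2^-1.
  by rewrite /jval qD powR_mulrn ?ltW.
have j1E : q `^ (jval R k + 1) = q ^+ k * q `^ 2^-1 * q.
  by rewrite qD jE powRr1 ?ltW.
rewrite qnum_nat // /qnum /nu !powRN j1E jE (exprS q k).
have := expf_neq0 k qne; move: (q ^+ k) => x x0.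
have : q * q - 1 != 0.
  rewrite (_ : _ - _ = q * (q - q^-1)) ?mulf_neq0 ?nu_neq0 //.
  by rewrite mulrBr mulfV.
move: (q `^ 2^-1) h0 h2 => y y0 -> qq.
by field; rewrite ?x0 ?y0 -?expr2 ?qq //; move: qq; rewrite !expr2 => ->.
Qed.

Lemma KK_ket b k i :
  K true (K true (norm_ket b k i)) = (if b then q else q^-1)%:C%C *: norm_ket b k i.
Proof.
rewrite K_ket linearZ /= K_ket scalerA -expr2; congr (_ *: _).
by case: b; rewrite ?exprVn ?hq_sqrV ?hq_sqr.
Qed.

Lemma KiKi_ket b k i :
  Ki true (Ki true (norm_ket b k i)) = (if b then q^-1 else q)%:C%C *: norm_ket b k i.
Proof.
rewrite Ki_ket linearZ /= Ki_ket scalerA -expr2; congr (_ *: _).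
by case: b; rewrite ?exprVn ?hq_sqrV ?hq_sqr.
Qed.

(** On the minus side [U_ket] and [L_ket] compose directly. On the plus side the order is exchanged
    first, and the commutator takes the value 1 there. *)
Lemma LU_ket b k i : L true (U true (norm_ket b k i)) =
  ([k.+1]_q ^+ 2 - (if b then 1 else 0))%:C%C *: norm_ket b k i.
Proof.
case: b; last by rewrite U_ket linearZ /= L_ket scalerA -rmorphM subr0 expr2.
have := ULE H true (norm_ket true k i).
rewrite L_ket linearZ /= U_ket KK_ket KiKi_ket (hq_nu q0).
move: (norm_ket true k i) (L true _) => v w; rewrite -scalerBl !scalerA -(rmorphB _ q).
rewrite mulVf ?scale1r => [E|]; last by rewrite fmorph_eq0 nu_neq0.
apply: (addIr v); rewrite -E -[in RHS](scale1r v) scalerA mulr1 -scalerDl.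
by congr (_ *: _); rewrite rmorphB rmorph1 subrK rmorphXn.
Qed.

(** D_0 is an affine function of the Casimir, so the scalar is the same for both signs: the shift by
    1 in [LU_ket] compensates the two values of K^2 and K^-2. *)
Lemma D0_ket b k i :
  K true (K true (norm_ket b k i)) + (nu q ^+ 2 * q^-1)%:C%C *: L true (U true (norm_ket b k i))
  - norm_ket b k i + (q ^- 2)%:C%C *: (Ki true (Ki true (norm_ket b k i)) - norm_ket b k i) =
  (q^-1 * nu q ^+ 2 * qnum q (jval R k) * qnum q (jval R k + 1))%:C%C *: norm_ket b k i.
Proof.
have qne : q != 0 by rewrite lt0r_neq0.
rewrite LU_ket KK_ket KiKi_ket jval_qnum; move: (norm_ket b k i) [k.+1]_q => v z.
have lin (x e y h w : C) : x *: v + e *: (y *: v) - v + h *: (w *: v - v) =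
    (x + e * y - 1 + h * (w - 1)) *: v.
  rewrite scalerA scalerBr scalerA mulrBr mulr1 (scalerDl _ _ (h * w - h)).
  by rewrite !scalerBl scalerDl scale1r.
rewrite lin; congr (_ *: _); rewrite -(rmorph1 (real_complex R)).
rewrite -!(rmorphM, rmorphB, rmorphD) /=; congr (_%:C%C).
by rewrite /nu; case: b; field; rewrite qne.
Qed.

Lemma ket_span (b : bool) x : vec_span g op (1 - 2 * b%:Z) x ->
  exists (N : nat) (c : nat -> nat -> C),
    x = \sum_(k < N) \sum_(i < mult k) c k i *: norm_ket b k i.
Proof.
move=> /(vec_span_odd H) [N [c ->]]; exists N, (fun k i => c k i / (ket_coef b k i)%:C%C).
apply: eq_bigr => k _; apply: eq_bigr => i _; rewrite /norm_ket scalerA divfK //.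
by rewrite fmorph_eq0 ket_coef_neq0 // -ltnS -doubleS ltn_ord.
Qed.

Lemma ket_free (b : bool) (N : nat) (c : nat -> nat -> C) :
  \sum_(k < N) \sum_(i < mult k) c k i *: norm_ket b k i = 0 ->
  forall k i, (k < N)%N -> (i < mult k)%N -> c k i = 0.
Proof.
move=> c0 k i kN ik.
have E : \sum_(k < N) \sum_(i < mult k) (c k i * (ket_coef b k i)%:C%C) *: vec k.*2.+1 (k + b) i = 0.
  by apply: etrans c0; apply: eq_bigr => k' _; apply: eq_bigr => i' _; rewrite /norm_ket scalerA.
have /eqP := @vec_free _ _ _ _ _ H b N (fun k i => c k i * (ket_coef b k i)%:C%C) E k i kN ik.
rewrite mulf_eq0 fmorph_eq0 (negPf (ket_coef_neq0 _ _)) ?orbF; first by move/eqP.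
by rewrite -ltnS -doubleS.
Qed.
End Kets.

Lemma sub_of_add (V : zmodType) (x y z : V) : x = y + z -> x - y = z.
Proof. by move=> ->; rewrite addrAC subrr add0r. Qed.

(** * The actions of U_q on A[SU_q(2)] realise the abstract setting *)

Section SUq2Instance.
Context (R : realType) (q : R) (q0 : 0 < q) (q1 : q < 1).
Local Notation C := (R[i]).
Local Notation A := (SUq2 q).
Local Notation s := (hq q).
Local Notation lop := (lop q0).
Local Notation sg := (sg q).

Lemma sword_prod w : sword q w = \prod_(x <- w) sg x.
Proof.
elim: w => [|x w IHw]; first by rewrite sword_nil big_nil.
by rewrite sword_cons IHw big_cons.
Qed.

Lemma sg_exp n : sg Ga ^+ n = sword q (nseq n Ga).
Proof. by rewrite sword_prod big_nseq -Monoid.iteropE. Qed.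

(** The counit sends a^n to 1. *)
Lemma sg_exp_neq0 n : sg Ga ^+ n != 0.
Proof.
rewrite sg_exp; apply/eqP => w0.
have := counit_sword q (nseq n Ga); rewrite w0 linear0 /counit_word big_nseq /=.
by elim: n {w0} => [|n IHn] /=; [move/esym/eqP; rewrite oner_eq0|rewrite mul1r].
Qed.

Lemma SUq2_actionsP : SUq2_actions s sg lop.
Proof.
split.
- exact: hq_neq0.
- exact: hq_nu_neq0.
- exact: hq_inj.
- exact: qint_neq0.
- exact: qint_sqr_inj.
- exact: sg_relations.
- by move=> t X x y; exact: actM.
- by move=> t X; exact: act1.
- by move=> t X x; exact: act_sg.
- by move=> X Y x; exact: act_comm.
- move=> Q Q0 QD Qw; apply: (SUq2_ind Q0 QD) => k w.
  by rewrite sword_prod; exact: Qw.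
- exact: sg_exp_neq0.
Qed.

Local Notation cU := (cls (Uq_rels q)).

(** The left operators satisfy the relations of U_q, so an element of U_q acts through any of its
    lifts. *)
Lemma Urep_lop x p : Urep (lop true) (cU x) p = rep (lop true) x p.
Proof.
have H := SUq2_actionsP; have s2 := hq_sqr q0; have s2V := hq_sqrV q0.
apply: Urep_cls => v; rewrite -?s2V -?s2.
- exact: (KKiE H true v).
- exact: (KiKE H true v).
- exact: (KUE H true v).
- exact: (KiUE H true v).
- exact: (KLE H true v).
- exact: (KiLE H true v).
- have -> : ((q - q^-1)^-1)%:C%C = (s ^+ 2 - s ^- 2)^-1 by rewrite (hq_nu q0) fmorphV.
  by apply: sub_of_add; exact: (ULE H true v).
Qed.

Lemma lact_cls x p : lact (cU x) p = rep (lop true) x p.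
Proof. exact: etrans (lact_rep q0 _ _) (Urep_lop _ _). Qed.

Lemma lactM (X Y : Uq q) (p : A) : lact (X * Y) p = lact X (lact Y p).
Proof.
elim/presentedP: X => x; elim/presentedP: Y => y.
apply: (etrans (congr1 (fun Z : Uq q => lact Z p) (esym (clsMr (Uq_rels q) x y)))).
apply: (etrans (lact_cls (x * y) p)); apply: (etrans (repM (lop true) x y p)).
apply: esym; apply: (etrans (lact_cls x _)).
exact: (congr1 (rep (lop true) x) (lact_cls y p)).
Qed.

Lemma lactZ k (X : Uq q) (p : A) : lact (k *: X) p = k *: lact X p.
Proof.
elim/presentedP: X => x.
apply: (etrans (congr1 (fun Z : Uq q => lact Z p) (clsZ (Uq_rels q) k x))).
apply: (etrans (lact_cls (k *: x) p)); apply: (etrans (repZl (lop true) k x p)).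
exact: (congr1 ( *:%R k) (esym (lact_cls x p))).
Qed.

Lemma lactD (X Y : Uq q) (p : A) : lact (X + Y) p = lact X p + lact Y p.
Proof.
elim/presentedP: X => x; elim/presentedP: Y => y.
apply: (etrans (congr1 (fun Z : Uq q => lact Z p) (esym (clsD (Uq_rels q) x y)))).
apply: (etrans (lact_cls (x + y) p)); apply: (etrans (repDl (lop true) x y p)).
exact: (congr2 +%R (esym (lact_cls x p)) (esym (lact_cls y p))).
Qed.

Lemma lact1 (p : A) : lact 1 p = p.
Proof. exact: etrans (lact_cls 1 p) (rep1 _ _). Qed.

Lemma lact_gen Y p : lact (cU (gen C Y)) p = lop true Y p.
Proof. exact: etrans (lact_cls _ p) (rep_gen _ _ _). Qed.

Lemma lactB (X Y : Uq q) (p : A) : lact (X - Y) p = lact X p - lact Y p.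
Proof.
apply: (etrans (lactD X (- Y) p)); apply: (congr1 (+%R (lact X p))).
rewrite -scaleN1r; apply: (etrans (lactZ (-1) Y p)); exact: scaleN1r.
Qed.

Lemma lact_is_linear (X : Uq q) : linear (lact X).
Proof.
move=> k u v; apply: (etrans (lact_rep q0 X (k *: u + v))).
apply: (etrans (rep_is_linear (lop true) (repr X) k u v)).
exact: (congr2 (fun a b => k *: a + b) (esym (lact_rep q0 X u)) (esym (lact_rep q0 X v))).
Qed.

Lemma lact_Dplus p : lact (Dplus q) p = (q `^ (- 2^-1))%:C%C *: lop true GE (lop true GKi p).
Proof. by rewrite /Dplus /Lplus lactZ lactM /uE /uKi !lact_gen. Qed.

Lemma lact_Dminus p : lact (Dminus q) p = (q `^ (2^-1))%:C%C *: lop true GF (lop true GKi p).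
Proof. by rewrite /Dminus /Lminus lactZ lactM /uF /uKi !lact_gen. Qed.

Lemma lact_Dzero p : lact (Dzero q) p =
  lop true GK (lop true GK p) + (nu q ^+ 2 * q^-1)%:C%C *: lop true GF (lop true GE p) - p
  + (q ^- 2)%:C%C *: (lop true GKi (lop true GKi p) - p).
Proof.
have lact_poly (k h : C) (K F E Ki : Uq q) :
    lact (K ^+ 2 + k *: (F * E) - 1 + h *: (Ki ^+ 2 - 1)) p =
    lact K (lact K p) + k *: lact F (lact E p) - p + h *: (lact Ki (lact Ki p) - p).
  pose sub (u v : A) := u - v.
  apply: (etrans (lactD (K ^+ 2 + k *: (F * E) - 1) (h *: (Ki ^+ 2 - 1)) p)).
  apply: (congr2 +%R).
    apply: (etrans (lactB (K ^+ 2 + k *: (F * E)) 1 p)); apply: (congr2 sub _ (lact1 p)).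
    apply: (etrans (lactD (K ^+ 2) (k *: (F * E)) p)); apply: (congr2 +%R (lactM K K p)).
    exact: (etrans (lactZ k (F * E) p) (congr1 ( *:%R k) (lactM F E p))).
  apply: (etrans (lactZ h (Ki ^+ 2 - 1) p)); apply: (congr1 ( *:%R h)).
  exact: (etrans (lactB (Ki ^+ 2) 1 p) (congr2 sub (lactM Ki Ki p) (lact1 p))).
have lact_poly' (k h : C) (K F E Ki : Uq q) (fK fF fE fKi : A -> A) :
    lact K =1 fK -> lact F =1 fF -> lact E =1 fE -> lact Ki =1 fKi ->
    lact (K ^+ 2 + k *: (F * E) - 1 + h *: (Ki ^+ 2 - 1)) p =
    fK (fK p) + k *: fF (fE p) - p + h *: (fKi (fKi p) - p).
  by move=> hK hF hE hKi; apply: (etrans (lact_poly k h K F E Ki)); rewrite !hK !hF !hE !hKi.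
exact: lact_poly' (lact_gen GK) (lact_gen GF) (lact_gen GE) (lact_gen GKi).
Qed.

Lemma pair_uword1 Y w : pair_uword q [:: Y] w = pair_ugen q Y w.
Proof.
rewrite /= -[RHS](cop_counitr (fun u => pair_ugen q Y u : C^o)).
by apply: eq_bigr => p _; rewrite mulrC.
Qed.

(** The pairing of a generator with a word is, through the left action and the counit, the value
    [pair_ugen]; hence [ract] agrees with the right operators built above. *)
Lemma ract_gen Y p : ract p (cU (gen C Y)) = lop false Y p.
Proof.
have E w : \sum_(r <- cop_sword w) pairing (cU (gen C Y)) (sword q r.1) *: sword q r.2 =
    act_word q false Y w.
  apply: eq_bigr => r _; congr (_ *: _).
  apply: (etrans (pairing_sword q0 _ _)).
  apply: (etrans (congr1 (counit_lin q) (Urep_lop (gen C Y) (sword q r.1)))).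
  apply: (etrans (congr1 (counit_lin q) (rep_wordE (lop true) [:: Y] (sword q r.1)))).
  apply: (etrans (eps_rep_word (lop_sword q0) (counit_sword q) [:: Y] r.1)).
  exact: pair_uword1.
exact: eq_linear_ext E (repr p).
Qed.
End SUq2Instance.

(** * Comparison of the two descriptions of the grading *)

Section DegreeParts.
Context (R : realType) (q : R).
Local Notation C := (R[i]).
Local Notation A := (SUq2 q).
Local Notation F := (free_alg C sgen).

Definition homogeneous (d : int) (p : F) : Prop :=
  forall w : fmonom sgen, mcoeff w p != 0 -> deg_sword w = d.

Lemma homogeneous0 d : homogeneous d 0.
Proof. by move=> w; rewrite mcoeff0 eqxx. Qed.

Lemma homogeneousD d x y : homogeneous d x -> homogeneous d y -> homogeneous d (x + y).
Proof.
move=> hx hy w; rewrite mcoeffD => xy.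
have [x0|x0] := eqVneq (mcoeff w x) 0; last exact: hx.
by apply: hy; move: xy; rewrite x0 add0r.
Qed.

Lemma homogeneous_word d k w : d = deg_sword w -> homogeneous d (k *: word C w).
Proof.
move=> -> u; rewrite scale_wordE mcoeffU /=.
by case: (FMonom w =P u) => [<- //|_]; rewrite mulr0n eqxx.
Qed.

Lemma homog_degree_part d x : homog (sg q) d x -> degree_part d x.
Proof.
elim=> {d x} [d|d x y _ [u uh <-] _ [v vh <-]|d k w dE].
- exists 0; [exact: homogeneous0|exact: linear0 (cl q)].
- exists (u + v); [exact: homogeneousD|exact: linearD (cl q) u v].
- exists (k *: word C w); first exact: homogeneous_word.
  by rewrite -sword_prod; exact: linearZZ (cl q) k _.
Qed.

Lemma degree_part_homog d x : degree_part d x -> homog (sg q) d x.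
Proof.
move=> [p ph <-]; rewrite -[cls _ p]/(cl q p) cl_linear_ext /linear_ext.
elim/big_ind: _ => [|y z|w _]; [exact: Homog0|exact: HomogD|].
have [->|w0] := eqVneq (mcoeff w p) 0; first by rewrite scale0r; exact: Homog0.
by rewrite sword_prod; apply: HomogZ; rewrite ph.
Qed.
End DegreeParts.

Lemma ffun_add3 (I : finType) (V : zmodType) (f g h : {ffun I -> V}) i :
  (f + g + h) i = f i + g i + h i.
Proof. by rewrite !ffunE. Qed.

Lemma ffun_scaleE (I : finType) (C : fieldType) (V : lmodType C) (f : {ffun I -> V}) k i :
  (k *: f) i = k *: f i.
Proof. by rewrite !ffunE. Qed.

Lemma ffun_addE (I : finType) (V : zmodType) (f g : {ffun I -> V}) i :
  (f + g) i = f i + g i.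
Proof. by rewrite !ffunE. Qed.

Lemma sigma_row0 (C : fieldType) (V : lmodType C) (a b c d e f : V) :
  0 *: a + 1 *: b + (1 *: c + 0 *: d) + (0 *: e + 0 *: f) = 1 *: c + b.
Proof. by rewrite !scale0r !scale1r !addr0 add0r addrC. Qed.

Lemma sigma_row1 (C : fieldType) (V : lmodType C) (a b c d e f : V) :
  0 *: a + 0 *: b + (0 *: c + (-1) *: d) + (1 *: e + 0 *: f) = (-1) *: d + e.
Proof. by rewrite !scale0r !scale1r !addr0 !add0r. Qed.

Lemma lincomb_l (C : fieldType) (V : lmodType C) k l (x u v : V) :
  u = x -> v = 0 -> k *: u + l *: v = k *: x.
Proof. by move=> -> ->; rewrite scaler0 addr0. Qed.

Lemma lincomb_r (C : fieldType) (V : lmodType C) k l (x u v : V) :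
  u = 0 -> v = x -> k *: u + l *: v = l *: x.
Proof. by move=> -> ->; rewrite scaler0 add0r. Qed.

(** * The Dirac operator on columns and the existence of adapted kets *)

Section Columns.
Context (R : realType) (q : R) (q0 : 0 < q) (q1 : q < 1).
Local Notation C := (R[i]).
Local Notation A := (SUq2 q).

Lemma op_sigmaE (X : Uq q) (M : 'M[C]_2) (psi : column q) i :
  op_sigma X M psi i = M i ord0 *: lact X (psi ord0) + M i ord_max *: lact X (psi ord_max).
Proof.
rewrite ffunE big_ord_recl big_ord1.
by have -> : lift ord0 (ord0 : 'I_1) = ord_max by apply/val_inj.
Qed.

Lemma Dirac_pos (s : bool) (psi : column q) : Dirac psi (pos s) =
  (if s then 1 else -1) *: lact (Dzero q) (psi (pos s)) +
  lact (if s then Dplus q else Dminus q) (psi (pos (~~ s))).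
Proof.
have D i : Dirac psi i = op_sigma (Dplus q) (sigma_plus R) psi i
  + op_sigma (Dzero q) (sigma_zero R) psi i + op_sigma (Dminus q) (sigma_minus R) psi i.
  exact: ffun_add3.
apply: (etrans (D _)); have E := op_sigmaE.
apply: (etrans (congr2 +%R (congr2 +%R (E _ _ _ _) (E _ _ _ _)) (E _ _ _ _))).
have [p1 p2 p3 p4] : [/\ sigma_plus R ord0 ord0 = 0, sigma_plus R ord0 ord_max = 1,
    sigma_plus R ord_max ord0 = 0 & sigma_plus R ord_max ord_max = 0].
  by rewrite !mxE.
have [z1 z2 z3 z4] : [/\ sigma_zero R ord0 ord0 = 1, sigma_zero R ord0 ord_max = 0,
    sigma_zero R ord_max ord0 = 0 & sigma_zero R ord_max ord_max = -1].
  by rewrite !mxE /= ?(subr0, sub0r, subrr).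
have [m1 m2 m3 m4] : [/\ sigma_minus R ord0 ord0 = 0, sigma_minus R ord0 ord_max = 0,
    sigma_minus R ord_max ord0 = 1 & sigma_minus R ord_max ord_max = 0].
  by rewrite !mxE.
case: s; cbn [pos negb].
  by rewrite p1 p2 z1 z2 m1 m2; exact: sigma_row0.
by rewrite p3 p4 z3 z4 m3 m4; exact: sigma_row1.
Qed.

Lemma inS_same (s : bool) (p : A) : inS s p (pos s) = p.
Proof. by rewrite ffunE eqxx. Qed.

Lemma inS_other (s : bool) (p : A) : inS s p (pos (~~ s)) = 0.
Proof. by rewrite ffunE; case: s. Qed.

Lemma inS_other' (s : bool) (p : A) : inS (~~ s) p (pos s) = 0.
Proof. by rewrite ffunE; case: s. Qed.

Lemma column_eq (psi phi : column q) (s : bool) :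
  psi (pos s) = phi (pos s) -> psi (pos (~~ s)) = phi (pos (~~ s)) -> psi = phi.
Proof.
move=> h1 h2; apply/ffunP => i.
have [->|->] : i = pos s \/ i = pos (~~ s).
  case: (s); case: i => [[|[|//]] i2] /=;
    by [left; apply/val_inj|right; apply/val_inj].
- exact: h1.
- exact: h2.
Qed.

Definition SUq2_ket (s : bool) (k i : nat) : A := norm_ket q (sg q) (lop q0) s k i.
Local Notation ket := SUq2_ket.
Let H := SUq2_actionsP q0 q1.

Lemma ket_Spm s k i : Spm s (ket s k i).
Proof.
apply: homog_degree_part; have -> : (if s then -1 else 1 : int) = k.*2.+1%:Z - 2 * (k + s)%N%:Z.
  by case: s; lia.
rewrite /SUq2_ket /norm_ket; apply: homogZ; exact: (homog_vec H).
Qed.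

Lemma SUq2_ket_basis s : ket_basis (Spm s) (ket s).
Proof.
split=> [k i _|p hp|N c c0]; first exact: ket_Spm.
  apply: (ket_span q0 q1 H); apply: (homog_vec_span H); apply: degree_part_homog.
  by have -> : 1 - 2 * s%:Z = (if s then -1 else 1) by case: (s).
exact: (ket_free q0 q1 H c0).
Qed.

Lemma SUq2_ket_right s : standard_right (ket s).
Proof.
move=> k i ik; split.
- apply: (etrans (ract_gen q0 q1 GK (ket s k i))).
  by have E := K_ket_right q0 H s k i; apply: (etrans E).
- apply: (etrans (ract_gen q0 q1 GE (ket s k i))).
  by have E := L_ket_right q0 q1 H s ik; apply: (etrans E).
- apply: (etrans (ract_gen q0 q1 GF (ket s k i))).
  by have E := U_ket_right q0 q1 H s ik; apply: (etrans E).
Qed.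

Lemma jval_half k : jval R k + 2^-1 = k.+1%:R.
Proof. by rewrite /jval -natr1; field. Qed.

Lemma lact_Dplus_ket k i :
  lact (Dplus q) (ket false k i) = (qnum q k.+1%:R)%:C%C *: ket true k i.
Proof.
apply: (etrans (lact_Dplus q0 q1 _)); rewrite -hq_inv.
apply: (etrans (congr1 (fun x => _ *: lop q0 true GE x) (Ki_ket H false k i))).
apply: (etrans (congr1 ( *:%R _) (linearZZ (lop q0 true GE) _ _))).
apply: (etrans (scalerK (hq_neq0 q0) (lop q0 true GE (ket false k i)))).
by have E := U_ket q0 q1 (sg q) (lop q0) k i; apply: (etrans E).
Qed.

Lemma lact_Dminus_ket k i :
  lact (Dminus q) (ket true k i) = (qnum q k.+1%:R)%:C%C *: ket false k i.
Proof.
apply: (etrans (lact_Dminus q0 q1 _)); rewrite -hq_half.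
apply: (etrans (congr1 (fun x => _ *: lop q0 true GF x) (Ki_ket H true k i))).
apply: (etrans (congr1 ( *:%R _) (linearZZ (lop q0 true GF) _ _))).
apply: (etrans (scalerKV (hq_neq0 q0) (lop q0 true GF (ket true k i)))).
by have E := L_ket q0 q1 H k i; apply: (etrans E).
Qed.

(** The component of sign s comes from D_0 alone; the opposite one comes from D_- if s is plus and
    from D_+ if s is minus. *)
Lemma Dirac_ket (s : bool) k i : Dirac (inS s (ket s k i)) =
  ((if s then 1 else -1) * (q^-1 * nu q ^+ 2 * qnum q (jval R k) * qnum q (jval R k + 1)))%:C%C
    *: inS s (ket s k i) + (qnum q (jval R k + 2^-1))%:C%C *: inS (~~ s) (ket (~~ s) k i).
Proof.
have lact0 (X : Uq q) : lact X (0 : A) = 0.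
  have E := lact_is_linear q0 X (-1) 0 0.
  by move: E; rewrite scaler0 addr0 scaleN1r addNr.
apply: (@column_eq _ _ s).
  apply: (etrans (Dirac_pos _ _)).
  apply: (etrans (congr2 (fun u v => _ *: lact _ u + lact _ v) (inS_same s _) (inS_other s _))).
  apply: (etrans (congr1 (fun u => _ + u) (lact0 _))); apply: (etrans (addr0 _)).
  apply: esym; apply: (etrans (ffun_addE _ _ _)).
  apply: (etrans (congr2 +%R (ffun_scaleE _ _ _) (ffun_scaleE _ _ _))).
  apply: (etrans (lincomb_l _ _ (inS_same s _) (inS_other' s _))).
  apply: esym; apply: (etrans (congr1 ( *:%R _) (lact_Dzero q0 q1 _))).
  apply: (etrans (congr1 ( *:%R _) (D0_ket q0 q1 H s k i))).
  apply: (etrans (scalerA _ _ _)); apply: (congr1 (fun c => c *: ket s k i)).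
  by rewrite [RHS]rmorphM; case: (s); rewrite ?rmorph1 ?rmorphN1.
apply: (etrans (Dirac_pos _ _)); rewrite negbK.
apply: (etrans (congr2 (fun u v => _ *: lact _ u + lact _ v) (inS_other s _) (inS_same s _))).
apply: (etrans (congr1 (fun u => _ *: u + _) (lact0 _))).
apply: (etrans (congr1 (fun u => u + _) (scaler0 _ _))); apply: (etrans (add0r _)).
apply: esym; apply: (etrans (ffun_addE _ _ _)).
apply: (etrans (congr2 +%R (ffun_scaleE _ _ _) (ffun_scaleE _ _ _))).
apply: (etrans (lincomb_r _ _ (inS_other s _) (inS_same (~~ s) _))).
rewrite jval_half; apply: esym; case: (s).
  by have E := lact_Dminus_ket k i; apply: (etrans E).
by have E := lact_Dplus_ket k i; apply: (etrans E).
Qed.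

Theorem adapted_kets_exist : adapted_kets ket.
Proof.
split; [exact: SUq2_ket_basis|exact: SUq2_ket_right|].
by move=> s k i _; exact: Dirac_ket.
Qed.
End Columns.

(** * Diagonal operators on a Hilbert space *)

Lemma eq0_small (C : numFieldType) (t K : C) :
  (forall e : C, 0 < e -> `|t| <= K * e) -> t = 0.
Proof.
move=> h; apply/eqP/negPn/negP => t0.
have K0 : 0 <= K by have := h 1 ltr01; rewrite mulr1; apply: le_trans.
have K1 : 0 < K + 1 by rewrite ltr_wpDl.
have := h (`|t| / (K + 1)); rewrite divr_gt0 ?normr_gt0 // => /(_ isT).
rewrite mulrCA -[X in X <= _]mulr1 ler_pM2l ?normr_gt0 // ler_pdivlMr // mul1r.
by rewrite gerDl ler10.
Qed.

Section DiagonalOperator.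
Context (C : numClosedFieldType) (H : completeNormedModType C).
Context (dot : {dot H for @Num.conj C}) (I : eqType) (idx : nat -> seq I) (u : I -> H).
Hypothesis normE : forall x, `|x| ^+ 2 = dot x x.
Hypothesis idx_uniq : forall N, uniq (idx N).
Hypothesis idx_mono : forall M N, (M <= N)%N -> {subset idx M <= idx N}.
Hypothesis orth : forall N i j, i \in idx N -> j \in idx N ->
  dot (u i) (u j) = (i == j)%:R.

(** The increasing lists [idx N] exhaust the indices of an orthonormal basis, so finite combinations
    can be taken over one list. *)
Definition comb N (c : I -> C) : H := \sum_(i <- idx N) c i *: u i.
Hypothesis dense_comb : dense [set x | exists N c, x = comb N c].

Lemma dot_combl N c x : dot (comb N c) x = \sum_(i <- idx N) c i * dot (u i) x.
Proof.
rewrite /comb linear_sumlz; apply: eq_bigr => i _.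
by rewrite linearZl_LR.
Qed.

Lemma dot_comb N c j : j \in idx N -> dot (comb N c) (u j) = c j.
Proof.
move=> jN; rewrite dot_combl (bigD1_seq j) //= (orth jN jN) eqxx mulr1.
rewrite big1_seq ?addr0 // => i /andP[ij iN].
by rewrite (orth iN jN) (negPf ij) mulr0.
Qed.

Lemma dot_comb_out M N c j : j \in idx N -> j \notin idx M ->
  dot (comb M c) (u j) = 0.
Proof.
move=> jN jM; rewrite dot_combl big1_seq // => i /andP[_ iM].
have iX := idx_mono (leq_maxl M N) iM; have jX := idx_mono (leq_maxr M N) jN.
by rewrite (orth iX jX); case: (i =P j) => [ij|_]; [rewrite -ij iM in jM|rewrite mulr0].
Qed.

Lemma dot_conj x y : dot x y = (dot y x)^*.
Proof. by rewrite hermC expr0 mul1r. Qed.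

Lemma norm_comb N c : `|comb N c| ^+ 2 = \sum_(i <- idx N) `|c i| ^+ 2.
Proof.
rewrite normE dot_combl; apply: eq_big_seq => i iN.
by rewrite dot_conj dot_comb // -normCK.
Qed.

(** The finite-rank truncation of the diagonal operator with multipliers m. *)
Definition mulop (m : I -> C) N x := comb N (fun i => m i * dot x (u i)).

Lemma mulop_linear m N : linear (mulop m N).
Proof.
move=> k x y; rewrite /mulop /comb scaler_sumr -big_split /=.
apply: eq_bigr => i _.
by rewrite linearPl scalerA -scalerDl mulrDr mulrCA.
Qed.

Lemma mulopB m N x y : mulop m N (x - y) = mulop m N x - mulop m N y.
Proof.
by rewrite addrC -scaleN1r mulop_linear scaleN1r addrC.
Qed.

Lemma mulop_comb m M N c : (M <= N)%N -> mulop m N (comb M c) = comb M (fun i => m i * c i).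
Proof.
move=> MN; rewrite /mulop /comb.
rewrite (bigID (mem (idx M))) /= [X in _ + X]big1_seq ?addr0.
  rewrite -big_filter (perm_big (idx M)) /=; last first.
    apply: uniq_perm => [||i]; rewrite ?filter_uniq //.
    by rewrite mem_filter; case iM: (i \in idx M) => //=; apply: idx_mono iM.
  by apply: eq_big_seq => i iM; rewrite dot_comb.
by move=> i /andP[iM iN]; rewrite (dot_comb_out _ iN iM) mulr0 scale0r.
Qed.

(** Pythagoras for the orthogonal projection p of x and the remainder r = x - p. *)
Lemma bessel N x : \sum_(i <- idx N) `|dot x (u i)| ^+ 2 <= `|x| ^+ 2.
Proof.
have r0 j : j \in idx N -> dot (x - comb N (fun i => dot x (u i))) (u j) = 0.
  by move=> jN; rewrite linearBl /= dot_comb // subrr.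
set p := comb N _ in r0; set r := x - p in r0.
have pr : dot p r = 0.
  rewrite dot_combl big1_seq // => i /andP[_ iN].
  by rewrite [dot (u i) r]dot_conj r0 // conjC0 mulr0.
rewrite -norm_comb -/p !normE.
have -> : dot x x = dot p p + dot r r.
  by rewrite -hnormDd // /r addrC subrK.
by rewrite lerDl dnorm_ge0.
Qed.

Lemma dot_norm N x i : i \in idx N -> `|dot x (u i)| <= `|x|.
Proof.
move=> iN; rewrite -(ler_pXn2r (n := 2)) ?nnegrE //; apply: le_trans (bessel N x).
by rewrite (bigD1_seq i) //= lerDl sumr_ge0 // => j _; rewrite exprn_ge0.
Qed.

Definition bounded_by (m : I -> C) (B : C) := forall N i, i \in idx N -> `|m i| <= B.

Lemma mulop_norm m B N x : 0 <= B -> bounded_by m B -> `|mulop m N x| <= B * `|x|.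
Proof.
move=> B0 mB; rewrite -(ler_pXn2r (n := 2)) ?nnegrE ?mulr_ge0 //.
rewrite norm_comb exprMn; apply: le_trans (_ : B ^+ 2 * \sum_(i <- idx N) `|dot x (u i)| ^+ 2 <= _).
  rewrite mulr_sumr !big_seq; apply: ler_sum => i iN.
  rewrite normrM exprMn ler_wpM2r ?exprn_ge0 // ler_pXn2r ?nnegrE //.
  exact: mB iN.
by rewrite ler_wpM2l ?exprn_ge0 // bessel.
Qed.

Lemma comb_approx x (e : C) : 0 < e -> exists N c, `|x - comb N c| < e.
Proof.
move=> e0; have [|v [xv [N [c vE]]]] := dense_comb _ (ball_open x e).
  by exists x; exact: ballxx.
by exists N, c; rewrite -vE; move: xv; rewrite -ball_normE.
Qed.

(** The truncations are bounded by B uniformly in N and are eventually constant on a finite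
    combination close to x, so they form a Cauchy sequence at x. *)
Lemma mulop_cvg m B x : 0 <= B -> bounded_by m B -> cvgn (mulop m ^~ x).
Proof.
move=> B0 mB; apply/cauchy_cvgP/cauchy_exP => e e0.
(* B may be 0, so the tolerance is divided by B + 1. *)
have B1 : 0 < B + 1 by rewrite ltr_wpDl.
have [M [c xc]] := comb_approx x (divr_gt0 e0 B1).
exists (comb M (fun i => m i * c i)); exists M => // N /= MN.
rewrite -ball_normE /= -(mulop_comb _ _ MN) -normrN opprB -mulopB.
apply: le_lt_trans (mulop_norm _ _ B0 mB) _.
apply: le_lt_trans (_ : (B + 1) * `|x - comb M c| < e); first by rewrite ler_wpM2r ?lerDl.
by rewrite mulrC -ltr_pdivlMr.
Qed.

Definition diagop m x := limn (mulop m ^~ x).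

Lemma diagop_cvg m B x : 0 <= B -> bounded_by m B -> mulop m ^~ x @ \oo --> diagop m x.
Proof. by move=> B0 mB; exact: mulop_cvg B0 mB. Qed.

Let one : I -> C := fun=> 1.

Lemma bounded_one : bounded_by one 1.
Proof. by move=> *; rewrite normr1. Qed.

Lemma mulop_one_comb M N c : (M <= N)%N -> mulop one N (comb M c) = comb M c.
Proof. by move=> MN; rewrite mulop_comb //; apply: eq_bigr => i _; rewrite mul1r. Qed.

(** Fourier expansion: the truncations have norm at most 1 and eventually fix each finite
    combination, and these are dense. *)
Lemma mulop_one_cvg x : mulop one ^~ x @ \oo --> x.
Proof.
apply/cvgrPdist_lt => e e0.
have e2 : 0 < e / 2 by rewrite divr_gt0.
have [M [c xc]] := comb_approx x e2.
exists M => // N /= MN.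
have -> : x - mulop one N x = (x - comb M c) - mulop one N (x - comb M c).
  by rewrite mulopB mulop_one_comb // opprB addrA subrK.
apply: le_lt_trans (ler_normB _ _) _.
apply: le_lt_trans (lerD (lexx _) (mulop_norm _ _ ler01 bounded_one)) _.
by rewrite mul1r -mulr2n -mulr_natr -ltr_pdivlMr.
Qed.

Lemma diagop_linear m B : 0 <= B -> bounded_by m B -> linear (diagop m).
Proof.
move=> B0 mB k x y; apply: cvg_lim => //.
have -> : mulop m ^~ (k *: x + y) = (fun N => k *: mulop m N x + mulop m N y).
  by apply/funext => N; rewrite mulop_linear.
apply: cvgD; last exact: diagop_cvg B0 mB.
by apply: cvgZl_tmp; exact: diagop_cvg B0 mB.
Qed.

Lemma diagop_norm m B x : 0 <= B -> bounded_by m B -> `|diagop m x| <= B * `|x|.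
Proof.
move=> B0 mB.
have ge0 : 0 <= B * `|x| by rewrite mulr_ge0.
rewrite real_leNgt ?ger0_real //; apply/negP => lt.
have e0 : 0 < `|diagop m x| - B * `|x| by rewrite subr_gt0.
have /cvgrPdist_lt/(_ _ e0)[N _ /(_ N (leqnn _))] := diagop_cvg (x := x) B0 mB.
move=> /= h; have := le_lt_trans (lerB_dist _ _) h.
rewrite ltrD2l ltrN2 => /lt_le_trans/(_ (mulop_norm N x B0 mB)).
by rewrite ltxx.
Qed.

(** * The closure of a diagonal operator and its spectrum *)

Context (lam : I -> C) (G : set (H * H)).
Hypothesis graphE : G =
  [set p | exists N c, p = (comb N c, comb N (fun i => lam i * c i))].
Local Notation T := (closure G).

Definition valid i := exists N, i \in idx N.

Lemma graph_comb N c : T (comb N c, comb N (fun i => lam i * c i)).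
Proof. by apply: subset_closure; rewrite graphE; exists N, c. Qed.

Lemma graph_cvg (a b : nat -> H) x y : (forall N, T (a N, b N)) ->
  a @ \oo --> x -> b @ \oo --> y -> T (x, y).
Proof.
move=> ab ax bx; have near_ab : \forall N \near \oo, T (a N, b N) by exists 0%N.
exact: (closed_cvg T (@closed_closure _ G) near_ab (x, y) (cvg_pair ax bx)).
Qed.

(** Coordinates are continuous, so the relation passes from finite combinations to the closure. *)
Lemma graph_coef x y i : valid i -> T (x, y) -> dot y (u i) = lam i * dot x (u i).
Proof.
move=> [N iN] xy; apply/eqP; rewrite -subr_eq0; apply/eqP.
apply: (@eq0_small _ _ (1 + `|lam i|)) => e e0.
have [] := xy (ball (x, y) e); first exact: nbhsx_ballx.
rewrite graphE => -[a b] [[M [c [-> ->]]]].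
rewrite /ball /= /prod_ball /= -!ball_normE /= => -[xa yb].
set a' := comb M c in xa *; set b' := comb M _ in yb *.
have ab : dot b' (u i) = lam i * dot a' (u i).
  have iX := idx_mono (leq_maxr M N) iN.
  have [iM|iM] := boolP (i \in idx M); first by rewrite !dot_comb.
  by rewrite !(dot_comb_out _ iX iM) mulr0.
have -> : dot y (u i) - lam i * dot x (u i) = dot (y - b') (u i) - lam i * dot (x - a') (u i).
  by rewrite !linearBl /= ab mulrBr opprB addrA subrK.
apply: le_trans (ler_normB _ _) _; rewrite mulrDl mul1r normrM; apply: lerD.
  exact: le_trans (dot_norm _ iN) (ltW yb).
by rewrite ler_wpM2l //; exact: le_trans (dot_norm _ iN) (ltW xa).
Qed.

Lemma comb_unit N i : i \in idx N -> comb N (fun j => (j == i)%:R) = u i.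
Proof.
move=> iN; rewrite /comb (bigD1_seq i) //= eqxx scale1r big1 ?addr0 // => j /negPf ->.
by rewrite scale0r.
Qed.

(** An inverse of T - lam i would send 0 to the unit vector u i. *)
Lemma eigenvalue_spectrum i : valid i -> spectrum T (lam i).
Proof.
move=> [N iN] [Rz [_ _ /(_ (u i) (lam i *: u i))]].
have h : T (u i, lam i *: u i).
  have := @graph_comb N (fun j => (j == i)%:R).
  have -> : comb N (fun j => lam j * (j == i)%:R) = lam i *: u i.
    rewrite -(comb_unit iN) /comb scaler_sumr; apply: eq_bigr => j _.
    by rewrite scalerA; case: eqP => [->|_] //; rewrite !mulr0.
  by rewrite comb_unit.
move=> /(_ h); rewrite subrr linear0 => ui0.
by have := orth iN iN; rewrite -ui0 linear0l eqxx => /eqP; rewrite eq_sym oner_eq0.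
Qed.

(** The inverse is the bounded diagonal operator with multipliers 1 / (lam i - z). Its values lie in
    the domain of the closure as limits of truncations within the graph; that it undoes T - z is
    read off the coordinates by [graph_coef]. *)
Lemma resolvent_bounded z (B : C) : 0 <= B -> (forall i, valid i -> lam i != z) ->
  (forall i, valid i -> `|(lam i - z)^-1| <= B) -> resolvent_set T z.
Proof.
move=> B0 lz lB; pose m i := (lam i - z)^-1.
have mB : bounded_by m B by move=> N i iN; apply: lB; exists N.
pose Rz : {linear H -> H} := HB.pack (diagop m)
  (GRing.isLinear.Build _ _ _ _ (diagop m) (diagop_linear B0 mB)).
exists Rz; split.
- apply: bounded_linear_continuous; apply/linear_boundedP.
  exists B; split=> [|r Br x]; first exact: ger0_real.
  by apply: le_trans (diagop_norm x B0 mB) _; rewrite ler_wpM2r // ltW.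
- move=> y; have my := @diagop_cvg m B y B0 mB.
  refine (graph_cvg (a := mulop m ^~ y) (b := fun N => mulop one N y + z *: mulop m N y) _ my _).
    move=> N; have -> : mulop one N y + z *: mulop m N y =
        comb N (fun i => lam i * (m i * dot y (u i))); last by exact: (@graph_comb N).
    rewrite /mulop /comb scaler_sumr -big_split /=; apply: eq_big_seq => i iN.
    rewrite scalerA -scalerDl /one mul1r !mulrA -[X in X + _]mul1r -mulrDl; congr (_ * _ *: _).
    have d0 : lam i - z != 0 by rewrite subr_eq0; apply: lz; exists N.
    by rewrite -[in LHS](mulfV d0) -mulrDl subrK.
  exact: cvgD (@mulop_one_cvg y) (cvgZl_tmp my).
- move=> x y xy; apply: cvg_lim => //.
  have -> : mulop m ^~ (y - z *: x) = mulop one ^~ x; last exact: mulop_one_cvg.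
  apply/funext => N; apply: eq_big_seq => i iN.
  have iv : valid i by exists N.
  rewrite linearBl /= linearZl_LR /= (graph_coef iv xy) -mulrBl mulrA mulVf ?mul1r //.
  by rewrite subr_eq0 lz.
Qed.

Lemma diag_eigenspace z (s : seq I) N : uniq s -> {subset s <= idx N} ->
  (forall i, valid i -> (lam i == z) = (i \in s)) ->
  has_dimension (graph_eigenspace T z) (size s).
Proof.
move=> su sN sz; exists (fun j => u (tnth (in_tuple s) j)); split; last first.
  move=> c c0 j.
  have vs k : tnth (in_tuple s) k \in s by exact: mem_tnth.
  have := congr1 (dot ^~ (u (tnth (in_tuple s) j))) c0; rewrite /= linear0l linear_sumlz (bigD1 j) //=.
  rewrite linearZl_LR /= (orth (sN _ (vs j)) (sN _ (vs j))) eqxx mulr1.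
  rewrite big1 ?addr0 // => k kj.
  rewrite linearZl_LR /= (orth (sN _ (vs k)) (sN _ (vs j))).
  by rewrite (inj_eq (tuple_uniqP (in_tuple s) su)) (negPf kj) mulr0.
move=> x; split=> [xz|[c ->]].
  exists (fun j => dot x (u (tnth (in_tuple s) j))).
  (* The coordinates satisfy (lam i - z) x_i = 0, so only those in s survive and the Fourier sums of
     x are eventually constant. *)
  apply: (cvg_unique _ (@mulop_one_cvg x)) => //.
  apply: cvg_near_cst; exists N => // M /= NM.
  rewrite -(big_tnth _ _ s xpredT (fun i => dot x (u i) *: u i)) /mulop /comb.
  rewrite (bigID (mem s)) /= [X in _ + X]big1_seq ?addr0.
    rewrite -big_filter (perm_big s) /=; first by apply: eq_bigr => i _; rewrite mul1r.
    apply: uniq_perm => [||i]; rewrite ?filter_uniq //.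
    rewrite mem_filter; case is_: (i \in s) => //=.
    by apply: (idx_mono NM); exact: sN.
  move=> i /andP[is_ iM]; have iv : valid i by exists M.
  have := graph_coef iv xz; rewrite linearZl_LR /= => /eqP.
  rewrite -subr_eq0 -mulrBl mulf_eq0 subr_eq0 eq_sym (sz _ iv) (negPf is_) /= => /eqP ->.
  by rewrite mulr0 scale0r.
have := @graph_comb N (fun i => \sum_j c j * (i == tnth (in_tuple s) j)%:R).
have E (w : 'I_(size s) -> C) : comb N (fun i => \sum_j w j * (i == tnth (in_tuple s) j)%:R) =
    \sum_j w j *: u (tnth (in_tuple s) j).
  rewrite /comb; under eq_bigr do rewrite scaler_suml.
  rewrite exchange_big; apply: eq_bigr => j _.
  rewrite -[in RHS](comb_unit (sN _ (mem_tnth j (in_tuple s)))) /comb scaler_sumr.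
  by apply: eq_bigr => i _; rewrite scalerA.
rewrite /graph_eigenspace /= E.
have -> // : comb N (fun i => lam i * \sum_j c j * (i == tnth (in_tuple s) j)%:R) =
  z *: \sum_j c j *: u (tnth (in_tuple s) j).
rewrite -E /comb scaler_sumr; apply: eq_big_seq => i iN.
rewrite scalerA; congr (_ *: _); rewrite !mulr_sumr; apply: eq_bigr => j _.
case: eqP => [ij|_]; last by rewrite !mulr0.
have iv : valid i by exists N.
have /eqP -> // : lam i == z by rewrite (sz _ iv) ij mem_tnth.
Qed.

Hypothesis lam_infty : forall A : C, 0 <= A ->
  exists N, forall i, valid i -> i \notin idx N -> A <= `|lam i|.

(** If z is not an eigenvalue, then beyond some finite list |lam i| >= |z| + 1, so 1 / (lam i - z)
    has modulus at most 1 there; on the list it is bounded by a finite sum. *)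
Theorem diag_spectrum : spectrum T = [set z | exists2 i, valid i & z = lam i].
Proof.
apply/seteqP; split=> z /=; last by case=> i iv ->; exact: eigenvalue_spectrum.
move=> zs; apply: contrapT => nz; apply: zs.
have lz i : valid i -> lam i != z.
  by move=> iv; apply/eqP => E; apply: nz; exists i.
have [N hN] := lam_infty (addr_ge0 (normr_ge0 z) ler01).
have B0 : 0 <= \sum_(i <- idx N) `|(lam i - z)^-1| by exact: sumr_ge0.
refine (@resolvent_bounded z (1 + \sum_(i <- idx N) `|(lam i - z)^-1|) _ lz _).
  exact: addr_ge0.
move=> i iv; have [iN|iN] := boolP (i \in idx N).
  rewrite (bigD1_seq i) //= addrCA lerDl addr_ge0 //; exact: sumr_ge0.
apply: le_trans (_ : 1 <= _); last by rewrite lerDl.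
rewrite normfV invf_le1 ?normr_gt0 ?subr_eq0 ?lz //.
rewrite -(lerD2l `|z|); apply: le_trans (hN _ iv iN) _.
by rewrite addrC -[X in `|X| <= _](subrK z) ler_normD.
Qed.
End DiagonalOperator.

(** * Direct sums of planes *)

Lemma reflection_comb (K : comNzRingType) (V : lmodType K) (al be a b : K) (x y : V) :
  a *: (al *: x + be *: y) + b *: (- al *: y + be *: x) =
  (al * a + be * b) *: x + (be * a - al * b) *: y.
Proof.
rewrite [X in b *: X]addrC !scalerDr !scalerA addrACA -!scalerDl.
by congr (_ *: _ + _ *: _); ring.
Qed.

Section TwoLevel.
Context (R : realType).
Local Notation C := (R[i]).
Context (H : completeNormedModType C) (dot : {dot H for @Num.conj C}).
Context (V : lmodType C) (Sp : set V) (D : V -> V) (iota_ : V -> H).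
Context (d : nat -> nat) (f : bool -> nat * nat -> V) (alpha beta lambda : nat -> R).

Definition levels N : seq (nat * nat) := [seq (k, i) | k <- iota 0 N, i <- iota 0 (d k)].
(** A level (k, i) stands for a pair (j, m); it carries a plane, whose two eigenvectors are told
    apart by the boolean. *)
Definition level_idx N : seq (nat * nat * bool) :=
  [seq (p, s) | p <- levels N, s <- [:: true; false]].

Lemma mem_levels N k i : ((k, i) \in levels N) = (k < N)%N && (i < d k)%N.
Proof.
apply/allpairsPdep/andP => [[k' [i' []]]|[kN id]]; last first.
  by exists k, i; rewrite !mem_iota !add0n.
by rewrite !mem_iota !add0n => ? ? [-> ->].
Qed.

Lemma mem_level_idx N p s : ((p, s) \in level_idx N) = (p \in levels N).
Proof.
apply/allpairsP/idP => [[[p' s'] /= [pN _ [-> _]]] //|pN].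
by exists (p, s); split => //; case: s.
Qed.

Lemma levels_mono M N : (M <= N)%N -> {subset levels M <= levels N}.
Proof.
by move=> MN [k i]; rewrite !mem_levels => /andP[kM ->]; rewrite (leq_trans kM).
Qed.

Lemma levels_uniq N : uniq (levels N).
Proof.
by apply: allpairs_uniq_dep => [|k _|[k i] [k' i'] _ _ [-> ->]] //; rewrite iota_uniq.
Qed.

Lemma level_idx_uniq N : uniq (level_idx N).
Proof. by apply: allpairs_uniq => [||[? ?] [? ?] _ _ [-> ->]] //; exact: levels_uniq. Qed.

Lemma level_idx_mono M N : (M <= N)%N -> {subset level_idx M <= level_idx N}.
Proof. by move=> MN [p s]; rewrite !mem_level_idx; exact: levels_mono. Qed.

Lemma big_level_idx (W : nmodType) N (F : nat * nat * bool -> W) :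
  \sum_(x <- level_idx N) F x = \sum_(p <- levels N) (F (p, true) + F (p, false)).
Proof.
rewrite /level_idx big_allpairs; apply: eq_bigr => p _.
by rewrite big_cons big_seq1.
Qed.

Lemma big_levels (W : nmodType) N (F : nat -> nat -> W) :
  \sum_(p <- levels N) F p.1 p.2 = \sum_(k < N) \sum_(i < d k) F k i.
Proof.
have big_iota M (G : nat -> W) : \sum_(k <- iota 0 M) G k = \sum_(k < M) G k.
  by rewrite -(big_mkord xpredT) /index_iota subn0.
by rewrite /levels big_allpairs_dep big_iota; apply: eq_bigr => k _; rewrite big_iota.
Qed.

Definition pcomb (W : lmodType C) (g : bool -> nat * nat -> W) N (a b : nat * nat -> C) :=
  \sum_(p <- levels N) (a p *: g true p + b p *: g false p).

Definition is_level p := (p.2 < d p.1)%N.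

Lemma levels_is_level N p : p \in levels N -> is_level p.
Proof. by case: p => k i; rewrite mem_levels => /andP[]. Qed.

Hypothesis Sp0 : Sp 0.
Hypothesis SpP : forall k x y, Sp x -> Sp y -> Sp (k *: x + y).
Hypothesis Sp_f : forall s p, is_level p -> Sp (f s p).
Hypothesis Sp_span : forall x, Sp x -> exists N a b, x = pcomb f N a b.
Hypothesis D_linear : linear D.
Hypothesis D_f : forall s p, is_level p ->
  D (f s p) = ((if s then 1 else -1) * alpha p.1)%:C%C *: f s p + (beta p.1)%:C%C *: f (~~ s) p.
Hypothesis iotaP : forall k x y, Sp x -> Sp y ->
  iota_ (k *: x + y) = k *: iota_ x + iota_ y.

Let h s p := iota_ (f s p).

Lemma Sp_pcomb N a b : Sp (pcomb f N a b).
Proof.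
rewrite /pcomb big_seq; apply: big_ind => // [x y xS yS|p pN].
  by rewrite -[x]scale1r; exact: SpP.
have pl := levels_is_level pN.
by apply: SpP; [exact: Sp_f|rewrite -[_ *: _]addr0; apply: SpP => //; exact: Sp_f].
Qed.

Lemma iota0 : iota_ 0 = 0.
Proof.
have := iotaP 1 Sp0 Sp0; rewrite !scale1r addr0 => /eqP.
by rewrite -[X in X == _]addr0 (inj_eq (addrI _)) => /eqP.
Qed.

Lemma iota_pcomb N a b : iota_ (pcomb f N a b) = pcomb h N a b.
Proof.
suff E : iota_ (pcomb f N a b) = pcomb h N a b /\ Sp (pcomb f N a b) by case: E.
rewrite /pcomb !big_seq; apply: (big_ind2 (fun x y => iota_ x = y /\ Sp x)) => [|x _ y _ [<- xS] [<- yS]|p pN].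
- by split=> //; exact: iota0.
- have SpD := SpP 1 xS yS; have iD := iotaP 1 xS yS; rewrite !scale1r in SpD iD.
  by split.
have pl := levels_is_level pN; have fS s := Sp_f s pl.
have fbS : Sp (b p *: f false p) by rewrite -[_ *: _]addr0; exact: SpP.
split; last exact: SpP.
by rewrite iotaP // -[b p *: _]addr0 iotaP // iota0 !addr0.
Qed.

Lemma D_pcomb N a b : D (pcomb f N a b) =
  pcomb f N (fun p => (alpha p.1)%:C%C * a p + (beta p.1)%:C%C * b p)
    (fun p => (beta p.1)%:C%C * a p - (alpha p.1)%:C%C * b p).
Proof.
pose DL : {linear V -> V} := HB.pack D (GRing.isLinear.Build _ _ _ _ D D_linear).
have DE x : D x = DL x by [].
rewrite /pcomb DE linear_sum; apply: eq_big_seq => p pN.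
have pl := levels_is_level pN.
rewrite [DL _]linearD [DL (a p *: _)]linearZ [DL (b p *: _)]linearZ /= -!/(D _) !D_f //=.
have -> : (-1 * alpha p.1)%:C%C = - (alpha p.1)%:C%C by rewrite mulN1r rmorphN.
rewrite mul1r; exact: reflection_comb.
Qed.

Hypothesis normE : forall x : H, `|x| ^+ 2 = dot x x.
Hypothesis dot_h : forall s p s' p', is_level p -> is_level p' ->
  dot (h s p) (h s' p') = ((s, p) == (s', p'))%:R.
Hypothesis dense_Sp : dense (iota_ @` Sp).
Hypothesis beta_gt0 : forall k, 0 < beta k.
Hypothesis lambdaE : forall k, lambda k = Num.sqrt (alpha k ^+ 2 + beta k ^+ 2).

(* The reflection [[alpha, beta], [beta, -alpha]] / lambda has the eigenvector   *)
(* (beta, lambda - alpha), i.e. (cos, sin) of half its angle after normalisation. *)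
Let nrm k := Num.sqrt (beta k ^+ 2 + (lambda k - alpha k) ^+ 2).
Let cs k := beta k / nrm k.
Let sn k := (lambda k - alpha k) / nrm k.

Lemma lambda_sqr k : lambda k ^+ 2 = alpha k ^+ 2 + beta k ^+ 2.
Proof. by rewrite lambdaE sqr_sqrtr // addr_ge0 ?sqr_ge0. Qed.

Lemma lambda_gt0 k : 0 < lambda k.
Proof. by rewrite lambdaE sqrtr_gt0 ltr_wpDl ?sqr_ge0 // exprn_gt0. Qed.

Lemma nrm_sqr k : nrm k ^+ 2 = beta k ^+ 2 + (lambda k - alpha k) ^+ 2.
Proof. by rewrite sqr_sqrtr // addr_ge0 ?sqr_ge0. Qed.

Lemma nrm_neq0 k : nrm k != 0.
Proof. by rewrite gt_eqF // sqrtr_gt0 ltr_pwDl ?sqr_ge0 // exprn_gt0. Qed.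

Lemma cs_sn1 k : cs k ^+ 2 + sn k ^+ 2 = 1.
Proof. by rewrite !expr_div_n -mulrDl -nrm_sqr divff // expf_neq0 // nrm_neq0. Qed.

Lemma half_angle1 k : alpha k * cs k + beta k * sn k = lambda k * cs k.
Proof. by rewrite /cs /sn; ring. Qed.

Lemma half_angle2 k : beta k * cs k - alpha k * sn k = lambda k * sn k.
Proof.
rewrite /cs /sn !mulrA -mulrBl; congr (_ / _).
(* Up to the common denominator: beta^2 - alpha (lambda - alpha) = lambda (lambda - alpha). *)
by have := lambda_sqr k; rewrite !expr2 => E; rewrite !mulrBr E; ring.
Qed.

Definition eigvec (x : nat * nat * bool) : H :=
  let: (p, s) := x in if s then (cs p.1)%:C%C *: h true p + (sn p.1)%:C%C *: h false p
  else (- sn p.1)%:C%C *: h true p + (cs p.1)%:C%C *: h false p.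

Definition eigval (x : nat * nat * bool) : C :=
  ((if x.2 then 1 else -1) * lambda x.1.1)%:C%C.

Lemma dot_hcomb (a b a' b' : R) p p' : is_level p -> is_level p' ->
  dot (a%:C%C *: h true p + b%:C%C *: h false p) (a'%:C%C *: h true p' + b'%:C%C *: h false p')
  = (a * a' + b * b')%:C%C * (p == p')%:R.
Proof.
have conj_real (r : R) : Num.conj (r%:C%C : C) = r%:C%C by exact: conjc_real.
have dotZr x k y : dot x (k *: y) = k^* * dot x y by exact: linearZr_LR.
move=> pl pl'; rewrite linearDl /= !linearDr /= !linearZl_LR /= !dotZr !dot_h //.
rewrite !xpair_eqE /= !mulr0 addr0 add0r !conj_real rmorphD !rmorphM mulrDl.
by rewrite !mulrA.
Qed.

Lemma dot_eigvec N x y : x \in level_idx N -> y \in level_idx N ->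
  dot (eigvec x) (eigvec y) = (x == y)%:R.
Proof.
case: x y => [p s] [p' s']; rewrite !mem_level_idx => /levels_is_level pl /levels_is_level pl'.
have E := cs_sn1 p.1; rewrite xpair_eqE /eigvec.
have [<-|pp'] := eqVneq p p'; last by case: s s' => -[]; rewrite dot_hcomb // (negPf pp') mulr0.
case: s s' => -[]; rewrite dot_hcomb // eqxx mulr1 /=.
- by rewrite -!expr2 E.
- by rewrite mulrN [X in _ + X]mulrC addNr.
- by rewrite mulNr [X in _ + X]mulrC addNr.
- by rewrite mulrNN addrC -!expr2 E.
Qed.

(** [coef1] and [coef2] rotate coordinates in the eigenvectors back to coordinates in the two
    original vectors of each plane. *)
Definition coef1 (c : nat * nat * bool -> C) (p : nat * nat) : C :=
  (cs p.1)%:C%C * c (p, true) - (sn p.1)%:C%C * c (p, false).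
Definition coef2 (c : nat * nat * bool -> C) (p : nat * nat) : C :=
  (sn p.1)%:C%C * c (p, true) + (cs p.1)%:C%C * c (p, false).

Lemma comb_eigvec N c : comb level_idx eigvec N c = pcomb h N (coef1 c) (coef2 c).
Proof.
rewrite /comb big_level_idx; apply: eq_bigr => p _ /=.
rewrite rmorphN /= !scalerDr !scalerA addrACA -!scalerDl.
by rewrite mulrN ![c _ * _]mulrC.
Qed.

Lemma pcomb_coef N c : D (pcomb f N (coef1 c) (coef2 c)) =
  pcomb f N (coef1 (fun x => eigval x * c x)) (coef2 (fun x => eigval x * c x)).
Proof.
rewrite D_pcomb; apply: eq_bigr => p _.
have h1 : (alpha p.1)%:C%C * (cs p.1)%:C%C + (beta p.1)%:C%C * (sn p.1)%:C%C =
    (lambda p.1)%:C%C * (cs p.1)%:C%C by rewrite -!rmorphM -rmorphD half_angle1.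
have h2 : (beta p.1)%:C%C * (cs p.1)%:C%C - (alpha p.1)%:C%C * (sn p.1)%:C%C =
    (lambda p.1)%:C%C * (sn p.1)%:C%C by rewrite -!rmorphM -rmorphB half_angle2.
have e1 : eigval (p, true) = (lambda p.1)%:C%C by rewrite /eigval mul1r.
have e2 : eigval (p, false) = - (lambda p.1)%:C%C by rewrite /eigval mulN1r rmorphN.
rewrite /coef1 /coef2 e1 e2; move: h1 h2.
move: (alpha _)%:C%C (beta _)%:C%C (cs _)%:C%C (sn _)%:C%C (lambda _)%:C%C (c (p, true)) (c (p, false)).
move=> al be co si la x y h1 h2; congr (_ *: _ + _ *: _).
  transitivity ((al * co + be * si) * x + (be * co - al * si) * y); first by ring.
  by rewrite h1 h2; ring.
transitivity ((be * co - al * si) * x - (al * co + be * si) * y); first by ring.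
by rewrite h1 h2; ring.
Qed.

Lemma Sp_eigvec_span x : Sp x -> exists N c, x = pcomb f N (coef1 c) (coef2 c).
Proof.
move=> /Sp_span[N [a [b ->]]]; exists N.
(* The rotation inverse to [coef1] and [coef2]. *)
exists (fun x => if x.2 then (cs x.1.1)%:C%C * a x.1 + (sn x.1.1)%:C%C * b x.1
  else (cs x.1.1)%:C%C * b x.1 - (sn x.1.1)%:C%C * a x.1).
apply: eq_bigr => p _; rewrite /coef1 /coef2 /=.
have := congr1 (real_complex R) (cs_sn1 p.1); rewrite /= rmorphD !rmorphXn rmorph1 /=.
move: (cs _)%:C%C (sn _)%:C%C (a p) (b p) => co si x' y' E.
congr (_ *: _ + _ *: _).
  transitivity ((co ^+ 2 + si ^+ 2) * x'); last by ring.
  by rewrite E mul1r.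
transitivity ((co ^+ 2 + si ^+ 2) * y'); last by ring.
by rewrite E mul1r.
Qed.

Local Notation G := [set (iota_ x, iota_ (D x)) | x in Sp].

Lemma level_graph : G = [set p | exists N c,
  p = (comb level_idx eigvec N c, comb level_idx eigvec N (fun i => eigval i * c i))].
Proof.
apply/seteqP; split=> [_ [x xS <-]|_ [N [c ->]]] /=.
  have [N [c ->]] := Sp_eigvec_span xS; exists N, c.
  by rewrite !comb_eigvec pcomb_coef !iota_pcomb.
exists (pcomb f N (coef1 c) (coef2 c)); first exact: Sp_pcomb.
by rewrite !comb_eigvec pcomb_coef !iota_pcomb.
Qed.

Lemma dense_eigvec : dense [set x | exists N c, x = comb level_idx eigvec N c].
Proof.
move=> O O0 Oo; have [y [Oy [x xS xy]]] := dense_Sp O0 Oo.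
exists y; split=> //; rewrite -xy; have [N [c ->]] := Sp_eigvec_span xS.
by exists N, c; rewrite comb_eigvec iota_pcomb.
Qed.

Hypothesis d_gt0 : forall k, (0 < d k)%N.
Hypothesis lambda_mono : {homo lambda : k l / (k < l)%N >-> k < l}.
Hypothesis lambda_infty : forall A : R, exists N, A <= lambda N.

Lemma valid_level p s : valid level_idx (p, s) <-> is_level p.
Proof.
split=> [[N]|pl]; first by rewrite mem_level_idx => /levels_is_level.
by exists p.1.+1; rewrite mem_level_idx; case: p pl => k i pl; rewrite mem_levels ltnSn.
Qed.

Lemma eigval_infty (A : C) : 0 <= A ->
  exists N, forall x, valid level_idx x -> x \notin level_idx N -> A <= `|eigval x|.
Proof.
move=> A0; have [N AN] := lambda_infty (complex.Re A); exists N => -[[k i] s] /valid_level pl.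
rewrite mem_level_idx mem_levels andbC [X in X && _]pl /= -leqNgt => Nk.
have -> : `|eigval ((k, i), s)| = (lambda k)%:C%C.
  have l0 : 0 <= (lambda k)%:C%C by rewrite lecR ltW // lambda_gt0.
  by rewrite /eigval; case: (s); rewrite /= ?mul1r ?mulN1r ?rmorphN ?normrN ger0_norm.
(* A nonnegative complex number is real, so the bound found for its real part serves for A. *)
have <- : (complex.Re A)%:C%C = A by apply: RRe_real; exact: ger0_real.
rewrite lecR (le_trans AN) //; move: Nk; rewrite leq_eqVlt.
by case/predU1P => [<-|/lambda_mono/ltW].
Qed.

(** Positivity of lambda separates the signs and strict monotonicity the levels, so an eigenspace
    never mixes different k. *)
Lemma eigval_eq k s x : (eigval x == ((if s then 1 else -1) * lambda k)%:C%C) =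
  (x.1.1 == k) && (x.2 == s).
Proof.
have inj (a b : R) : (a%:C%C == b%:C%C) = (a == b) by exact: (inj_eq (@complexI R)).
have lk j l : (lambda j == lambda l) = (j == l).
  by case: (ltngtP j l) => [/lambda_mono/lt_eqF|/lambda_mono/gt_eqF|->] //; rewrite eqxx.
have ll j l : lambda j != - lambda l.
  by rewrite gt_eqF // (lt_trans _ (lambda_gt0 j)) // oppr_lt0 lambda_gt0.
rewrite /eigval inj; case: x => [[j i] t] /=.
case: s t => -[]; rewrite ?mul1r ?mulN1r ?eqr_opp ?lk ?andbT ?andbF //.
- by rewrite eqr_oppLR (negPf (ll _ _)).
- exact/negbTE/ll.
Qed.

Theorem two_level_spectrum :
  spectrum (closure G) =
    [set z | exists k, z = (lambda k)%:C%C \/ z = (- lambda k)%:C%C] /\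
  forall k s, has_dimension
    (graph_eigenspace (closure G) ((if s then 1 else -1) * lambda k)%:C%C) (d k).
Proof.
split.
  rewrite (diag_spectrum normE level_idx_uniq level_idx_mono dot_eigvec dense_eigvec
    level_graph eigval_infty).
  apply/seteqP; split=> z /=.
    move=> [[[k i] s] _ ->]; exists k; rewrite /eigval.
    by case: s; [left; rewrite mul1r|right; rewrite mulN1r].
  move=> [k kz]; pose s := `[< z = (lambda k)%:C%C >].
  (* Index 0 is available at every level because d k is positive. *)
  exists ((k, 0%N), s); first by apply/valid_level; exact: d_gt0.
  rewrite /eigval /s; case: asboolP => /= [->|nz]; first by rewrite mul1r.
  by case: kz => [//|->]; rewrite mulN1r.
move=> k s; pose e := [seq ((k, i), s) | i <- iota 0 (d k)].
have mem_e x : (x \in e) = [&& x.1.1 == k, x.2 == s & (x.1.2 < d k)%N].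
  apply/mapP/and3P => [[j]|]; first by rewrite mem_iota add0n => idk ->; rewrite !eqxx.
  by case: x => [[k' i] s'] /= [/eqP -> /eqP -> idk]; exists i => //; rewrite mem_iota.
have -> : d k = size e by rewrite size_map size_iota.
refine (diag_eigenspace (N := k.+1) normE level_idx_uniq level_idx_mono dot_eigvec
  dense_eigvec level_graph _ _ _).
- by rewrite map_inj_uniq ?iota_uniq // => ? ? [].
- move=> x xe; move: (mem_e x); rewrite xe => /esym/and3P[].
  by case: x {xe} => [[k' i] s'] /= /eqP -> _ id_; rewrite mem_level_idx mem_levels ltnSn.
move=> x xv; rewrite eigval_eq; have := mem_e x; case: x xv => [[k' i] s'] /valid_level /= pl ->.
by case: eqP pl => [-> pl|] //=; rewrite [(i < d k)%N]pl andbT.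
Qed.
End TwoLevel.

(** * The Dirac operator *)

Lemma lincomb_comb (K : comNzRingType) (V : lmodType K) (c k : K) (a b a1 b1 : V) :
  c *: (k *: a + b) + (k *: a1 + b1) = k *: (c *: a + a1) + (c *: b + b1).
Proof. by rewrite !scalerDr !scalerA [c * k]mulrC addrACA. Qed.

Section DiracSpectrum.
Context (R : realType) (q : R) (q0 : 0 < q) (q1 : q < 1).
Local Notation C := (R[i]).

Lemma qnum_homo : {homo qnum q : x y / x <= y}.
Proof.
move=> x y xy; rewrite /qnum ler_nM2r ?invr_lt0 ?nu_lt0 //.
have q01 : 0 < q <= 1 by rewrite q0 ltW.
by apply: lerB; apply: (ger_powR q01); rewrite ?lerN2.
Qed.

Lemma qnum_pos x : 0 <= x -> 0 <= qnum q x.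
Proof. by move=> /qnum_homo; have := qnum0 q0 => /= ->. Qed.

Definition level_diag k := q^-1 * nu q ^+ 2 * qnum q (jval R k) * qnum q (jval R k + 1).
Definition level_offdiag k := qnum q (jval R k + 2^-1).

Lemma level_offdiag_gt0 k : 0 < level_offdiag k.
Proof. by rewrite /level_offdiag jval_half qnum_gt0. Qed.

Lemma level_diag_homo k : 0 <= level_diag k <= level_diag k.+1.
Proof.
have j0 : 0 <= jval R k by rewrite addr_ge0.
have jS : jval R k <= jval R k.+1 by rewrite lerD2r ler_nat.
have jS1 : jval R k + 1 <= jval R k.+1 + 1 by rewrite lerD2r.
have c0 : 0 <= q^-1 * nu q ^+ 2 by rewrite mulr_ge0 ?sqr_ge0 // invr_ge0 ltW.
have n0 : 0 <= qnum q (jval R k) by exact: qnum_pos.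
have n1 : 0 <= qnum q (jval R k + 1) by apply: qnum_pos; exact: addr_ge0.
rewrite /level_diag; apply/andP; split; first by do 2![apply: mulr_ge0 => //].
apply: ler_pM => //; [exact: mulr_ge0| |exact: qnum_homo].
by apply: ler_wpM2l => //; exact: qnum_homo.
Qed.

Lemma Dirac_evE k : Dirac_ev q k = Num.sqrt (level_diag k ^+ 2 + level_offdiag k ^+ 2).
Proof.
by rewrite /Dirac_ev /level_diag -exprVn; congr Num.sqrt; rewrite -/(level_offdiag k); ring.
Qed.

(** The entry [k+1] increases strictly, and the nonnegative diagonal entry does not decrease. *)
Lemma Dirac_ev_mono : {homo Dirac_ev q : k l / (k < l)%N >-> k < l}.
Proof.
apply: homo_ltn => [x y z|k]; first exact: lt_trans.
have [/andP[a0 aS] b0] := (level_diag_homo k, level_offdiag_gt0 k).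
have bS : level_offdiag k < level_offdiag k.+1 by rewrite /level_offdiag !jval_half qnum_lt.
rewrite !Dirac_evE ltr_sqrt; last by rewrite ltr_wpDl ?sqr_ge0 // exprn_gt0 // (lt_trans b0).
have h : level_diag k ^+ 2 <= level_diag k.+1 ^+ 2.
  by rewrite ler_pXn2r // nnegrE // (le_trans a0).
by apply: ler_ltD => //; rewrite ltr_pXn2r // nnegrE ltW // (lt_trans b0).
Qed.

(** The eigenvalue dominates its off-diagonal entry [N+1], which is at least q^-N. *)
Lemma Dirac_ev_infty A : exists N, A <= Dirac_ev q N.
Proof.
have e0 : 0 < (`|A| + 1)^-1 by rewrite invr_gt0 ltr_wpDl.
have q_lt1 : `|q| < 1 by rewrite ger0_norm // ltW.
have /cvgrPdist_lt/(_ _ e0)[N _ /(_ N (leqnn _))] := cvg_geometric 1 q_lt1.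
rewrite /= sub0r normrN mul1r ger0_norm ?exprn_ge0 1?ltW // => qN.
exists N; apply: le_trans (ler_norm A) _; apply: le_trans (_ : `|A| + 1 <= _).
  by rewrite lerDl.
have qN0 : 0 < q ^+ N by rewrite exprn_gt0.
apply: le_trans (_ : q ^- N <= _).
  by rewrite -[leLHS]invrK lef_pV2 ?posrE // ltW.
apply: (le_trans (qnum_ge q0 q1 N)).
rewrite -jval_half -/(level_offdiag N) Dirac_evE.
rewrite -[leLHS]ger0_norm ?(ltW (level_offdiag_gt0 N)) // -sqrtr_sqr ler_sqrt.
  by rewrite lerDr sqr_ge0.
by rewrite addr_ge0 ?sqr_ge0.
Qed.

Lemma degree_part_lin d (k : C) (x y : SUq2 q) :
  degree_part d x -> degree_part d y -> degree_part d (k *: x + y).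
Proof.
move=> [u uh <-] [v vh <-]; exists (k *: u + v); last exact: linearP (cl q) k u v.
move=> w; rewrite mcoeffD mcoeffZ => kw.
have [u0|u0] := eqVneq (mcoeff w u) 0; last exact: uh.
by apply: vh; move: kw; rewrite u0 mulr0 add0r.
Qed.

Lemma Spinor_lin (k : C) (x y : column q) : Spinor x -> Spinor y -> Spinor (k *: x + y).
Proof.
move=> xS yS s; have -> : (k *: x + y) (pos s) = k *: x (pos s) + y (pos s).
  by apply: (etrans (ffun_addE _ _ _)); apply: (congr1 (fun z => z + _)); exact: ffun_scaleE.
exact: degree_part_lin (xS s) (yS s).
Qed.

Lemma degree_part0 d : degree_part d (0 : SUq2 q).
Proof. by apply: homog_degree_part; exact: Homog0. Qed.

Lemma Spinor0 : Spinor (0 : column q).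
Proof.
move=> s; have -> : (0 : column q) (pos s) = 0 by rewrite ffunE.
exact: degree_part0.
Qed.

Lemma Spinor_inS s p : Spm s p -> Spinor (inS s p : column q).
Proof.
move=> sp t; have [->|->] : t = s \/ t = ~~ s by case: (t); case: (s); [left|right|right|left].
  by rewrite inS_same.
by rewrite inS_other; exact: degree_part0.
Qed.

Lemma Dirac_linear : linear (@Dirac R q).
Proof.
move=> k x y; have E s : Dirac (k *: x + y) (pos s) = (k *: Dirac x + Dirac y) (pos s).
  apply: (etrans (Dirac_pos _ _)); apply: esym; apply: (etrans (ffun_addE _ _ _)).
  apply: (etrans (congr2 +%R (ffun_scaleE _ _ _) (erefl _))).
  apply: (etrans (congr2 (fun u v => _ *: u + v) (Dirac_pos _ _) (Dirac_pos _ _))).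
  have pE t : (k *: x + y) (pos t) = k *: x (pos t) + y (pos t).
    by apply: (etrans (ffun_addE _ _ _)); apply: (congr1 (fun z => z + _)); exact: ffun_scaleE.
  have lE X t : lact X ((k *: x + y) (pos t)) = k *: lact X (x (pos t)) + lact X (y (pos t)).
    by apply: (etrans (congr1 (lact X) (pE t))); exact: lact_is_linear.
  apply: esym; apply: (etrans (congr2 (fun u v => _ *: u + v) (lE _ _) (lE _ _))).
  exact: lincomb_comb.
by apply: (column_eq (s := true)); exact: E.
Qed.

Lemma inS_linear s : linear (@inS R q s).
Proof.
move=> k x y; apply: (column_eq (s := s)).
  apply: (etrans (inS_same _ _)); apply: esym; apply: (etrans (ffun_addE _ _ _)).
  apply: (etrans (congr2 +%R (ffun_scaleE _ _ _) (inS_same _ _))).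
  by apply: (congr1 (fun u => k *: u + _)); exact: inS_same.
apply: (etrans (inS_other _ _)); apply: esym; apply: (etrans (ffun_addE _ _ _)).
apply: (etrans (congr2 +%R (ffun_scaleE _ _ _) (inS_other _ _))).
by apply: (etrans (congr1 (fun u => k *: u + 0) (inS_other _ _))); rewrite addr0 scaler0.
Qed.

Lemma column_split (x : column q) : x = inS true (x (pos true)) + inS false (x (pos false)).
Proof.
apply: (column_eq (s := true)); apply: esym; apply: (etrans (ffun_addE _ _ _)).
  exact: (etrans (congr2 +%R (inS_same true _) (inS_other' true _)) (addr0 _)).
exact: (etrans (congr2 +%R (inS_other true _) (inS_same false _)) (add0r _)).
Qed.

Section Kets.
Context (ket : bool -> nat -> nat -> SUq2 q).
Hypothesis kets : adapted_kets ket.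
Let f s (p : nat * nat) : column q := inS s (ket s p.1 p.2).

(** The expansion holds at every large truncation, so that the two components of a spinor can share
    one. *)
Lemma ket_expand s x : Spm s x -> exists N (c : nat * nat -> C),
  forall M, (N <= M)%N -> x = \sum_(p <- levels mult M) c p *: ket s p.1 p.2.
Proof.
case: kets => /(_ s)[_ + _] _ _ => /(_ x) h xs; have [N [c ->]] := h xs.
exists N, (fun p => if (p.1 < N)%N then c p.1 p.2 else 0) => M NM.
rewrite (big_levels mult M (fun k i => (if (k < N)%N then c k i else 0) *: ket s k i)).
apply: (etrans (big_ord_widen M (fun k => \sum_(i < mult k) c k i *: ket s k i) NM)).
apply: (etrans (big_mkcond _ _)); apply: eq_bigr => k _; case: (k < N)%N => //.
by apply: esym; apply: big1 => i _; exact: scale0r.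
Qed.

Lemma Spinor_span x : Spinor x -> exists N a b, x = pcomb mult f N a b.
Proof.
move=> xS; have [N [c cE]] := ket_expand (xS true); have [M [e eE]] := ket_expand (xS false).
exists (maxn N M), c, e; apply: (etrans (column_split x)).
apply: (etrans (congr2 (fun u v => inS true u + inS false v)
  (cE _ (leq_maxl N M)) (eE _ (leq_maxr N M)))).
have inS_sum s (a : nat * nat -> C) :
    inS s (\sum_(p <- levels mult (maxn N M)) a p *: ket s p.1 p.2) =
    \sum_(p <- levels mult (maxn N M)) a p *: f s p.
  pose L : {linear SUq2 q -> column q} :=
    HB.pack (@inS R q s) (GRing.isLinear.Build _ _ _ _ (@inS R q s) (inS_linear s)).
  apply: (etrans (linear_sum L _ _ _)); apply: eq_bigr => p _; exact: linearZZ L _ _.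
apply: (etrans (congr2 +%R (inS_sum true c) (inS_sum false e))).
by apply: esym; exact: big_split.
Qed.

Lemma Spinor_ket s p : is_level mult p -> Spinor (f s p).
Proof. by case: kets => /(_ s)[kS _ _] _ _ pl; apply: Spinor_inS; exact: kS. Qed.

Lemma Dirac_ket_level s p : is_level mult p -> Dirac (f s p) =
  ((if s then 1 else -1) * level_diag p.1)%:C%C *: f s p
  + (level_offdiag p.1)%:C%C *: f (~~ s) p.
Proof. by case: kets => _ _ DE pl; exact: DE. Qed.

Context (H : completeNormedModType C) (dot : {dot H for @Num.conj C}) (iota_ : column q -> H).
Hypothesis completion : spinor_completion ket dot iota_.

Lemma dot_iota_ket s p s' p' : is_level mult p -> is_level mult p' ->
  dot (iota_ (f s p)) (iota_ (f s' p')) = ((s, p) == (s', p'))%:R.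
Proof.
case: completion => _ _ orth _ pl pl'; have E := orth s p.1 p.2 s' p'.1 p'.2 pl pl'.
by apply: (etrans E); case: p p' {pl pl' E} => [k i] [k' i']; rewrite !xpair_eqE andbA.
Qed.

Theorem Dirac_spectrum : let D := closure (Dirac_graph iota_) in
  spectrum D =
    [set z | exists k, z = (Dirac_ev q k)%:C%C \/ z = (- Dirac_ev q k)%:C%C] /\
  forall k s, has_dimension
    (graph_eigenspace D ((if s then 1 else -1) * Dirac_ev q k)%:C%C) (mult k).
Proof.
case: (completion) => normE iotaP _ dense_S.
have mult_gt0 k : (0 < mult k)%N by [].
exact: (two_level_spectrum Spinor0 Spinor_lin Spinor_ket Spinor_span Dirac_linear Dirac_ket_level
  iotaP normE dot_iota_ket dense_S level_offdiag_gt0 Dirac_evE mult_gt0 Dirac_ev_mono Dirac_ev_infty).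
Qed.
End Kets.
End DiracSpectrum.

Theorem corollary5p5 (R : realType) (q : R) (q0 : 0 < q) (q1 : q < 1) :
  (exists ket : bool -> nat -> nat -> SUq2 q, adapted_kets ket) /\
  forall (ket : bool -> nat -> nat -> SUq2 q)
    (H : completeNormedModType R[i]) (dot : {dot H for @Num.conj R[i]})
    (iota : column q -> H),
  adapted_kets ket -> spinor_completion ket dot iota ->
  let D := closure (Dirac_graph iota) in
  spectrum D =
    [set z | exists k, z = (Dirac_ev q k)%:C%C \/ z = (- Dirac_ev q k)%:C%C] /\
  forall k,
    has_dimension (graph_eigenspace D (Dirac_ev q k)%:C%C) (mult k) /\
    has_dimension (graph_eigenspace D (- Dirac_ev q k)%:C%C) (mult k).
Proof.
split; first by exists (SUq2_ket q0); exact: adapted_kets_exist.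
move=> ket H dot iota_ kets completion D.
have [spec dim] := Dirac_spectrum q0 q1 kets completion.
split=> [|k]; first exact: spec.
by have := (dim k true, dim k false); rewrite mul1r mulN1r => -[].
Qed.
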